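(* Let $d\in\{2,3\}$, $\alpha\ge0$, and let $\Gamma^h(t)$, $t\in[0,T]$, be an evolving polyhedral surface with discrete velocity $\vec w^h$. Let $(\overline{\varkappa}^h,\vec w^h,\vec k^h,\lambda^h,\vec p^h,\lambda_A^h,\lambda_V^h)$, with $\overline{\varkappa}^h\in\mathbb V_T^h(\mathcal G_T^h)$ and $\vec k^h\in[\mathbb V_T^h(\mathcal G_T^h)]^d$, satisfy the semidiscrete Helfrich system (S1)--(S6) together with the discrete transport equation (S7) (all given in the context). Then $$\frac{\rm d}{{\rm d}t}|\Gamma^h(t)|=0,\qquad\frac{\rm d}{{\rm d}t}\operatorname{vol}(\Gamma^h(t))=0,$$ and the semidiscrete bending energy $\mathcal E^h_{\overline{\varkappa}^h}(\Gamma^h(t))=\frac12\bigl(|\vec k^h|^2,1\bigr)^h_{\Gamma^h}$ satisfies $$\frac{\rm d}{{\rm d}t}\mathcal E^h_{\overline{\varkappa}^h}(\Gamma^h(t))+\bigl(\vec w^h\cdot\vec\nu^h,\vec w^h\cdot\vec\nu^h\bigr)^h_{\Gamma^h}=0 .$$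
   Context: Evolving polyhedral surface: $\Gamma^h(t)=\bigcup_{j=1}^J\overline{\sigma_j^h(t)}\subset\mathbb R^d$, with $\mathcal T^h(t)=\{\sigma_j^h(t)\}$ mutually disjoint, consistently oriented, nondegenerate $(d-1)$-simplices of time-independent connectivity, with vertices $\vec q_k^h(t)$, $k=1,\dots,K$, of class $C^1$ in time. The boundary is $\partial\Gamma^h(t)=\partial_1\Gamma^h(t)\cup\partial_2\Gamma^h(t)$ (disjoint partition, empty in the closed case) with $\partial_i\Gamma^h(t)=\partial_i\Gamma^h(0)$. $\vec\nu^h$ is the elementwise constant unit normal (pointing out of the enclosed region whose volume is considered), $P_{\Gamma^h}={\rm Id}-\vec\nu^h\otimes\vec\nu^h=\nabla_s\vec{\rm id}$ elementwise. $|\Gamma^h(t)|$ is the surface area; $\operatorname{vol}(\Gamma^h(t))$ is the volume enclosed by $\Gamma^h(t)$ in the closed case, and in the open case the volume enclosed by the union of $\Gamma^h(t)$ and a fixed, time-independent capping surface with the same boundary. Spaces: $\mathbb V^h(\Gamma^h(t))$ = continuous functions on $\Gamma^h(t)$ affine on each simplex, with nodal basis $\phi_k^h(\cdot,t)$; $\mathbb V_0^h$, $\mathbb V_{\partial_1}^h$ = the subspaces vanishing on $\partial\Gamma^h(t)$, resp. on $\partial_1\Gamma^h(t)$. $\vec\mu_\partial^h$ is a given time-independent vector field on $\partial_2\Gamma^h$, each component being the trace of a function in $\mathbb V^h(\Gamma^h(t))$. The discrete velocity is $\vec w^h(\cdot,t)=\sum_k\frac{{\rm d}\vec q_k^h}{{\rm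 d}t}(t)\,\phi_k^h(\cdot,t)$. With $\mathcal G_T^h=\bigcup_{t}(\Gamma^h(t)\times\{t\})$, the discrete material derivative $\partial_t^{\circ,h}$ is, elementwise, the time derivative following the motion of the simplices with velocity $\vec w^h$ (so $\partial_t^{\circ,h}\phi_k^h=0$). $\mathbb V_T^h(\mathcal G_T^h)$ = functions $\chi\in C(\mathcal G_T^h)$ with $\chi(\cdot,t)\in\mathbb V^h(\Gamma^h(t))$ for all $t$ and $\partial_t^{\circ,h}\chi\in C(\mathcal G_T^h)$. Inner products: $(f,g)_{\Gamma^h}=\sum_j\int_{\sigma_j^h}fg\,{\rm d}\mathcal H^{d-1}$; mass-lumped $(f,g)^h_{\Gamma^h}=\frac1d\sum_j\mathcal H^{d-1}(\sigma_j^h)\sum_{k=0}^{d-1}\lim_{\sigma_j^h\ni\vec x\to\vec q^h_{j_k}}f(\vec x)g(\vec x)$, with $\vec q^h_{j_k}$ the vertices of $\sigma_j^h$; both extend to vectors and to matrices (with $A:B={\rm tr}(A^TB)$). $(\cdot,\cdot)_{\partial_2\Gamma^h}$ is the $L^2$ inner product on $\partial_2\Gamma^h$. Notation: $\nabla_s$ is the elementwise surface gradient, $(\nabla_s\vec\varphi)_{ij}$ the $j$-th component of $\nabla_s\varphi_i$, $\nabla_s\cdot\vec\varphi={\rm tr}\nabla_s\vec\varphi$, $\mathcal D(\vec\chi)=\nabla_s\vec\chi+(\nabla_s\vec\chi)^T$, $\vec{\rm id}$ the identity map on $\Gamma^h(t)$. $\mathcal C_h(\overline{\varkappa}^h;\vec\chi^h)\in\mathbb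 V^h(\Gamma^h(t))$ is defined by $(\mathcal C_h(\overline{\varkappa}^h;\vec\chi^h),\varphi^h)^h_{\Gamma^h}=(\vec\chi^h\cdot\nabla_s\overline{\varkappa}^h,\varphi^h)^h_{\Gamma^h}$ for all $\varphi^h\in\mathbb V^h(\Gamma^h(t))$. The form $\mathcal B_h$ is $$\begin{aligned}\mathcal B_h(\vec k^h,\overline{\varkappa}^h;\vec\chi^h)={}&-(\nabla_s\vec k^h,\nabla_s\vec\chi^h)_{\Gamma^h}-(\nabla_s\cdot\vec k^h,\nabla_s\cdot\vec\chi^h)_{\Gamma^h}+((\nabla_s\vec k^h)^T,\mathcal D(\vec\chi^h)(\nabla_s\vec{\rm id})^T)^h_{\Gamma^h}\\&-(\tfrac12|\vec k^h|^2+\overline{\varkappa}^h\vec\nu^h\cdot\vec k^h,\nabla_s\vec{\rm id}:\nabla_s\vec\chi^h)^h_{\Gamma^h}+(\overline{\varkappa}^h(\nabla_s\vec\chi^h)^T\vec\nu^h,\vec k^h)^h_{\Gamma^h}-(\mathcal C_h(\overline{\varkappa}^h;\vec\chi^h)\vec\nu^h,\vec k^h)^h_{\Gamma^h}.\end{aligned}$$ Semidiscrete Helfrich system: for all $t\in(0,T]$, $(\vec w^h,\vec k^h,\lambda^h,\vec p^h,\lambda_A^h,\lambda_V^h)\in[\mathbb V_0^h]^d\times[\mathbb V_{\partial_1}^h]^d\times\mathbb V_0^h\times[\mathbb V_0^h]^d\times\mathbb R\times\mathbb R$ (spaces on $\Gamma^h(t)$), $\vec w^h$ being the velocity of $\Gamma^h(t)$,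 and for all $(\vec\chi^h,\vec\eta^h,\rho^h,\vec\xi^h)\in[\mathbb V_0^h]^d\times[\mathbb V_{\partial_1}^h]^d\times\mathbb V_0^h\times[\mathbb V_0^h]^d$: (S1) $0=(\vec w^h\cdot\vec\nu^h,\vec\chi^h\cdot\vec\nu^h)^h_{\Gamma^h}+\mathcal B_h(\vec k^h,\overline{\varkappa}^h;\vec\chi^h)+(P_{\Gamma^h}\vec\chi^h,\vec p^h)^h_{\Gamma^h}+\alpha(\nabla_s\vec\chi^h,\nabla_s\vec p^h)_{\Gamma^h}+\lambda_A^h(\vec k^h+\overline{\varkappa}^h\vec\nu^h,\vec\chi^h)^h_{\Gamma^h}+\lambda_V^h(\vec\chi^h,\vec\nu^h)^h_{\Gamma^h}$; (S2) $0=(\vec k^h+\overline{\varkappa}^h\vec\nu^h,\vec\eta^h)^h_{\Gamma^h}+(\nabla_s\vec{\rm id},\nabla_s\vec\eta^h)_{\Gamma^h}-(\vec\mu_\partial^h,\vec\eta^h)_{\partial_2\Gamma^h}$; (S3) $0=(\rho^h\vec\nu^h,\vec p^h)^h_{\Gamma^h}$; (S4) $0=(P_{\Gamma^h}\vec w^h,\vec\xi^h)^h_{\Gamma^h}+(\lambda^h\vec\nu^h,\vec\xi^h)^h_{\Gamma^h}+\alpha(\nabla_s\vec w^h,\nabla_s\vec\xi^h)_{\Gamma^h}$; (S5) $0=(\vec w^h,\vec\nu^h)^h_{\Gamma^h}$; (S6) $0=(\vec k^h+\overline{\varkappa}^h\vec\nu^h,\vec w^h)^h_{\Gamma^h}$.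 Discrete transport: (S7) $0=(\partial_t^{\circ,h}\overline{\varkappa}^h,\varphi^h)^h_{\Gamma^h}-(\vec w^h\cdot\nabla_s\overline{\varkappa}^h,\varphi^h)^h_{\Gamma^h}$ for all $\varphi^h\in\mathbb V^h(\Gamma^h(t))$. *)

(* Defs.v *)
From HB Require Import structures.
From mathcomp Require Import all_boot all_order all_algebra perm.
From mathcomp Require Import all_classical all_reals all_analysis.
Set Implicit Arguments.
Unset Strict Implicit.
Unset Printing Implicit Defensive.
Import Order.TTheory GRing.Theory Num.Theory.
Import numFieldNormedType.Exports.
Local Open Scope classical_set_scope.
Local Open Scope ring_scope.

(* The ambient dimension is d = n.+2, so that the simplices have dimension
   n.+1 = d - 1 and their facets dimension n = d - 2.  Vectors of R^d are
   columns. *)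

Section Euclidean.
Context {R : realType}.

Definition dot {d} (u v : 'cV[R]_d) : R := (u^T *m v) 0 0.

(* The norm that the library puts on matrices is the sup norm. *)
Definition enorm d (u : 'cV[R]_d) : R := Num.sqrt (dot u u).

Definition frob {d} (A B : 'M[R]_d) : R := \tr (A^T *m B).

(* Lebesgue integral over R^p, as an iterated integral; R^0 is a point. *)
Fixpoint leb_int (p : nat) : ('cV[R]_p -> \bar R) -> \bar R :=
  match p return ('cV[R]_p -> \bar R) -> \bar R with
  | 0 => fun f => f 0
  | p'.+1 => fun f => (\int[@lebesgue_measure R]_x
      leb_int (fun y : 'cV[R]_p' => f (col_mx (const_mx x : 'cV[R]_1) y)))%E
  end.

Definition leb_vol p (A : set 'cV[R]_p) : \bar R :=
  leb_int (fun x => (\1_A x)%:E).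

Definition ref_simplex p : set 'cV[R]_p :=
  [set s | (forall k, 0 < s k 0) /\ \sum_k s k 0 < 1].

Definition edge_mx d p (v : 'I_p.+1 -> 'cV[R]_d) : 'M[R]_(d, p) :=
  \matrix_(i, k) (v (lift ord0 k) i 0 - v ord0 i 0).

(* Integral with respect to the p-dimensional Hausdorff measure over the open
   simplex with vertices v 0, ..., v p, through its affine parametrization
   s |-> v 0 + E s, whose area element is sqrt (det (E^T E)). *)
Definition simplex_int d p (v : 'I_p.+1 -> 'cV[R]_d) (F : 'cV[R]_d -> R) : R :=
  let E := edge_mx v in
  Num.sqrt (\det (E^T *m E)) *
  fine (leb_int (fun s => (\1_(ref_simplex (p := p)) s
                           * F (v ord0 + E *m s))%:E)).

End Euclidean.

Record mesh (R : realType) (n J K : nat) := Mesh {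
  elt : 'I_J -> 'I_n.+2 -> 'I_K ;
  vtx : 'I_K -> 'cV[R]_n.+2
}.

Section Mesh.
Context {R : realType} {n J K : nat}.
Variable M : mesh R n J K.
Local Notation vec := 'cV[R]_n.+2.

Definition combination (b : 'I_K -> R) : vec := \sum_k b k *: vtx M k.

Definition weights (F : {set 'I_K}) (b : 'I_K -> R) :=
  (forall k, k \notin F -> b k = 0) /\ \sum_k b k = 1.

Definition cell (F : {set 'I_K}) : set vec :=
  [set x | exists b, [/\ weights F b, forall k, 0 <= b k & x = combination b]].

Definition open_cell (F : {set 'I_K}) : set vec :=
  [set x | exists b,
    [/\ weights F b, forall k, k \in F -> 0 < b k & x = combination b]].

Definition vset (j : 'I_J) : {set 'I_K} := [set elt M j i | i in 'I_n.+2].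

Definition verts (j : 'I_J) : 'I_n.+2 -> vec := fun i => vtx M (elt M j i).

Definition surface : set vec := [set x | exists j, cell (vset j) x].

(* The facet of the j-th simplex opposite to its a-th vertex. *)
Definition facet (j : 'I_J) (a : 'I_n.+2) : {set 'I_K} :=
  [set elt M j i | i in predC1 a].

Definition facet_verts (j : 'I_J) (a : 'I_n.+2) : 'I_n.+1 -> vec :=
  fun i => vtx M (elt M j (lift a i)).

Definition boundary_facet (j : 'I_J) (a : 'I_n.+2) : bool :=
  [forall i : 'I_J, (i != j) ==>
    [forall b : 'I_n.+2, facet i b != facet j a]].

Definition boundary : set vec :=
  [set x | exists j a, boundary_facet j a /\ cell (facet j a) x].

(* Replacing, in the ordered simplex i, its a-th vertex by the remaining vertex
   of a simplex j sharing the facet opposite to it gives a reordering of j;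
   the orientations agree iff this reordering is odd.  In particular a facet
   belongs to at most two simplices. *)
Definition consistently_oriented :=
  forall (i j : 'I_J) (a : 'I_n.+2) (s : {perm 'I_n.+2}), i != j ->
    (forall k, k != a -> elt M j (s k) = elt M i k) -> odd_perm s.

Definition polyhedral_surface :=
  [/\ forall j, \rank (edge_mx (verts j)) = n.+1,
      forall i j, i != j -> open_cell (vset i) `&` open_cell (vset j) = set0,
      forall i j, cell (vset i) `&` cell (vset j) = cell (vset i :&: vset j),
      forall k, exists j i, elt M j i = k
    & consistently_oriented].

(* Generalized cross product of the edges: its direction is determined by the
   ordering of the vertices, which [encloses] below requires to be outward. *)
Definition wedge (j : 'I_J) : vec :=
  \col_i \det (row_mx (delta_mx i 0 : vec) (edge_mx (verts j)) : 'M[R]_n.+2).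

Definition normal (j : 'I_J) : vec := (enorm (wedge j))^-1 *: wedge j.

Definition proj (j : 'I_J) : 'M[R]_n.+2 := 1%:M - normal j *m (normal j)^T.

Definition Vh (f : vec -> R) :=
  {within surface, continuous f} /\
  forall j, exists (a : vec) (c : R),
    forall x, cell (vset j) x -> f x = dot a x + c.

Definition Vh0 (f : vec -> R) := Vh f /\ forall x, boundary x -> f x = 0.

Definition vectorial (V : (vec -> R) -> Prop) (f : vec -> vec) :=
  forall i, V (fun x => f x i 0).

Definition nodal_basis (k : 'I_K) : vec -> R :=
  xget (fun=> 0) [set f | Vh f /\ forall l, f (vtx M l) = (l == k)%:R].

(* An elementwise field assigns to each simplex j a function of x, whose values
   matter only on that simplex. *)

(* The i-th component of the surface gradient is the derivative in the tangent
   direction P e_i. *)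
Definition sgrad (f : vec -> R) (j : 'I_J) (x : vec) : vec :=
  \col_i 'D_(col i (proj j)) f x.

Definition sgradv (f : vec -> vec) (j : 'I_J) (x : vec) : 'M[R]_n.+2 :=
  \matrix_(i, l) sgrad (fun y => f y i 0) j x l 0.

Definition sdiv (f : vec -> vec) (j : 'I_J) (x : vec) : R := \tr (sgradv f j x).

Definition symgrad (f : vec -> vec) (j : 'I_J) (x : vec) : 'M[R]_n.+2 :=
  sgradv f j x + (sgradv f j x)^T.

Definition elt_area (j : 'I_J) : R := simplex_int (verts j) (fun=> 1).

Definition area : R := \sum_j elt_area j.

(* The inner products (f, g) and (f, g)^h, for scalar, vector or matrix fields
   according to the pairing op, which is multiplication, dot or frob. *)
Definition ip (V : Type) (op : V -> V -> R) (f g : 'I_J -> vec -> V) : R :=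
  \sum_j simplex_int (verts j) (fun x => op (f j x) (g j x)).

Definition iph (V : Type) (op : V -> V -> R) (f g : 'I_J -> vec -> V) : R :=
  (n.+2)%:R^-1 * \sum_j elt_area j * \sum_i
    lim (op (f j x) (g j x)
         @[x --> within (open_cell (vset j)) (nbhs (verts j i))]).

Definition boundary_ip (D : set vec) (f g : vec -> vec) : R :=
  \sum_j \sum_(a | boundary_facet j a)
    simplex_int (facet_verts j a) (fun x => \1_D x * dot (f x) (g x)).

Definition Ch (kap : vec -> R) (chi : vec -> vec) : vec -> R :=
  xget (fun=> 0) [set c | Vh c /\ forall phi, Vh phi ->
    iph *%R (fun=> c) (fun=> phi) =
    iph *%R (fun j x => dot (chi x) (sgrad kap j x)) (fun=> phi)].

Definition Bh (k : vec -> vec) (kap : vec -> R) (chi : vec -> vec) : R :=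
  - ip frob (sgradv k) (sgradv chi)
  - ip *%R (sdiv k) (sdiv chi)
  + iph frob (fun j x => (sgradv k j x)^T)
             (fun j x => symgrad chi j x *m (sgradv id j x)^T)
  - iph *%R (fun j x => 2^-1 * dot (k x) (k x) + kap x * dot (normal j) (k x))
            (fun j x => frob (sgradv id j x) (sgradv chi j x))
  + iph dot (fun j x => kap x *: ((sgradv chi j x)^T *m normal j)) (fun=> k)
  - iph dot (fun j x => Ch kap chi x *: normal j) (fun=> k).

Definition bending_energy (k : vec -> vec) : R :=
  2^-1 * iph *%R (fun _ x => dot (k x) (k x)) (fun _ _ => 1).

End Mesh.

(* The derivative is relative to [0, T], hence one-sided at 0 and T. *)
Section TimeDerivative.
Context {R : realType} {V : normedModType R}.
Variable T : R.

Definition is_tderiv (f : R -> V) (t : R) (l : V) :=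
  (s - t)^-1 *: (f s - f t) @[s --> within `[0, T] (t^')] --> l.

Definition tderiv (f : R -> V) (t : R) : V :=
  lim ((s - t)^-1 *: (f s - f t) @[s --> within `[0, T] (t^')]).

Definition C1_on (f : R -> V) :=
  (forall t, 0 <= t <= T -> exists l, is_tderiv f t l) /\
  {within `[0, T], continuous (tderiv f)}.

End TimeDerivative.

Record evolution (R : realType) (n J K : nat) := Evolution {
  final_time : R ;
  conn : 'I_J -> 'I_n.+2 -> 'I_K ;
  pos : R -> 'I_K -> 'cV[R]_n.+2 ;
  bd1 : set 'cV[R]_n.+2 ;
  bd2 : set 'cV[R]_n.+2
}.

Section Evolution.
Context {R : realType} {n J K : nat}.
Variable G : evolution R n J K.
Local Notation vec := 'cV[R]_n.+2.
Local Notation T := (final_time G).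

Definition at_time (t : R) : mesh R n J K := Mesh (conn G) (pos G t).

Definition evolving_polyhedral_surface :=
  [/\ forall k, C1_on T (fun t => pos G t k),
      forall t, 0 <= t <= T -> polyhedral_surface (at_time t),
      forall t, 0 <= t <= T -> boundary (at_time t) = bd1 G `|` bd2 G
    & bd1 G `&` bd2 G = set0].

Definition velocity (t : R) (x : vec) : vec :=
  \sum_k nodal_basis (at_time t) k x *: tderiv T (fun s => pos G s k) t.

Definition Vbd1 (t : R) (f : vec -> R) :=
  Vh (at_time t) f /\ forall x, bd1 G x -> f x = 0.

Definition spacetime : set (R * vec) :=
  [set z | 0 <= z.1 <= T /\ surface (at_time z.1) z.2].

Definition barycentric (t : R) (j : 'I_J) (x : vec) : 'I_K -> R :=
  xget (fun=> 0) [set b | weights (vset (at_time t) j) b /\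
                          x = combination (at_time t) b].

(* s |-> trajectory t j x s is the path of the material point of the j-th simplex
   that is at x at time t: it keeps its barycentric coordinates. *)
Definition trajectory (t : R) (j : 'I_J) (x : vec) (s : R) : vec :=
  combination (at_time s) (barycentric t j x).

Definition material_deriv (chi : R -> vec -> R) (t : R) (j : 'I_J) (x : vec) : R :=
  tderiv T (fun s => chi s (trajectory t j x s) : R^o) t.

Definition VT (chi : R -> vec -> R) :=
  [/\ {within spacetime, continuous (fun z : R * vec => chi z.1 z.2)},
      forall t, 0 <= t <= T -> Vh (at_time t) (chi t)
    & exists g : R * vec -> R, {within spacetime, continuous g} /\
      forall t j x, 0 <= t <= T -> cell (at_time t) (vset (at_time t) j) x ->
        is_tderiv T (fun s => chi s (trajectory t j x s) : R^o) t (g (t, x))].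

Definition boundary_datum (mu : vec -> vec) :=
  forall i t, 0 <= t <= T ->
    exists2 f, Vh (at_time t) f & forall x, bd2 G x -> mu x i 0 = f x.

(* Om t is the region enclosed by the surface and the capping surface cap, which
   is empty in the closed case.  The last two clauses say that the unit normal
   points out of Om t, and that, the cap being fixed, Om t always lies on the
   same side of it. *)
Definition encloses (cap : set vec) (Om : R -> set vec) :=
  [/\ closed cap /\ (bd1 G `|` bd2 G = set0 -> cap = set0),
      forall t, 0 <= t <= T ->
        cap `&` surface (at_time t) = bd1 G `|` bd2 G,
      forall t, 0 <= t <= T ->
        [/\ open (Om t), bounded_set (Om t)
          & closure (Om t) `\` Om t = surface (at_time t) `|` cap],
      forall t j x, 0 <= t <= T ->
        open_cell (at_time t) (vset (at_time t) j) x ->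
        \forall e \near 0^'+, Om t (x - e *: normal (at_time t) j) /\
                              ~ Om t (x + e *: normal (at_time t) j)
    & forall s t x, 0 <= s <= T -> 0 <= t <= T -> cap x -> ~ (bd1 G `|` bd2 G) x ->
        \forall y \near x, Om s y <-> Om t y].

Definition helfrich_system (alpha : R) (mu : vec -> vec) (t : R)
    (kap : vec -> R) (k : vec -> vec) (lam : vec -> R) (p : vec -> vec)
    (lamA lamV : R) :=
  let M := at_time t in
  let w := velocity t in
  let nu := fun (j : 'I_J) (_ : vec) => normal M j in
  let kknu := fun j x => k x + kap x *: normal M j in
  [/\ [/\ vectorial (Vh0 M) w, vectorial (Vbd1 t) k, Vh0 M lam
        & vectorial (Vh0 M) p],
      forall chi, vectorial (Vh0 M) chi ->
        0 = iph M *%R (fun j x => dot (w x) (normal M j))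
                      (fun j x => dot (chi x) (normal M j))
          + Bh M k kap chi
          + iph M dot (fun j x => proj M j *m chi x) (fun=> p)
          + alpha * ip M frob (sgradv M chi) (sgradv M p)
          + lamA * iph M dot kknu (fun=> chi)
          + lamV * iph M dot (fun=> chi) nu,
      forall eta, vectorial (Vbd1 t) eta ->
        0 = iph M dot kknu (fun=> eta)
          + ip M frob (sgradv M id) (sgradv M eta)
          - boundary_ip M (bd2 G) mu eta,
      (forall rho, Vh0 M rho ->
        0 = iph M dot (fun j x => rho x *: normal M j) (fun=> p)) /\
      (forall xi, vectorial (Vh0 M) xi ->
        0 = iph M dot (fun j x => proj M j *m w x) (fun=> xi)
          + iph M dot (fun j x => lam x *: normal M j) (fun=> xi)
          + alpha * ip M frob (sgradv M w) (sgradv M xi))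
    & 0 = iph M dot (fun=> w) nu /\ 0 = iph M dot kknu (fun=> w)].

Definition discrete_transport (kap : R -> vec -> R) (t : R) :=
  forall phi, Vh (at_time t) phi ->
    0 = iph (at_time t) *%R (material_deriv kap t) (fun=> phi)
      - iph (at_time t) *%R
          (fun j x => dot (velocity t x) (sgrad (at_time t) (kap t) j x))
          (fun=> phi).

End Evolution.

(* Main.v *)
Require Import Defs.
From mathcomp Require Import all_boot all_order all_algebra perm.
From mathcomp Require Import all_classical all_reals all_analysis measurable_realfun.
From mathcomp Require Import ring lra.
Set Implicit Arguments.
Unset Strict Implicit.
Unset Printing Implicit Defensive.
Import Order.TTheory GRing.Theory Num.Theory.
Import numFieldNormedType.Exports.
Local Open Scope classical_set_scope.
Local Open Scope ring_scope.

(** All the fields of the scheme are affine or constant on each simplex, so its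
    equations are identities between sums over elements and vertices, in
    which a moving simplex enters through its edge matrix E. Let W be the
    surface gradient of the velocity. The area of a simplex has logarithmic
    derivative tr W ([td_area]), its normal nu has derivative - W^T nu
    ([tdm_normal]), and the left inverse of E that yields surface gradients
    is differentiated in [tdm_pinv].

    Area. The velocity vanishes on the boundary, hence is a test field of
    the curvature equation. The lumped term is then zero by the area
    constraint, and the remaining term is the derivative of the area
    ([area_conserved]).

    Energy. The boundary vertices have zero velocity, hence are fixed
    ([boundary_vertex_fixed]). A field with nodal values constant in time is
    therefore admissible in the curvature equation at all times, with a
    constant boundary term ([boundary_ip_frozen]). Take for nodal values
    those of k at time t, and differentiate the equation at t: this
    expresses the sum of the dk/dt . k through the geometry
    ([first_variation_derivative]). The transport equation identifies
    C_h(kap; w) with the derivative of the nodal values of kap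
    ([transported_kap]). The derivative of the energy is thus B_h(k, kap; w)
    ([energy_rate]). The evolution equation, tested with w, says that this
    is minus the squared norm of the normal velocity, because all the terms
    with multipliers cancel ([dissipation]).

    Volume. The enclosed region is known only through its frontier and the
    direction of the normal. Along a generic vertical line its indicator
    drops at each crossing with the surface by the sign of the vertical
    component of the normal ([line_jump]), whereas its jumps on the cap are
    the same at all times. The difference of the lengths of two slices is
    thus a difference of signed sums of heights ([slice_difference]). By
    Fubini, the difference of the volumes at two times is that of a
    polynomial in the vertices, [column_moment] divided by d!
    ([volume_difference2], [volume_difference3]). The derivative of the
    polynomial is the flux of the velocity, which is zero by the volume
    constraint, plus terms on the facets of the simplices. These vanish on
    the boundary, where the vertices are at rest, and cancel in pairs
    elsewhere, because neighbours induce opposite orientations on a common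
    facet ([facet_cancel]). *)

(** * Euclidean algebra of a simplex *)

Section Dot.
Context {R : realType}.
Implicit Types d m p : nat.

Lemma dotE d (u v : 'cV[R]_d) : dot u v = \sum_i u i 0 * v i 0.
Proof. by rewrite /dot mxE; apply: eq_bigr => i _; rewrite mxE. Qed.

Lemma dotC d (u v : 'cV[R]_d) : dot u v = dot v u.
Proof. by rewrite !dotE; apply: eq_bigr => i _; rewrite mulrC. Qed.

Lemma dotDr d (u v w : 'cV[R]_d) : dot u (v + w) = dot u v + dot u w.
Proof. by rewrite /dot mulmxDr mxE. Qed.

Lemma dotZr d a (u v : 'cV[R]_d) : dot u (a *: v) = a * dot u v.
Proof. by rewrite /dot -scalemxAr mxE. Qed.

Lemma dotDl d (u v w : 'cV[R]_d) : dot (v + w) u = dot v u + dot w u.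
Proof. by rewrite dotC dotDr !(dotC u). Qed.

Lemma dotZl d a (u v : 'cV[R]_d) : dot (a *: u) v = a * dot u v.
Proof. by rewrite dotC dotZr dotC. Qed.

Lemma dotNr d (u v : 'cV[R]_d) : dot u (- v) = - dot u v.
Proof. by rewrite -scaleN1r dotZr mulN1r. Qed.

Lemma dotNl d (u v : 'cV[R]_d) : dot (- u) v = - dot u v.
Proof. by rewrite dotC dotNr dotC. Qed.

Lemma dotBr d (u v w : 'cV[R]_d) : dot u (v - w) = dot u v - dot u w.
Proof. by rewrite dotDr dotNr. Qed.

Lemma dotBl d (u v w : 'cV[R]_d) : dot (v - w) u = dot v u - dot w u.
Proof. by rewrite dotDl dotNl. Qed.

Lemma dot0r d (u : 'cV[R]_d) : dot u 0 = 0.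
Proof. by rewrite /dot mulmx0 mxE. Qed.

Lemma dot0l d (u : 'cV[R]_d) : dot 0 u = 0.
Proof. by rewrite dotC dot0r. Qed.

Lemma dot_sumr d (I : finType) (P : pred I) (u : 'cV[R]_d) (F : I -> 'cV[R]_d) :
  dot u (\sum_(i | P i) F i) = \sum_(i | P i) dot u (F i).
Proof. by rewrite /dot mulmx_sumr summxE. Qed.

Lemma dot_suml d (I : finType) (P : pred I) (u : 'cV[R]_d) (F : I -> 'cV[R]_d) :
  dot (\sum_(i | P i) F i) u = \sum_(i | P i) dot (F i) u.
Proof. by rewrite dotC dot_sumr; apply: eq_bigr => i _; rewrite dotC. Qed.

Lemma dot_mulmxr d m (u : 'cV[R]_d) (A : 'M[R]_(d, m)) v :
  dot u (A *m v) = dot (A^T *m u) v.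
Proof. by rewrite /dot trmx_mul trmxK mulmxA. Qed.

Lemma dot_ge0 d (u : 'cV[R]_d) : 0 <= dot u u.
Proof. by rewrite dotE; apply: sumr_ge0 => i _; rewrite -expr2 sqr_ge0. Qed.

Lemma dot_eq0 d (u : 'cV[R]_d) : (dot u u == 0) = (u == 0).
Proof.
apply/eqP/eqP => [|->]; last by rewrite dot0r.
rewrite dotE => /eqP; rewrite psumr_eq0; last by move=> i _; rewrite -expr2 sqr_ge0.
move=> /allP h; apply/colP => i; rewrite mxE; apply/eqP.
by have := h i (mem_index_enum _); rewrite mulf_eq0 orbb.
Qed.

Lemma dot_delta d (u : 'cV[R]_d) i : dot (delta_mx i 0) u = u i 0.
Proof.
rewrite dotE (bigD1 i) //= big1 ?addr0; last first.
  by move=> l /negPf li; rewrite mxE li mul0r.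
by rewrite mxE !eqxx mul1r.
Qed.

End Dot.

Section SimplexAlgebra.
Context {R : realType} {n : nat}.
Local Notation vec := 'cV[R]_n.+2.
Implicit Types E F : 'M[R]_(n.+2, n.+1).

(** The wedge of a simplex as a function of its edges: what evolves in time
    below is a path of edge matrices. *)
Definition cross E : vec :=
  \col_i \det (row_mx (delta_mx i 0 : vec) E : 'M[R]_n.+2).

Lemma dot_cross (u : vec) E : dot u (cross E) = \det (row_mx u E : 'M[R]_n.+2).
Proof.
have cof i (v : vec) : cofactor (row_mx v E : 'M[R]_n.+2) i 0
             = cofactor (row_mx (0 : vec) E : 'M[R]_n.+2) i 0.
  rewrite /cofactor; congr (_ * \det _); apply/matrixP => a b; rewrite !mxE.
  by case: splitP => // -[[]].
have ex (v : vec) : \det (row_mx v E : 'M[R]_n.+2)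
    = \sum_i v i 0 * cofactor (row_mx (0 : vec) E : 'M[R]_n.+2) i 0.
  rewrite (expand_det_col _ 0); apply: eq_bigr => i _; rewrite cof; congr (_ * _).
  by rewrite mxE; case: splitP => // k; rewrite (ord1 k).
rewrite dotE ex; apply: eq_bigr => i _; rewrite mxE ex; congr (_ * _).
rewrite (bigD1 i) //= big1 ?addr0; first by rewrite mxE !eqxx mul1r.
by move=> l /negPf li; rewrite mxE li mul0r.
Qed.

(** The Gram matrix of the columns u and E is block diagonal when u is
    orthogonal to E. *)
Lemma sqr_dot_cross (u : vec) E : E^T *m u = 0 ->
  dot u (cross E) ^+ 2 = dot u u * \det (E^T *m E).
Proof.
move=> uE; rewrite dot_cross expr2 -{1}det_tr -det_mulmx.
rewrite (_ : _ *m _ = block_mx (dot u u)%:M 0 0 (E^T *m E) :> 'M[R]_(1 + n.+1)).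
  by rewrite -[LHS]/(\det (block_mx (dot u u)%:M 0 0 (E^T *m E) : 'M[R]_(1 + n.+1)))
             det_ublock det_scalar1.
rewrite (tr_row_mx (u : vec) E) (mul_col_row u^T E^T u E) uE; congr (block_mx _ _ _ _).
  by apply/matrixP=> i j; rewrite !ord1 [RHS]mxE mulr1n.
by apply: trmx_inj; rewrite trmx_mul trmxK uE trmx0.
Qed.

Lemma cross_orth E : E^T *m cross E = 0.
Proof.
apply/colP => k; rewrite [RHS]mxE.
transitivity (dot (col k E) (cross E)).
  by rewrite !mxE dotE; apply: eq_bigr => i _; rewrite !mxE.
rewrite dot_cross -det_tr; apply: (@determinant_alternate _ _ _ 0 (lift 0 k)) => //.
move=> i; rewrite !mxE; case: splitP => // a _; case: splitP => [b|b].
  by rewrite (ord1 b) lift0.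
by rewrite lift0 /= add1n => -[/ord_inj ->]; rewrite mxE.
Qed.

Variable E : 'M[R]_(n.+2, n.+1).
Hypothesis rkE : \rank E = n.+1.

Lemma gram_unit : E^T *m E \in unitmx.
Proof.
rewrite -row_free_unit -kermx_eq0; apply/eqP/row_matrixP => i; rewrite row0.
set u := row i _.
have u0 : u *m (E^T *m E) = 0 by apply/sub_kermxP; exact: row_sub.
have : dot (E *m u^T) (E *m u^T) = 0.
  by rewrite /dot trmx_mul trmxK mulmxA -(mulmxA u) u0 mul0mx mxE.
move/eqP; rewrite dot_eq0 => /eqP /(congr1 trmx); rewrite trmx_mul trmxK trmx0.
move=> uE; have : row_free E^T by rewrite /row_free mxrank_tr rkE.
by move/row_free_injr; apply; rewrite /= uE mul0mx.
Qed.

(** This is [sqr_dot_cross] with [u := cross E], divided by [dot u u]; the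
    latter is not zero, as the same lemma shows with any nonzero u orthogonal
    to the edges. *)
Lemma dot_cross_self : dot (cross E) (cross E) = \det (E^T *m E).
Proof.
have := sqr_dot_cross (cross_orth E); rewrite expr2.
suff : dot (cross E) (cross E) != 0 by move=> h /(mulfI h).
rewrite dot_eq0; apply/eqP => c0.
have : kermx E != 0 by rewrite -mxrank_eq0 mxrank_ker rkE subSnn.
move/rowV0Pn => [u /sub_kermxP uE un0].
have /sqr_dot_cross : E^T *m u^T = 0 by rewrite -trmx_mul uE trmx0.
rewrite c0 dot0r expr0n /= => /esym /eqP; rewrite mulf_eq0 dot_eq0.
have -> : (u^T == 0) = (u == 0) by rewrite -(inj_eq (@trmx_inj _ _ _)) trmxK trmx0.
rewrite (negPf un0) /=; apply/negP.
by have := gram_unit; rewrite unitmxE unitfE.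
Qed.

Lemma det_gram_gt0 : 0 < \det (E^T *m E).
Proof.
rewrite lt_def -{2}dot_cross_self dot_ge0 andbT.
by have := gram_unit; rewrite unitmxE unitfE.
Qed.

(** The left inverse of E that vanishes on the normal. It turns the
    differences of the nodal values of an affine function into its surface
    gradient. *)
Definition pinv : 'M[R]_(n.+1, n.+2) := invmx (E^T *m E) *m E^T.

Lemma pinvK : pinv *m E = 1%:M.
Proof. by rewrite /pinv -mulmxA mulVmx // gram_unit. Qed.

Definition unormal : vec := (enorm (cross E))^-1 *: cross E.

Lemma enorm_cross : enorm (cross E) = Num.sqrt (\det (E^T *m E)).
Proof. by rewrite /enorm dot_cross_self. Qed.

Lemma enorm_cross_gt0 : 0 < enorm (cross E).
Proof. by rewrite enorm_cross sqrtr_gt0 det_gram_gt0. Qed.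

Lemma crossE : cross E = enorm (cross E) *: unormal.
Proof. by rewrite scalerA mulfV ?scale1r // gt_eqF // enorm_cross_gt0. Qed.

Lemma unormal1 : dot unormal unormal = 1.
Proof.
rewrite dotZl dotZr dot_cross_self enorm_cross mulrA -invfM -expr2.
by rewrite sqr_sqrtr ?mulVf // ?gt_eqF ?ltW // det_gram_gt0.
Qed.

Lemma unormal_orth : E^T *m unormal = 0.
Proof. by rewrite -scalemxAr cross_orth scaler0. Qed.

(** Both sides vanish on the normal and fix the edges, and these vectors form
    a basis. *)
Lemma proj_pinv : 1%:M - unormal *m unormal^T = E *m pinv.
Proof.
have nE : unormal^T *m E = 0 by apply: trmx_inj; rewrite trmx_mul trmxK unormal_orth trmx0.
have nn : unormal^T *m unormal = 1%:M.
  by apply/matrixP => i j; rewrite !ord1 [RHS]mxE -unormal1.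
(* The determinant of these columns is the norm of the cross product. *)
have Xu : row_free (row_mx unormal E).
  rewrite -[row_free _]/(row_free (row_mx unormal E : 'M[R]_n.+2)) row_free_unit.
  rewrite unitmxE unitfE -dot_cross crossE dotZr unormal1 mulr1.
  by rewrite gt_eqF // enorm_cross_gt0.
apply: (row_free_injr Xu); rewrite /= !mul_mx_row; congr row_mx.
  rewrite mulmxBl mul1mx -mulmxA nn mulmx1 subrr.
  by rewrite /pinv -!mulmxA unormal_orth !mulmx0.
by rewrite mulmxBl mul1mx -mulmxA nE mulmx0 subr0 -mulmxA pinvK mulmx1.
Qed.

End SimplexAlgebra.

(** * Barycentric coordinates and nodal interpolation *)

Lemma edge_mx_mul (R : realType) d p (v : 'I_p.+1 -> 'cV[R]_d) (c : 'cV[R]_p) :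
  edge_mx v *m c = \sum_k c k 0 *: (v (lift ord0 k) - v ord0).
Proof.
apply/colP => i; rewrite mxE summxE; apply: eq_bigr => k _.
by rewrite !mxE mulrC.
Qed.

Section Barycentric.
Context {R : realType} {n J K : nat} (M : mesh R n J K).
Local Notation vec := 'cV[R]_n.+2.
Hypothesis hM : polyhedral_surface M.

Local Notation E j := (edge_mx (verts M j)).

Lemma edge_rank j : \rank (E j) = n.+1.
Proof. by case: hM => + _ _ _ _; apply. Qed.

(** Barycentric coordinates of the orthogonal projection onto the plane of the
    simplex, so that they are affine functions on the whole space. The points
    of the plane are those that are reproduced from their coordinates. *)
Definition bary (j : 'I_J) (x : vec) (i : 'I_n.+2) : R :=
  oapp (fun k => (pinv (E j) *m (x - verts M j ord0)) k 0)
    (1 - \sum_k (pinv (E j) *m (x - verts M j ord0)) k 0) (unlift ord0 i).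

Lemma bary0 j x : bary j x ord0 = 1 - \sum_k (pinv (E j) *m (x - verts M j ord0)) k 0.
Proof. by rewrite /bary unlift_none. Qed.

Lemma baryS j x k : bary j x (lift ord0 k) = (pinv (E j) *m (x - verts M j ord0)) k 0.
Proof. by rewrite /bary liftK. Qed.

Lemma sum_bary j x : \sum_i bary j x i = 1.
Proof.
rewrite big_ord_recl; under eq_bigr do rewrite baryS.
by rewrite bary0 subrK.
Qed.

Lemma affine_comb j (b : 'I_n.+2 -> R) : \sum_i b i = 1 ->
  \sum_i b i *: verts M j i
  = verts M j ord0 + E j *m (\col_k b (lift ord0 k)).
Proof.
rewrite big_ord_recl => b1; rewrite edge_mx_mul big_ord_recl.
under [in RHS]eq_bigr do rewrite mxE scalerBr.
rewrite sumrB -scaler_suml.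
have -> : \sum_(i < n.+1) b (lift ord0 i) = 1 - b ord0 by rewrite -b1 addrAC subrr add0r.
by rewrite scalerBl scale1r opprB addrC [RHS]addrC -addrA subrK.
Qed.

Lemma bary_comb j (b : 'I_n.+2 -> R) i : \sum_i b i = 1 ->
  bary j (\sum_i b i *: verts M j i) i = b i.
Proof.
move=> b1; have h : pinv (E j) *m (\sum_i b i *: verts M j i - verts M j ord0)
    = \col_k b (lift ord0 k).
  by rewrite affine_comb // addrAC subrr add0r mulmxA pinvK ?mul1mx // edge_rank.
case: (unliftP ord0 i) => [k ->|->]; first by rewrite baryS h mxE.
rewrite bary0 h -b1 big_ord_recl.
by under [in X in _ - X]eq_bigr do rewrite mxE; rewrite addrK.
Qed.

Lemma sum_delta (V : lmodType R) (i : 'I_n.+2) (F : 'I_n.+2 -> V) :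
  \sum_l (l == i)%:R *: F l = F i.
Proof.
rewrite (bigD1 i) //= big1 ?addr0; first by rewrite eqxx scale1r.
by move=> l /negPf ->; rewrite scale0r.
Qed.

Lemma bary_verts j i l : bary j (verts M j i) l = (l == i)%:R.
Proof.
rewrite -(sum_delta i (verts M j)) bary_comb //.
by rewrite (bigD1 i) //= big1 ?addr0 ?eqxx // => k /negPf ->.
Qed.

Lemma elt_inj j : injective (elt M j).
Proof.
move=> a b ab; have e : verts M j a = verts M j b by rewrite /verts ab.
have := bary_verts j a a; rewrite e bary_verts eqxx.
by case: eqP => // _ /eqP; rewrite eq_sym oner_eq0.
Qed.

Lemma in_vset j i : elt M j i \in vset M j.
Proof. by apply/imsetP; exists i. Qed.

Lemma sum_vset (V : zmodType) (F : 'I_K -> V) j :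
  (forall k, k \notin vset M j -> F k = 0) -> \sum_k F k = \sum_i F (elt M j i).
Proof.
move=> F0; rewrite (bigID (mem (vset M j))) /= [X in _ + X]big1 // addr0.
by rewrite big_imset //= => a b _ _; exact: elt_inj.
Qed.

Lemma weights_sum j (b : 'I_K -> R) : weights (vset M j) b -> \sum_i b (elt M j i) = 1.
Proof. by case=> b0 <-; rewrite (sum_vset b0). Qed.

Lemma weights_comb j (b : 'I_K -> R) : weights (vset M j) b ->
  combination M b = \sum_i b (elt M j i) *: verts M j i.
Proof.
by case=> b0 _; rewrite /combination (@sum_vset _ _ j) // => k /b0 ->; rewrite scale0r.
Qed.

Lemma bary_weights j (b : 'I_K -> R) i : weights (vset M j) b ->
  bary j (combination M b) i = b (elt M j i).
Proof.
by move=> wb; rewrite (weights_comb wb) bary_comb // weights_sum.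
Qed.

(** Cells are described by weights indexed by all the vertices of the mesh. *)
Definition spread j (b : 'I_n.+2 -> R) (k : 'I_K) : R :=
  \sum_i (elt M j i == k)%:R * b i.

Lemma spreadE j b i : spread j b (elt M j i) = b i.
Proof.
rewrite /spread (bigD1 i) //= eqxx mul1r big1 ?addr0 // => l /negPf li.
by rewrite (inj_eq (@elt_inj j)) li mul0r.
Qed.

Lemma spread_out j b k : k \notin vset M j -> spread j b k = 0.
Proof.
move=> kj; rewrite /spread big1 // => i _; case: eqP; last by rewrite mul0r.
by move=> e; move: kj; rewrite -e in_vset.
Qed.

Lemma spread_weights j b : \sum_i b i = 1 -> weights (vset M j) (spread j b).
Proof.
move=> b1; split=> [k|]; first exact: spread_out.
rewrite (@sum_vset _ _ j) => [|k]; last exact: spread_out.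
by under eq_bigr do rewrite spreadE.
Qed.

Lemma spread_comb j b : \sum_i b i = 1 ->
  combination M (spread j b) = \sum_i b i *: verts M j i.
Proof.
by move=> b1; rewrite (weights_comb (spread_weights j b1)); under eq_bigr do rewrite spreadE.
Qed.

Lemma cellP j x : cell M (vset M j) x <->
  x = \sum_i bary j x i *: verts M j i /\ forall i, 0 <= bary j x i.
Proof.
split=> [[b [wb b0 ->]]|[xE x0]].
  split=> [|i]; last by rewrite bary_weights.
  by rewrite {1}(weights_comb wb); apply: eq_bigr => i _; rewrite bary_weights.
exists (spread j (bary j x)); split.
- exact: spread_weights (sum_bary j x).
- by move=> k; apply: sumr_ge0 => i _; rewrite mulr_ge0 ?ler0n.
- by rewrite spread_comb ?sum_bary.
Qed.

Lemma open_cellP j x : open_cell M (vset M j) x <->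
  x = \sum_i bary j x i *: verts M j i /\ forall i, 0 < bary j x i.
Proof.
split=> [[b [wb b0 ->]]|[xE x0]].
  split=> [|i]; last by rewrite bary_weights // b0 // in_vset.
  by rewrite {1}(weights_comb wb); apply: eq_bigr => i _; rewrite bary_weights.
exists (spread j (bary j x)); split.
- exact: spread_weights (sum_bary j x).
- by move=> k /imsetP [i _ ->]; rewrite spreadE.
- by rewrite spread_comb ?sum_bary.
Qed.

Lemma open_cell_sub j x : open_cell M (vset M j) x -> cell M (vset M j) x.
Proof. by move=> /open_cellP [h1 h2]; apply/cellP; split => // i; exact: ltW. Qed.

Lemma cell_verts j i : cell M (vset M j) (verts M j i).
Proof.
apply/cellP; split=> [|l]; last by rewrite bary_verts ler0n.
by under eq_bigr do rewrite bary_verts; rewrite sum_delta.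
Qed.

(** Conformity: a point common to two cells is a combination of their common
    vertices, so that it has the same weights in both. *)
Lemma cell2_weights i j x : cell M (vset M i) x -> cell M (vset M j) x ->
  exists b, [/\ weights (vset M i :&: vset M j) b, weights (vset M i) b,
     weights (vset M j) b, forall k, 0 <= b k & x = combination M b].
Proof.
move=> xi xj; case: hM => _ _ h _ _.
have /[!h] : (cell M (vset M i) `&` cell M (vset M j)) x by [].
case=> b [wb b0 xE]; exists b; case: (wb) => w0 w1.
by split=> //; split=> // k kn; apply: w0; rewrite inE (negPf kn) ?andbF.
Qed.

Lemma barycentricE j x : cell M (vset M j) x ->
  xget (fun=> 0) [set b | weights (vset M j) b /\ x = combination M b]
  = spread j (bary j x).
Proof.
move=> /cellP [xE _]; apply: (@xget_subset1 _ (fun=> 0 : R)) => /=.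
  by split; [exact: spread_weights (sum_bary j x)|rewrite spread_comb ?sum_bary].
move=> b b' [wb xb] [wb' xb']; apply/funext => k.
case: (boolP (k \in vset M j)) => [/imsetP [a _ ->]|kn].
  by rewrite -(bary_weights a wb) -(bary_weights a wb') -xb -xb'.
by case: wb => -> // _; case: wb' => -> .
Qed.

End Barycentric.

Section Limits.
Context {R : realType}.

Lemma cvg_fsum {T : Type} (F : set_system T) {FF : Filter F} (I : finType) (P : pred I)
    (f : I -> T -> R) (a : I -> R) :
  (forall i, P i -> f i x @[x --> F] --> a i) ->
  \sum_(i | P i) f i x @[x --> F] --> \sum_(i | P i) a i.
Proof. by apply: cvg_big => //; exact: add_continuous. Qed.

Lemma dotr_continuous d (a x : 'cV[R]_d) : dot a y @[y --> x] --> dot a x.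
Proof.
have -> : dot a = fun x => \sum_i a i 0 * x i 0 by apply/funext => y; rewrite dotE.
apply: (@cvg_fsum _ (nbhs x)) => i _.
by apply: cvgM; [exact: cvg_cst|exact: coord_continuous].
Qed.

End Limits.
Arguments dotr_continuous {R d} a x.

Section Surface.
Context {R : realType} {n J K : nat} (M : mesh R n J K).
Local Notation vec := 'cV[R]_n.+2.
Hypothesis hM : polyhedral_surface M.
Local Notation E j := (edge_mx (verts M j)).
Local Notation bary := (bary M).
Local Notation cellj j := (cell M (vset M j)).
Local Notation ocell j := (open_cell M (vset M j)).

Definition bary_grad j (i : 'I_n.+2) : vec :=
  oapp (fun k => (row k (pinv (E j)))^T) (- \sum_k (row k (pinv (E j)))^T) (unlift ord0 i).

Lemma bary_line j (x v : vec) i (h : R) :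
  bary j (x + h *: v) i = bary j x i + h * dot (bary_grad j i) v.
Proof.
have e k : dot (row k (pinv (E j)))^T v = (pinv (E j) *m v) k 0.
  by rewrite dotE mxE; apply: eq_bigr => l _; rewrite !mxE.
have l k : (pinv (E j) *m (x + h *: v - verts M j ord0)) k 0
   = (pinv (E j) *m (x - verts M j ord0)) k 0 + h * dot (row k (pinv (E j)))^T v.
  by rewrite addrAC mulmxDr -scalemxAr mxE [X in _ + X]mxE e.
case: (unliftP ord0 i) => [k ->|->].
  by rewrite !baryS /bary_grad liftK /= l.
rewrite !bary0 /bary_grad unlift_none /=; under eq_bigr do rewrite l.
by rewrite big_split /= -mulr_sumr -dot_suml opprD addrA dotNl mulrN.
Qed.

Lemma bary_affine j (x : vec) i : bary j x i = dot (bary_grad j i) x + bary j 0 i.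
Proof. by have := bary_line j 0 x i 1; rewrite scale1r add0r mul1r addrC. Qed.

Lemma bary_cvg j i x : bary j y i @[y --> x] --> bary j x i.
Proof.
have -> : (fun x => bary j x i) = (fun x => dot (bary_grad j i) x + bary j 0 i).
  by apply/funext => y; rewrite bary_affine.
rewrite (bary_affine j x); apply: (@cvgD _ _ _ (nbhs x)); last exact: cvg_cst.
exact: (dotr_continuous (bary_grad j i) x).
Qed.

Arguments bary_cvg : clear implicits.

Lemma bary_grad_edge j (c : 'cV[R]_n.+1) k :
  dot (bary_grad j (lift ord0 k)) (E j *m c) = c k 0.
Proof.
rewrite /bary_grad liftK /= dotE.
transitivity ((pinv (E j) *m (E j *m c)) k 0).
  by rewrite mxE; apply: eq_bigr => l _; rewrite !mxE.
by rewrite mulmxA pinvK ?mul1mx // edge_rank.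
Qed.

Lemma plane_line j (x v : vec) c : x = \sum_i bary j x i *: verts M j i ->
  v = E j *m c -> x + v = \sum_i bary j (x + v) i *: verts M j i.
Proof.
move=> xE ->; rewrite affine_comb ?sum_bary // {1}xE affine_comb ?sum_bary //.
rewrite -addrA; congr (_ + _); rewrite -mulmxDr; congr (_ *m _).
apply/colP => k; rewrite !mxE -(scale1r (_ *m c)) bary_line mul1r.
by rewrite bary_grad_edge.
Qed.

Lemma cell_closed j : closed (cellj j).
Proof.
have -> : cellj j =
   \bigcap_(l in [set: 'I_n.+2]) ([set x | \sum_i bary j x i * verts M j i l 0 - x l 0 = 0]
      `&` [set x | 0 <= bary j x l]).
  apply/seteqP; split=> [x /(cellP hM) [xE x0] l _|x h].
    split; last exact: x0.
    rewrite /= {2}xE summxE; apply/eqP; rewrite subr_eq0; apply/eqP.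
    by apply: eq_bigr => i _; rewrite mxE.
  apply/(cellP hM); split=> [|i]; last by case: (h i I).
  apply/colP => l; have [/= /eqP] := h l I; rewrite subr_eq0 => /eqP <- _.
  by rewrite summxE; apply: eq_bigr => i _; rewrite mxE.
apply: closed_bigI => l _; apply: closedI.
  rewrite -[X in closed X]/((fun x : vec => \sum_i bary j x i * verts M j i l 0 - x l 0)
    @^-1` [set y | y = 0]).
  apply: preimage_closed; last exact: closed_eq.
  move=> x _; apply: (@cvgB _ _ _ (nbhs x)); last exact: coord_continuous.
  by apply: (@cvg_fsum _ _ (nbhs x)) => i _; apply: cvgM; [exact: (bary_cvg j i x)|exact: cvg_cst].
rewrite -[X in closed X]/((fun x : vec => bary j x l) @^-1` [set r : R | 0 <= r]).
apply: preimage_closed; last exact: closed_ge.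
by move=> x _; exact: (bary_cvg j l x).
Qed.

Lemma cell_away j x : ~ cellj j x -> \forall y \near x, ~ cellj j y.
Proof. by move=> xj; apply: (open_nbhs_nbhs (conj (closed_openC (@cell_closed j)) xj)). Qed.

(** By [interpE] the value does not depend on the simplex that is picked. *)
Definition interp (a : 'I_K -> R) (x : vec) : R :=
  match [pick j | `[< cellj j x >]] with
  | Some j => \sum_i bary j x i * a (elt M j i)
  | None => 0
  end.

Lemma interpE a j x : cellj j x -> interp a x = \sum_i bary j x i * a (elt M j i).
Proof.
move=> xj; rewrite /interp; case: pickP => [i /asboolP xi|/(_ j)]; last first.
  by move/asboolP.
have [b [_ wi wj _ ->]] := cell2_weights hM xi xj.
have e l : weights (vset M l) b -> \sum_i b (elt M l i) * a (elt M l i) = \sum_k b k * a k.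
  by move=> [b0 _]; rewrite (@sum_vset _ _ _ _ _ hM _ _ l) // => k /b0 ->; rewrite mul0r.
under eq_bigr do rewrite (bary_weights hM _ wi).
under [RHS]eq_bigr do rewrite (bary_weights hM _ wj).
by rewrite !e.
Qed.

Lemma interp_vtx a k : interp a (vtx M k) = a k.
Proof.
case: (hM) => _ _ _ /(_ k) [j [i <-]] _; rewrite (interpE a (cell_verts hM j i)).
under eq_bigr do rewrite (bary_verts hM).
by rewrite (sum_delta i (fun i => a (elt M j i) : R^o)).
Qed.

(** For continuity at x, the cells that do not contain x are also away from
    the points near x, since there are finitely many of them and they are
    closed; on the others the formula of [interpE] is continuous. *)
Lemma interp_Vh a : Vh M (interp a).
Proof.
split=> [|j]; last first.
  exists (\sum_i a (elt M j i) *: bary_grad j i), (\sum_i bary j 0 i * a (elt M j i)) => x xj.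
  rewrite (interpE a xj) dot_suml -big_split /=; apply: eq_bigr => i _.
  by rewrite bary_affine mulrDl dotZl mulrC.
apply/subspace_continuousP => x xS; apply/cvgrPdist_lt => e e0; rewrite near_withinE.
have : \forall y \near x, forall j, cellj j y -> `|interp a x - interp a y| < e.
  apply: (@filter_forall _ _ _ (nbhs x)) => j; case: (pselect (cellj j x)) => xj.
    have : (fun y => \sum_i bary j y i * a (elt M j i)) y @[y --> x] --> interp a x.
      rewrite (interpE a xj).
      by apply: (@cvg_fsum _ _ (nbhs x)) => i _; apply: cvgM; [exact: (bary_cvg j i x)|exact: cvg_cst].
    move=> /cvgrPdist_lt /(_ e e0); apply: filterS => y h yj.
    by rewrite [X in _ - X](interpE a yj).
  by apply: filterS (cell_away xj) => y.
by apply: filterS => y h [j yj]; exact: h yj.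
Qed.

Lemma Vh_bary f j x : Vh M f -> cellj j x ->
  f x = \sum_i bary j x i * f (verts M j i).
Proof.
move=> [_ /(_ j) [a [c fE]]] xj.
rewrite (fE _ xj) -[c]mul1r -(sum_bary M j x) mulr_suml.
have [xE _] := (cellP hM j x).1 xj; rewrite {1}xE dot_sumr -big_split /=.
by apply: eq_bigr => i _; rewrite (fE _ (cell_verts hM j i)) dotZr mulrDr.
Qed.

Lemma Vh_interp f x : Vh M f -> surface M x -> f x = interp (fun k => f (vtx M k)) x.
Proof. by move=> fV [j xj]; rewrite (interpE _ xj) (Vh_bary fV xj). Qed.

Lemma Vh_cvg f j i : Vh M f ->
  f x @[x --> within (ocell j) (nbhs (verts M j i))] --> f (verts M j i).
Proof.
move=> [/subspace_continuousP fc _].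
have vS : surface M (verts M j i) by exists j; exact: cell_verts.
apply: cvg_trans (fc _ vS); apply: cvg_app; apply: within_subset => x.
by move=> h; exists j; exact: open_cell_sub.
Qed.

Lemma nodal_basisE k : Vh M (nodal_basis M k) /\
  forall l, nodal_basis M k (vtx M l) = (l == k)%:R.
Proof.
rewrite /nodal_basis; case: xgetP => [f -> //|/(_ (interp (fun l => (l == k)%:R)))] [].
by split=> [|l]; [exact: interp_Vh|rewrite interp_vtx].
Qed.

Lemma bary_center j : ocell j (\sum_i (n.+2%:R^-1 : R) *: verts M j i).
Proof.
have s : \sum_(i < n.+2) (n.+2%:R^-1 : R) = 1.
  by rewrite sumr_const card_ord -[_ *+ _]mulr_natl mulfV // pnatr_eq0.
apply/(open_cellP hM); split=> [|i]; last by rewrite bary_comb // invr_gt0 ltr0n.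
by apply: eq_bigr => i _; rewrite bary_comb.
Qed.

(** A vertex is the limit of the points of the segment to the barycentre,
    which are interior. The limits in the lumped inner product are therefore
    unique. *)
Lemma vertex_proper j i : ProperFilter (within (ocell j) (nbhs (verts M j i))).
Proof.
apply: within_nbhs_proper => /=.
have [cE c0] := (open_cellP hM j _).1 (bary_center j).
set c := (\sum_i (n.+2%:R^-1 : R) *: verts M j i) in cE c0.
pose y h := verts M j i + h *: (c - verts M j i).
have yc : y h @[h --> 0^'+] --> verts M j i.
  rewrite -[X in _ --> X]addr0 -(scale0r (c - verts M j i)).
  apply: cvgD; first exact: cvg_cst.
  by apply: cvgZr_tmp; apply: cvg_at_right_filter; exact: cvg_id.
move=> B /yc; rewrite /= nbhs_simpl /= => hB.
have : \forall h \near (0 : R)^'+, ocell j (y h) /\ B (y h).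
  near=> h.
  have h0 : 0 < h by near: h; exact: nbhs_right_gt.
  have h1 : h < 1 by near: h; exact: nbhs_right_lt.
  split; last by near: h.
  (* Barycentric coordinates of the point y h of the segment. *)
  pose b l := (1 - h) * (l == i)%:R + h * bary j c l.
  have b1 : \sum_l b l = 1.
    rewrite big_split /= -!mulr_sumr sum_bary (bigD1 i) //= big1 ?eqxx.
      by rewrite addr0 !mulr1 subrK.
    by move=> l /negPf ->.
  have yE : y h = \sum_l b l *: verts M j l.
    rewrite /y scalerBr addrCA -[X in _ + (X - _)]scale1r -scalerBl.
    rewrite {1}cE scaler_sumr -{1}(sum_delta i (verts M j)) scaler_sumr -big_split /=.
    by apply: eq_bigr => l _; rewrite /b scalerDl !scalerA addrC.
  apply/(open_cellP hM); split=> [|l]; rewrite yE.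
    by apply: eq_bigr => l _; rewrite bary_comb.
  rewrite bary_comb // /b ltr_wpDl // ?mulr_ge0 ?ler0n ?subr_ge0 ?ltW //.
  by rewrite mulr_gt0.
by move=> /(@filter_ex _ _ _) [h [? ?]]; exists (y h).
Unshelve. all: by end_near. Qed.

End Surface.

(** * Iterated integrals of explicit functions *)

Section OneDimIntegral.
Context {R : realType}.
Local Notation mu := (@lebesgue_measure R).
Implicit Types (f g F : R -> R) (a b c v : R).

(** Integrability is kept together with the value of the integral, because
    linearity requires it. *)
Definition has_int f v :=
  mu.-integrable [set: R] (EFin \o f) /\ (\int[mu]_x (f x)%:E = v%:E)%E.

Lemma has_int0 : has_int (fun=> 0) 0.
Proof. by split; [exact: integrable0|rewrite integral0]. Qed.

Lemma has_intD f g v w : has_int f v -> has_int g w ->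
  has_int (fun x => f x + g x) (v + w).
Proof.
move=> [fi fv] [gi gw]; split.
  by have := integrableD measurableT fi gi; apply: eq_integrable => // x _; rewrite /= EFinD.
by under eq_integral do rewrite EFinD; rewrite integralD // fv gw.
Qed.

Lemma has_intZ f v c : has_int f v -> has_int (fun x => c * f x) (c * v).
Proof.
move=> [fi fv]; split.
  by have := integrableZl measurableT c fi; apply: eq_integrable => // x _; rewrite /= EFinM.
by under eq_integral do rewrite EFinM; rewrite integralZl // fv.
Qed.

Lemma has_intB f g v w : has_int f v -> has_int g w ->
  has_int (fun x => f x - g x) (v - w).
Proof.
move=> hf /(has_intZ (-1)); rewrite mulN1r => hg.
by have := has_intD hf hg; under eq_fun do rewrite mulN1r.
Qed.

Lemma has_int_sum (I : Type) (s : seq I) (P : pred I) (f : I -> R -> R) (v : I -> R) :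
  (forall i, P i -> has_int (f i) (v i)) ->
  has_int (fun x => \sum_(i <- s | P i) f i x) (\sum_(i <- s | P i) v i).
Proof.
move=> h; elim: s => [|i s ih].
  by under eq_fun do rewrite big_nil; rewrite big_nil; exact: has_int0.
rewrite big_cons; under eq_fun do rewrite big_cons.
by case: ifP => // Pi; apply: has_intD => //; exact: h.
Qed.

Lemma has_int_unique f v w : has_int f v -> has_int f w -> v = w.
Proof. by move=> [_ h] [_]; rewrite h => -[]. Qed.

Lemma has_int_point a : has_int \1_[set a] 0.
Proof.
have h : (\int[mu]_x (\1_[set a] x)%:E = 0)%E.
  by rewrite integral_indic // setIT; exact: lebesgue_measure_set1.
split=> //; apply/integrableP; split.
  by apply/measurable_EFinP; exact: measurable_indic.
under eq_integral => x _ do rewrite /= ger0_norm //.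
by rewrite h.
Qed.

(** The difference of f and g is a combination of indicators of points, which
    have integral 0. *)
Lemma has_int_except f g v (s : seq R) : has_int g v ->
  (forall x, x \notin s -> f x = g x) -> has_int f v.
Proof.
move=> hg fg.
have -> : f = fun x => g x + \sum_(a <- undup s) (f a - g a) * \1_[set a] x.
  apply/funext => x; case: (boolP (x \in undup s)) => xs.
    rewrite (bigD1_seq x) ?undup_uniq //= big1 ?addr0.
      by rewrite indicE mem_set // mulr1 addrC subrK.
    by move=> a ax; rewrite indicE memNset ?mulr0 // => xa; rewrite -xa eqxx in ax.
  rewrite big_seq big1 ?addr0 ?fg // => [|a as_]; first by rewrite -mem_undup.
  by rewrite indicE memNset ?mulr0 // => /= xa; rewrite xa as_ in xs.
rewrite -[v]addr0; apply: has_intD => //.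
rewrite -[X in has_int _ X](@big1_eq _ 0 +%R _ (undup s) xpredT).
apply: has_int_sum => a _; rewrite -(mulr0 (f a - g a)).
by apply: has_intZ; exact: has_int_point.
Qed.

Lemma has_int_itv F f a b : a <= b -> (forall x : R, is_derive x 1 F (f x)) ->
  continuous f -> has_int (fun x => \1_`]a, b[ x * f x) (F b - F a).
Proof.
move=> ab dF cf.
have cF : continuous F.
  by move=> x; apply: differentiable_continuous; apply/derivable1_diffP; case: (dF x).
have E x : ((\1_`]a, b[ x * f x)%:E = ((EFin \o f) \_ `]a, b[) x)%E.
  by rewrite patchE indicE /=; case: ifPn => xab; rewrite ?mul1r ?mul0r.
have mf : measurable_fun setT f by exact: continuous_measurable_fun.
have fi : mu.-integrable `[a, b] (EFin \o f).
  by apply: continuous_compact_integrable; [exact: segment_compact|exact: continuous_subspaceT].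
split.
  rewrite (_ : _ \o _ = (EFin \o f) \_ `]a, b[); last by apply/funext => x; rewrite -E.
  have X := @integrable_mkcond _ _ _ mu `]a, b[ (EFin \o f) (measurable_itv `]a, b[).
  apply: (iffLR X).
  by apply: (integrableS _ _ _ fi) => //; exact: subset_itvW.
under eq_integral do rewrite E; rewrite -integral_mkcond.
move: ab; rewrite le_eqVlt => /predU1P[<-|ab].
  by rewrite subrr set_itvoo0 integral_set0.
rewrite -(integral_itv_bndoo true false); last first.
  by apply/measurable_EFinP; exact: measurable_funTS.
rewrite (continuous_FTC2 (F := F)) //.
- exact: continuous_subspaceT.
- split => [x _||]; first by case: (dF x).
    by apply: cvg_at_right_filter; exact: cF.
  by apply: cvg_at_left_filter; exact: cF.
- by move=> x _; rewrite derive1E; apply: derive_val.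
Qed.

End OneDimIntegral.

Section ReferenceSimplex.
Context {R : realType}.

(** The decomposition of vectors in the iterated integral [leb_int]. *)
Definition vcons p (x : R) (y : 'cV[R]_p) : 'cV[R]_p.+1 :=
  col_mx (const_mx x : 'cV[R]_1) y.

Lemma vcons0 p x (y : 'cV[R]_p) : vcons x y ord0 0 = x.
Proof.
by rewrite mxE; case: splitP => [k|k]; rewrite ?mxE // => /eqP.
Qed.

Lemma vconsS p x (y : 'cV[R]_p) k : vcons x y (lift ord0 k) 0 = y k 0.
Proof.
rewrite mxE; case: splitP => [l|l]; rewrite lift0 ?(ord1 l) //.
by rewrite add1n => -[] /ord_inj ->.
Qed.

Lemma leb_int1 (f : 'cV[R]_1 -> R) v :
  has_int (fun x => f (vcons x 0)) v -> leb_int (fun s => (f s)%:E) = v%:E.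
Proof. by case. Qed.

Lemma leb_int2 (f : 'cV[R]_2 -> R) g v :
  (forall x, has_int (fun y => f (vcons x (vcons y 0))) (g x)) -> has_int g v ->
  leb_int (fun s => (f s)%:E) = v%:E.
Proof.
move=> fg [_ <-] /=; apply: eq_integral => x _; exact: (fg x).2.
Qed.

Lemma has_int_itv_cst a b (c : R) : a <= b ->
  has_int (fun x => \1_`]a, b[ x * c) ((b - a) * c).
Proof.
move=> ab; rewrite mulrC mulrBr.
apply: (has_int_itv (F := fun x => c * x)) => // x; last exact: cvg_cst.
by apply: is_derive_eq; rewrite /GRing.scale /=; ring.
Qed.

Lemma ref_int_cst p (c : R) : p \in [:: 1; 2]%N ->
  fine (leb_int (fun s : 'cV[R]_p => (\1_(ref_simplex (p := p)) s * c)%:E))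
  = c / p`!%:R.
Proof.
rewrite !inE => /orP[] /eqP ->.
  rewrite (@leb_int1 _ c) /= ?divr1 //.
  have := @has_int_itv_cst 0 1 c ler01; rewrite subr0 mul1r.
  congr has_int; apply/funext => x; congr (_ * _); rewrite !indicE; congr ((nat_of_bool _)%:R).
  apply/idP/idP; rewrite !inE /ref_simplex /= in_itv /=.
    by move=> /andP[x0 x1]; split=> [k|]; rewrite ?big_ord1 ?(ord1 k) vcons0.
  by move=> [/(_ ord0) + ]; rewrite big_ord1 vcons0 => -> ->.
have E x y : \1_(ref_simplex (p := 2)) (vcons x (vcons y 0)) * c
    = \1_`]0, 1[ x * (\1_`]0, 1 - x[ y * c).
  rewrite mulrA; congr (_ * _); rewrite !indicE -natrM mulnb; congr ((nat_of_bool _)%:R).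
  apply/idP/andP => [|[]]; rewrite !inE /ref_simplex /= !in_itv /=.
    move=> [h]; have := h ord0; have := h (lift ord0 ord0).
    by rewrite !big_ord_recl big_ord0 !vconsS !vcons0 ?inE /= ?in_itv /=; lra.
  move=> h1 h2; split=> [k|]; last by rewrite !big_ord_recl big_ord0 !vconsS !vcons0; lra.
  case: (unliftP ord0 k) => [l ->|->]; last by rewrite vcons0; lra.
  by rewrite (ord1 l) vconsS vcons0; lra.
rewrite (@leb_int2 _ (fun x => \1_`]0, 1[ x * ((1 - x) * c)) (c / 2)) //.
  move=> x; have -> : (fun y => \1_(ref_simplex (p := 2)) (vcons x (vcons y 0)) * c)
    = (fun y => \1_`]0, 1[ x * (\1_`]0, 1 - x[ y * c)) by apply/funext => y; rewrite E.
  rewrite indicE; case: (boolP (x \in _)) => x01; last first.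
    by rewrite mul0r; under eq_fun do rewrite mul0r; exact: has_int0.
  move: x01; rewrite inE /= in_itv /= => x01.
  apply: has_intZ; rewrite -[X in has_int _ (X * _)]subr0.
  by rewrite -[X in has_int _ (X * _)]/(1 - x - 0); apply: has_int_itv_cst; lra.
rewrite (_ : c / 2 = (c * (1 - 1 ^+ 2 / 2)) - (c * (0 - 0 ^+ 2 / 2))); last by field.
apply: (has_int_itv (F := fun x => c * (x - x ^+ 2 / 2))); first exact: ler01.
  by move=> x; apply: is_derive_eq; rewrite /= /GRing.scale /=; field.
by move=> x; apply: cvgM; [apply: cvgB; [exact: cvg_cst|exact: cvg_id]|exact: cvg_cst].
Qed.

End ReferenceSimplex.

(** * Discrete inner products as sums over vertices *)

Section DiscreteForms.
Context {R : realType} {n J K : nat} (M : mesh R n J K).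
Local Notation vec := 'cV[R]_n.+2.
Hypothesis hd : n.+2 \in [:: 2; 3]%N.
Hypothesis hM : polyhedral_surface M.
Local Notation E j := (edge_mx (verts M j)).
Local Notation bary := (bary M).
Local Notation cellj j := (cell M (vset M j)).
Local Notation ocell j := (open_cell M (vset M j)).

Lemma dim_small : n.+1 \in [:: 1; 2]%N.
Proof. by move: hd; rewrite !inE !eqSS. Qed.

Lemma simplex_int_cst d p (v : 'I_p.+1 -> 'cV[R]_d) F c : p \in [:: 1; 2]%N ->
  (forall s, ref_simplex s -> F (v ord0 + edge_mx v *m s) = c) ->
  simplex_int v F = Num.sqrt (\det ((edge_mx v)^T *m edge_mx v)) * (c / p`!%:R).
Proof.
move=> p12 Fc; rewrite /simplex_int -ref_int_cst //; congr (_ * fine (leb_int _)).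
apply/funext => s; congr (_ %:E); rewrite indicE.
by case: (boolP (s \in _)); rewrite ?mul0r // inE => /Fc ->.
Qed.

Lemma ref_ocell j s : ref_simplex s -> ocell j (verts M j ord0 + E j *m s).
Proof.
case=> s0 s1.
pose b i := oapp (fun k => s k 0) (1 - \sum_k s k 0) (unlift ord0 i).
have bS k : b (lift ord0 k) = s k 0 by rewrite /b liftK.
have b0 : b ord0 = 1 - \sum_k s k 0 by rewrite /b unlift_none.
have b1 : \sum_i b i = 1.
  by rewrite big_ord_recl; under eq_bigr do rewrite bS; rewrite b0 subrK.
have -> : verts M j ord0 + E j *m s = \sum_i b i *: verts M j i.
  rewrite affine_comb //; congr (_ + _ *m _); apply/colP => k.
  by rewrite [RHS]mxE; exact/esym/bS.
apply/(open_cellP hM); split=> [|i].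
  by apply: eq_bigr => i _; rewrite bary_comb.
rewrite bary_comb //; case: (unliftP ord0 i) => [k ->|->]; first by rewrite bS.
by rewrite b0 subr_gt0.
Qed.

Lemma elt_areaE j : elt_area M j = enorm (cross (E j)) / n.+1`!%:R.
Proof.
rewrite /elt_area (@simplex_int_cst _ _ _ _ 1) ?dim_small // mul1r.
by rewrite (enorm_cross (edge_rank hM j)).
Qed.

Lemma elt_area_gt0 j : 0 < elt_area M j.
Proof.
by rewrite elt_areaE divr_gt0 ?ltr0n ?fact_gt0 // enorm_cross_gt0 // edge_rank.
Qed.

Lemma ip_cst (V : Type) (op : V -> V -> R) f g (c : 'I_J -> R) :
  (forall j x, ocell j x -> op (f j x) (g j x) = c j) ->
  ip M op f g = \sum_j elt_area M j * c j.
Proof.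
move=> h; apply: eq_bigr => j _.
rewrite (@simplex_int_cst _ _ _ _ (c j)) ?dim_small //; last first.
  by move=> s /(ref_ocell j); exact: h.
by rewrite -(enorm_cross (edge_rank hM j)) elt_areaE mulrAC mulrA.
Qed.

Lemma iph_cvg (V : Type) (op : V -> V -> R) f g (c : 'I_J -> 'I_n.+2 -> R) :
  (forall j i, op (f j x) (g j x)
     @[x --> within (ocell j) (nbhs (verts M j i))] --> c j i) ->
  iph M op f g = n.+2%:R^-1 * \sum_j elt_area M j * \sum_i c j i.
Proof.
move=> h; congr (_ * _); apply: eq_bigr => j _; congr (_ * _).
apply: eq_bigr => i _; have PF := vertex_proper hM j i.
exact: (cvg_lim (@Rhausdorff R)).
Qed.

Lemma cvg_eq_within j i (f g : vec -> R) (l : R) :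
  (forall x, ocell j x -> f x = g x) ->
  g x @[x --> within (ocell j) (nbhs (verts M j i))] --> l ->
  f x @[x --> within (ocell j) (nbhs (verts M j i))] --> l.
Proof.
move=> fg; apply: cvg_trans; apply: near_eq_cvg.
by rewrite near_withinE; near=> x => xj; rewrite fg.
Unshelve. all: by end_near. Qed.

Lemma cvg_dot {T : Type} (F : set_system T) {FF : Filter F} d (f g : T -> 'cV[R]_d) (a b : 'cV[R]_d) :
  (forall i, f x i 0 @[x --> F] --> a i 0) -> (forall i, g x i 0 @[x --> F] --> b i 0) ->
  dot (f x) (g x) @[x --> F] --> dot a b.
Proof.
move=> fa gb; under eq_fun do rewrite dotE.
by rewrite dotE; apply: cvg_fsum => i _; apply: cvgM.
Qed.

(** By [proj_pinv] the direction of derivation is tangent to the simplex. A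
    short segment in that direction stays in the open simplex, where f is
    affine, so that the difference quotient is constant. *)
Lemma Vh_sgrad f j x l : Vh M f -> ocell j x ->
  sgrad M f j x l 0
  = \sum_k pinv (E j) k l * (f (verts M j (lift ord0 k)) - f (verts M j ord0)).
Proof.
move=> [_ /(_ j) [a [c fE]]] xj; rewrite mxE.
have -> : col l (Defs.proj M j) = E j *m col l (pinv (E j)).
  by rewrite -[Defs.proj M j]/(1%:M - unormal (E j) *m (unormal (E j))^T)
     proj_pinv ?edge_rank // !colE mulmxA.
set v := _ *m _.
have vD : dot a v = \sum_k pinv (E j) k l * (f (verts M j (lift ord0 k)) - f (verts M j ord0)).
  rewrite /v edge_mx_mul dot_sumr; apply: eq_bigr => k _.
  rewrite dotZr mxE !fE ?dotBr; try exact: cell_verts.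
  by rewrite opprD addrACA subrr addr0.
rewrite -vD; apply: (@lim_near_cst R^o); first exact: Rhausdorff.
have /(open_cellP hM) [xE x0] := xj.
have xv (h : R) : x + h *: v = \sum_i bary j (x + h *: v) i *: verts M j i.
  by apply: (plane_line hM (c := h *: col l (pinv (E j)))) => //; rewrite -scalemxAr.
have : \forall h \near (0 : R)^', forall i, 0 < bary j x i + h * dot (bary_grad M j i) v.
  apply: (@filter_forall _ _ _ (0 : R)^') => i.
  have : bary j x i + h * dot (bary_grad M j i) v @[h --> (0 : R)^']
      --> bary j x i + 0 * dot (bary_grad M j i) v.
    apply: cvgD; first exact: cvg_cst.
    apply: cvgM; last exact: cvg_cst.
    exact: nbhs_dnbhs.
  rewrite mul0r addr0 => cv.
  by apply: (cvgr_gt _ cv); exact: x0.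
have : \forall h \near (0 : R)^', h != 0 by exact: nbhs_dnbhs_neq.
apply: filterS2 => h h0 hx /=.
have hc : cellj j (x + h *: v).
  by apply/(cellP hM); split=> // i; rewrite bary_line ltW.
rewrite (addrC (h *: v)) !fE ?dotDr ?dotZr //; last exact: open_cell_sub.
rewrite (_ : _ - _ = h * dot a v); last by ring.
by rewrite /GRing.scale /= mulrA mulVf ?mul1r.
Qed.

Lemma Vh_sgradv f j x : vectorial (Vh M) f -> ocell j x ->
  sgradv M f j x = edge_mx (fun i => f (verts M j i)) *m pinv (E j).
Proof.
move=> fV xj; apply/matrixP => i l; rewrite [LHS]mxE Vh_sgrad // [RHS]mxE.
by apply: eq_bigr => k _; rewrite !mxE mulrC.
Qed.

Lemma coord_Vh : vectorial (Vh M) id.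
Proof.
move=> i; split.
  by apply: continuous_subspaceT => x; exact: coord_continuous.
by move=> j; exists (delta_mx i 0), 0 => x _; rewrite dot_delta addr0.
Qed.

Lemma sgradv_id j x : ocell j x -> sgradv M id j x = E j *m pinv (E j).
Proof. exact: Vh_sgradv coord_Vh. Qed.

(** Testing with a nodal basis function isolates the value at one vertex,
    multiplied by a positive mass. *)
Lemma Vh_uniq f g :
  (forall phi, Vh M phi -> iph M *%R (fun=> f) (fun=> phi) = iph M *%R (fun=> g) (fun=> phi)) ->
  Vh M f -> Vh M g -> forall k, f (vtx M k) = g (vtx M k).
Proof.
move=> fg fV gV k; have [kV kE] := nodal_basisE hM k.
have ev h : Vh M h -> iph M *%R (fun=> h) (fun=> nodal_basis M k)
    = n.+2%:R^-1 * (\sum_j elt_area M j * \sum_i (elt M j i == k)%:R) * h (vtx M k).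
  move=> hV; rewrite (@iph_cvg _ _ _ _ (fun j i => h (verts M j i) * (elt M j i == k)%:R)).
    rewrite -mulrA mulr_suml; congr (_ * _); apply: eq_bigr => j _.
    rewrite -[RHS]mulrA mulr_suml; congr (_ * _); apply: eq_bigr => i _.
    by case: eqP => [<-|]; rewrite ?mul0r ?mulr0 // mul1r mulr1.
  by move=> j i; rewrite -kE; apply: cvgM; exact: Vh_cvg.
have := fg _ kV; rewrite !ev // => /mulfI; apply.
apply: mulf_neq0; first by rewrite invr_eq0 pnatr_eq0.
apply: lt0r_neq0; case: (hM) => _ _ _ /(_ k) [j [i ijk]] _.
rewrite (bigD1 j) //= ltr_wpDr //.
  apply: sumr_ge0 => l _; rewrite mulr_ge0 ?(ltW (elt_area_gt0 l)) //.
  by apply: sumr_ge0 => m _; rewrite ler0n.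
rewrite mulr_gt0 ?elt_area_gt0 // (bigD1 i) //= ijk eqxx ltr_wpDr ?ltr01 //.
by apply: sumr_ge0 => m _; rewrite ler0n.
Qed.

End DiscreteForms.

(** * Calculus of the time derivative *)

Section TimeCalculus.
Context {R : realType}.

Lemma cvg_near_eq (F : set_system R) {FF : Filter F} (f g : R -> R) (l : R) :
  f s @[s --> F] --> l -> (\forall s \near F, f s = g s) -> g s @[s --> F] --> l.
Proof. by move=> fl fg; apply: cvg_trans fl; exact: near_eq_cvg. Qed.

Variables (T t : R).
Hypothesis ht : 0 < t <= T.
Let t0 : 0 < t. Proof. by case/andP: ht. Qed.
Let tT : t <= T. Proof. by case/andP: ht. Qed.
Local Notation FT := (within `[0, T] (t^')).
Local Notation td f l := (is_tderiv (V := R^o) T f t l).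
Implicit Types (f g : R -> R) (c l m : R).

Global Instance time_proper : ProperFilter FT.
Proof.
split; last exact: within_filter.
rewrite /within /= => h.
have : \forall s \near (0 : R)^'+, False.
  have c : t - s @[s --> (0 : R)^'+] --> t^'.
    move=> A [e /= e0 eA]; suff : \forall s \near (0 : R)^'+, A (t - s) by [].
    near=> s.
    have s0 : 0 < s by near: s; exact: nbhs_right_gt.
    have se : s < e by near: s; exact: nbhs_right_lt.
    apply: eA => /=; first by rewrite /ball_ /= opprB addrC subrK gtr0_norm.
    by rewrite -subr_eq0 addrAC subrr add0r oppr_eq0 gt_eqF.
  have := c _ h; rewrite /= nbhs_simpl => hc; near=> s.
  have : `[0, T]%classic (t - s) -> False by near: s; exact: hc.
  apply; rewrite /= in_itv /= subr_ge0; apply/andP; split.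
    by near: s; exact: nbhs_right_le.
  rewrite (le_trans _ tT) // gerBl; near: s; exact: nbhs_right_ge.
by move/filter_ex => [].
Unshelve. all: by end_near. Qed.

Lemma near_time (P : R -> Prop) : (forall s, 0 < s <= T -> s != t -> P s) ->
  \forall s \near FT, P s.
Proof.
move=> h; rewrite near_withinE.
have p : \forall s \near t^', 0 < s by apply: nbhs_dnbhs; exact: lt_nbhsr.
have q : \forall s \near t^', s != t by exact: nbhs_dnbhs_neq.
move: p q; apply: filterS2 => s s0 st; rewrite /= in_itv /= => /andP[_ sT].
by apply: h => //; rewrite s0.
Qed.

Lemma td_cvg f l : td f l -> (f s - f t) / (s - t) @[s --> FT] --> l.
Proof. by move/cvg_near_eq; apply; near=> s; rewrite mulrC.
Unshelve. all: by end_near. Qed.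

Lemma cvg_td f l : (f s - f t) / (s - t) @[s --> FT] --> l -> td f l.
Proof. by move/cvg_near_eq; apply; near=> s; rewrite mulrC.
Unshelve. all: by end_near. Qed.

(** At positive times the difference quotient involves only positive times
    nearby. So the functions need to agree only on the half-open interval,
    where the discrete equations hold. *)
Lemma td_ext f g l : (forall s, 0 < s <= T -> f s = g s) -> td f l -> td g l.
Proof.
move=> fg /td_cvg fl; apply: cvg_td; apply: (cvg_near_eq fl).
by apply: near_time => s sT _; rewrite !fg.
Qed.

Lemma td_unique f l m : td f l -> td f m -> l = m.
Proof. by move=> /td_cvg fl /td_cvg; apply: (norm_cvg_unique fl). Qed.

Lemma td_cst c : td (fun=> c) 0.
Proof.
apply: cvg_td; rewrite subrr (_ : (fun s => 0 / (s - t)) = fun=> 0); first exact: cvg_cst.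
by apply/funext => s; rewrite mul0r.
Qed.

Lemma td_continuous f l : td f l -> f s @[s --> FT] --> f t.
Proof.
move=> /td_cvg fl.
have : f t + (f s - f t) / (s - t) * (s - t) @[s --> FT] --> f t + l * (t - t).
  apply: cvgD; first exact: cvg_cst.
  apply: cvgM => //; apply: cvgB; last exact: cvg_cst.
  apply: cvg_trans (@nbhs_dnbhs _ t); exact: cvg_within.
rewrite subrr mulr0 addr0 => /cvg_near_eq; apply.
by apply: near_time => s _ st; rewrite divfK ?subr_eq0 // addrC subrK.
Qed.

Lemma tdD f g l m : td f l -> td g m -> td (fun s => f s + g s) (l + m).
Proof.
move=> /td_cvg fl /td_cvg gm; apply: cvg_td; apply: (cvg_near_eq (cvgD fl gm)).
by near=> s; rewrite -mulrDl opprD addrACA.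
Unshelve. all: by end_near. Qed.

Lemma tdM f g l m : td f l -> td g m -> td (fun s => f s * g s) (l * g t + f t * m).
Proof.
move=> fl gm; have fc := td_continuous fl; apply: cvg_td.
apply: (cvg_near_eq (cvgD (cvgM (td_cvg fl) (cvg_cst (g t))) (cvgM fc (td_cvg gm)))).
by near=> s => /=; rewrite mulrAC mulrA -mulrDl; congr (_ / _); ring.
Unshelve. all: by end_near. Qed.

Lemma tdZ c f l : td f l -> td (fun s => c * f s) (c * l).
Proof. by move=> fl; have := tdM (td_cst c) fl; rewrite mul0r add0r. Qed.

Lemma tdN f l : td f l -> td (fun s => - f s) (- l).
Proof.
move=> /(tdZ (c := -1)); rewrite mulN1r; apply: td_ext => s _; exact: mulN1r.
Qed.

Lemma tdB f g l m : td f l -> td g m -> td (fun s => f s - g s) (l - m).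
Proof. by move=> fl /tdN; exact: tdD. Qed.

Lemma td_sum (I : Type) (r : seq I) (P : pred I) (f : I -> R -> R) (l : I -> R) :
  (forall i, P i -> td (f i) (l i)) ->
  td (fun s => \sum_(i <- r | P i) f i s) (\sum_(i <- r | P i) l i).
Proof.
move=> h; elim: r => [|i r ih].
  rewrite big_nil; apply: td_ext (td_cst 0) => s _; by rewrite big_nil.
rewrite big_cons; case: ifP => Pi.
  by apply: td_ext (tdD (h _ Pi) ih) => s _; rewrite big_cons Pi.
by apply: td_ext ih => s _; rewrite big_cons Pi.
Qed.

Lemma td_prod (I : eqType) (r : seq I) (f : I -> R -> R) (l : I -> R) :
  uniq r -> (forall i, td (f i) (l i)) ->
  td (fun s => \prod_(i <- r) f i s)
     (\sum_(i <- r) l i * \prod_(k <- r | k != i) f k t).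
Proof.
move=> + h; elim: r => [_|i r ih /= /andP[ir ur]].
  rewrite big_nil; apply: td_ext (td_cst 1) => s _; by rewrite big_nil.
have := tdM (h i) (ih ur).
rewrite big_cons big_cons eqxx /=.
have -> : \prod_(k <- r | k != i) f k t = \prod_(k <- r) f k t.
  rewrite big_seq_cond [RHS]big_seq_cond; apply: eq_bigl => k.
  by case: (boolP (k \in r)) => //= kr; apply: contraNneq ir => <-.
have -> : \sum_(k <- r) l k * \prod_(m <- i :: r | m != k) f m t
   = f i t * \sum_(k <- r) l k * \prod_(m <- r | m != k) f m t.
  rewrite mulr_sumr big_seq [RHS]big_seq; apply: eq_bigr => k kr.
  rewrite big_cons ifT; first by rewrite mulrCA.
  by apply: contraNneq ir => ->.
by apply: td_ext => s _; rewrite big_cons.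
Qed.

Lemma tdV f l : td f l -> f t != 0 -> td (fun s => (f s)^-1) (- l / f t ^+ 2).
Proof.
move=> fl ft; have fc := td_continuous fl; apply: cvg_td.
rewrite expr2 invfM.
apply: (cvg_near_eq (cvgM (cvgN (td_cvg fl)) (cvgM (cvgV ft fc) (cvg_cst (f t)^-1)))).
have f0 : \forall s \near FT, f s != 0.
  by apply: (cvgr_neq0 _ fc).
have st : \forall s \near FT, s != t by apply: near_time.
move: f0 st; apply: filterS2 => s f0 st /=.
rewrite -[X in X * _]/(- ((f s - f t) / (s - t))).
by field; rewrite ft f0 /= ?subr_eq0 st.
Qed.

Lemma td_sqrt f l : td f l -> 0 < f t -> td (fun s => Num.sqrt (f s)) (l / (2 * Num.sqrt (f t))).
Proof.
move=> fl ft; have fc := td_continuous fl; apply: cvg_td.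
have sc : Num.sqrt (f s) @[s --> FT] --> Num.sqrt (f t).
  exact: (cvg_comp _ _ fc (@sqrt_continuous R (f t))).
have s0 : Num.sqrt (f t) != 0 by rewrite sqrtr_eq0 -ltNge.
have s20 : Num.sqrt (f t) + Num.sqrt (f t) != 0.
  by rewrite -mulr2n mulrn_eq0.
rewrite mulr_natl mulr2n.
apply: (cvg_near_eq (cvgM (td_cvg fl) (cvgV s20 (cvgD sc (cvg_cst (Num.sqrt (f t))))))).
have f0 : \forall s \near FT, 0 < f s by apply: (cvgr_gt _ fc).
have st : \forall s \near FT, s != t by apply: near_time.
move: f0 st; apply: filterS2 => s f0 st /=.
have p1 : 0 < Num.sqrt (f s) by rewrite sqrtr_gt0.
have p2 : 0 < Num.sqrt (f t) by rewrite sqrtr_gt0.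
rewrite -[LHS]/((f s - f t) / (s - t) * (Num.sqrt (f s) + Num.sqrt (f t))^-1).
rewrite (_ : f s - f t = Num.sqrt (f s) ^+ 2 - Num.sqrt (f t) ^+ 2); last first.
  by rewrite !sqr_sqrtr // ltW.
by field; rewrite subr_eq0 st /=; apply: lt0r_neq0; lra.
Qed.

End TimeCalculus.

Section MatrixCalculus.
Context {R : realType}.
Variables (T t : R).
Hypothesis ht : 0 < t <= T.
Local Notation td f l := (is_tderiv (V := R^o) T f t l).

Definition tdm m p (F : R -> 'M[R]_(m, p)) (L : 'M[R]_(m, p)) :=
  forall i j, td (fun s => F s i j) (L i j).

Lemma tdm_ext m p (F H : R -> 'M[R]_(m, p)) L :
  (forall s, 0 < s <= T -> F s = H s) -> tdm F L -> tdm H L.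
Proof. by move=> FH FL i j; apply: (td_ext ht _ (FL i j)) => s sT; rewrite FH. Qed.

Lemma tdm_unique m p (F : R -> 'M[R]_(m, p)) L L' : tdm F L -> tdm F L' -> L = L'.
Proof. by move=> h h'; apply/matrixP => i j; exact: (td_unique ht (h i j) (h' i j)). Qed.

Lemma tdm_cst m p (A : 'M[R]_(m, p)) : tdm (fun=> A) 0.
Proof. by move=> i j; rewrite mxE; exact: td_cst. Qed.

Lemma tdmM m p q (F : R -> 'M[R]_(m, p)) (H : R -> 'M[R]_(p, q)) L N :
  tdm F L -> tdm H N -> tdm (fun s => F s *m H s) (L *m H t + F t *m N).
Proof.
move=> FL HN i j; rewrite !mxE -big_split /=.
apply: (td_ext ht); last by apply: td_sum => // k _; apply: tdM (FL i k) (HN k j).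
by move=> s _; rewrite mxE.
Qed.

Lemma tdmT m p (F : R -> 'M[R]_(m, p)) L : tdm F L -> tdm (fun s => (F s)^T) L^T.
Proof.
move=> FL i j; rewrite mxE; apply: (td_ext ht _ (FL j i)) => s _; by rewrite mxE.
Qed.

Lemma tdmZ m p (f : R -> R) (F : R -> 'M[R]_(m, p)) (l : R) L : td f l -> tdm F L ->
  tdm (fun s => f s *: F s) (l *: F t + f t *: L).
Proof.
move=> fl FL i j; rewrite !mxE; apply: (td_ext ht _ (tdM ht fl (FL i j))) => s _.
by rewrite mxE.
Qed.

Lemma td_trace m (F : R -> 'M[R]_m) L : tdm F L -> td (fun s => \tr (F s)) (\tr L).
Proof. by move=> FL; apply: td_sum => // i _; exact: FL. Qed.

(** Jacobi's formula: in the Leibniz expansion one row at a time is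
    differentiated, and the expansion of the resulting determinant along this
    row gives the adjugate. *)
Lemma td_det m (F : R -> 'M[R]_m) L : tdm F L ->
  td (fun s => \det (F s)) (\tr (L *m \adj (F t))).
Proof.
move=> FL.
have -> : \tr (L *m \adj (F t)) = \sum_(s : 'S_m) (-1) ^+ s *
    \sum_i L i (s i) * \prod_(k | k != i) F t k (s k).
  rewrite [RHS](eq_bigr (fun s : 'S_m => \sum_i (-1) ^+ s *
      (L i (s i) * \prod_(k | k != i) F t k (s k)))); last first.
    by move=> s _; rewrite mulr_sumr.
  rewrite exchange_big /=; apply: eq_bigr => i _.
  (* F with its i-th row replaced by that of L. *)
  pose Fi := \matrix_(a, b) if a == i then L a b else F t a b.
  transitivity (\det Fi).
    rewrite (expand_det_row _ i) mxE; apply: eq_bigr => j _.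
    rewrite !mxE eqxx; congr (_ * _); congr (_ * \det _); apply/matrixP => a b.
    by rewrite !mxE eq_sym (negPf (neq_lift _ _)).
  apply: eq_bigr => s _; congr (_ * _); rewrite (bigD1 i) //= mxE eqxx.
  by congr (_ * _); apply: eq_bigr => k /negPf ki; rewrite mxE ki.
apply: td_sum => // s _; apply: tdZ => //.
apply: (td_prod ht (f := fun i u => F u i (s i)) (l := fun i => L i (s i))) => //.
exact: index_enum_uniq.
Qed.

(** Cramer's rule gives differentiability; the value then follows by
    differentiating the product of F and its inverse. *)
Lemma tdm_inv m (F : R -> 'M[R]_m) L : (forall s, 0 < s <= T -> F s \in unitmx) ->
  tdm F L -> tdm (fun s => invmx (F s)) (- (invmx (F t) *m L *m invmx (F t))).
Proof.
move=> Fu FL; have Ftu : F t \in unitmx by exact: Fu.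
have [N FN] : exists N, tdm (fun s => invmx (F s)) N.
  have adj i j : exists l, td (fun s => \adj (F s) i j) l.
    have [l hl] : exists l, td (fun s => \det (row' j (col' i (F s)))) l.
      eexists; apply: td_det => a b; instantiate (1 := row' j (col' i L)).
      rewrite !mxE; apply: (td_ext ht _ (FL _ _)) => s _; by rewrite !mxE.
    exists ((-1) ^+ (j + i) * l).
    by apply: (td_ext ht _ (tdZ ht hl)) => s _; rewrite mxE.
  pose N i j := projT1 (cid (adj i j)).
  have dV := tdV ht (td_det FL) _.
  eexists; apply: tdm_ext; last first.
    apply: tdmZ; first by apply: dV; rewrite -unitfE -unitmxE.
    by instantiate (1 := \matrix_(i, j) N i j) => i j; rewrite mxE; exact: projT2.
  by move=> s sT; rewrite /invmx Fu.
suff -> : - (invmx (F t) *m L *m invmx (F t)) = N by [].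
have h1 := tdmM FN FL.
(* The product is constant, and the derivative of the inverse follows from
   uniqueness of derivatives. *)
have h2 : tdm (fun s => invmx (F s) *m F s) 0.
  by apply: tdm_ext (tdm_cst 1%:M) => s sT; rewrite mulVmx ?Fu.
have /eqP := tdm_unique h1 h2; rewrite addr_eq0 => /eqP e.
by rewrite -mulNmx -e -mulmxA mulmxV ?mulmx1.
Qed.

End MatrixCalculus.

(** * Kinematics of a simplex *)

Lemma row_mx0 (R : realType) n (u : 'cV[R]_n.+2) (E : 'M[R]_(n.+2, n.+1)) a :
  (row_mx u E : 'M[R]_n.+2) a ord0 = u a 0.
Proof. by rewrite mxE; case: splitP => // k _; rewrite (ord1 k). Qed.

Lemma row_mxS (R : realType) n (u : 'cV[R]_n.+2) (E : 'M[R]_(n.+2, n.+1)) a k :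
  (row_mx u E : 'M[R]_n.+2) a (lift ord0 k) = E a k.
Proof.
rewrite mxE; case: splitP => [l|l]; rewrite lift0 ?(ord1 l) //.
by rewrite add1n => -[] /ord_inj ->.
Qed.

Section EvolvingSimplex.
Context {R : realType} {n : nat}.
Variables (T t : R).
Hypothesis ht : 0 < t <= T.
Local Notation td f l := (is_tderiv (V := R^o) T f t l).
Variables (E : R -> 'M[R]_(n.+2, n.+1)) (E' : 'M[R]_(n.+2, n.+1)).
Hypothesis rkE : forall s, 0 < s <= T -> \rank (E s) = n.+1.
Hypothesis dE : tdm T t E E'.

Local Notation area s := (enorm (cross (E s))).
Local Notation W := (E' *m pinv (E t)).
Local Notation nu := (unormal (E t)).
Local Notation Pt := (1%:M - nu *m nu^T).

Let rkEt : \rank (E t) = n.+1. Proof. exact: rkE. Qed.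

Lemma trmx_gram m p (A : 'M[R]_(m, p)) : (A^T *m A)^T = A^T *m A.
Proof. by rewrite trmx_mul trmxK. Qed.

Lemma tdm_gram : tdm T t (fun s => (E s)^T *m E s) (E'^T *m E t + (E t)^T *m E').
Proof. by apply: tdmM => //; exact: tdmT. Qed.

Lemma adj_unitmx m (A : 'M[R]_m) : A \in unitmx -> \adj A = \det A *: invmx A.
Proof.
move=> Au; rewrite /invmx Au scalerA mulfV ?scale1r //.
by rewrite -unitfE -unitmxE.
Qed.

(** Jacobi's formula for the Gram determinant. W is the surface gradient of
    the velocity, hence its trace is the divergence. *)
Lemma td_area : td (fun s => area s) (area t * \tr W).
Proof.
have Gu := gram_unit rkEt.
have D0 := det_gram_gt0 rkEt.
have := td_sqrt ht (td_det ht tdm_gram) D0.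
have -> : \tr ((E'^T *m E t + (E t)^T *m E') *m \adj ((E t)^T *m E t))
     = \det ((E t)^T *m E t) * (2 * \tr W).
  rewrite adj_unitmx // -scalemxAr mxtraceZ mulmxDl raddfD /=; congr (_ * _).
  rewrite (mulr_natl _ 2) mulr2n; congr (_ + _).
    rewrite -mxtrace_tr !trmx_mul trmxK trmx_inv trmx_gram mxtrace_mulC.
    by rewrite -mulmxA mxtrace_mulC mulmxA.
  by rewrite /pinv mxtrace_mulC [RHS]mxtrace_mulC mulmxA.
rewrite -{1}(sqr_sqrtr (ltW D0)) -enorm_cross //.
rewrite (_ : _ / _ = area t * \tr W); last first.
  by field; rewrite lt0r_neq0 // enorm_cross_gt0.
by apply: td_ext => // s sT; rewrite -enorm_cross // rkE.
Qed.

Lemma td_cross : exists L, tdm T t (fun s => cross (E s)) L.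
Proof.
have h i : exists l, td (fun s => \det (row_mx (delta_mx i 0 : 'cV[R]_n.+2) (E s) : 'M[R]_n.+2)) l.
  eexists; apply: td_det => // a b.
  instantiate (1 := row_mx (0 : 'cV[R]_n.+2) E').
  case: (unliftP ord0 b) => [k ->|->].
    rewrite row_mxS; apply: (td_ext ht _ (@dE a k)) => s _; exact/esym/row_mxS.
  rewrite row_mx0 mxE; apply: (td_ext ht _ (td_cst _ _ ((delta_mx i 0 : 'cV[R]_n.+2) a 0))) => s _.
  exact/esym/row_mx0.
exists (\col_i projT1 (cid (h i))) => i j; rewrite mxE.
by apply: (td_ext ht _ (projT2 (cid (h i)))) => // s _; rewrite mxE.
Qed.

(** The derivative N of the normal is determined by its products with the
    edges, from [E^T nu = 0], and with the normal, from [|nu| = 1]. *)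
Lemma tdm_normal : tdm T t (fun s => unormal (E s)) (- (W^T *m nu)).
Proof.
have [L cL] := td_cross.
have aV := tdV ht td_area (lt0r_neq0 (enorm_cross_gt0 rkEt)).
have := tdmZ ht aV cL.
set N := (X in tdm _ _ _ X) => dN; suff <- : N = - (W^T *m nu) by exact: dN.
have dn : tdm T t (fun s => unormal (E s)) N by exact: dN.
have e1 : E'^T *m nu + (E t)^T *m N = 0.
  apply: (tdm_unique ht (tdmM ht (tdmT ht dE) dn)).
  by apply: tdm_ext (tdm_cst _ _ _) => // s sT; rewrite unormal_orth.
have e2 : nu^T *m N = 0.
  have : N^T *m nu + nu^T *m N = 0.
    apply: (tdm_unique ht (tdmM ht (tdmT ht dn) dn)).
    apply: tdm_ext (tdm_cst _ _ 1%:M) => // s sT.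
    by apply/matrixP => i j; rewrite !ord1 mxE -(unormal1 (rkE sT)).
  rewrite -{1}(trmxK nu) -trmx_mul; move/matrixP => /(_ 0 0).
  rewrite mxE [X in X + _]mxE [RHS]mxE -mulr2n => /eqP; rewrite mulrn_eq0 /= => /eqP h.
  by apply/matrixP => i j; rewrite !ord1 h mxE.
have -> : N = Pt *m N by rewrite mulmxBl mul1mx -mulmxA e2 mulmx0 subr0.
have PT : Pt = (pinv (E t))^T *m (E t)^T.
  by rewrite -trmx_mul -(proj_pinv rkEt) raddfB /= trmx1 trmx_mul trmxK.
rewrite PT -mulmxA; move/eqP: e1; rewrite addrC addr_eq0 => /eqP ->.
by rewrite mulmxN mulmxA -trmx_mul.
Qed.

(** Differentiation of [(E^T E)^-1 E^T], written with the surface gradient W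
    of the velocity and the projection onto the tangent plane. *)
Lemma tdm_pinv : tdm T t (fun s => pinv (E s))
  (pinv (E t) *m W^T *m (1%:M - Pt) - pinv (E t) *m W).
Proof.
have Gu s : 0 < s <= T -> (E s)^T *m E s \in unitmx by move=> sT; apply: gram_unit; exact: rkE.
have Gt : (E t)^T *m E t \in unitmx by exact: Gu.
have h := tdmM ht (tdm_inv ht Gu tdm_gram) (tdmT ht dE).
rewrite (_ : _ - _ *m W = - (invmx ((E t)^T *m E t) *m (E'^T *m E t + (E t)^T *m E') *m
    invmx ((E t)^T *m E t)) *m (E t)^T + invmx ((E t)^T *m E t) *m E'^T) //.
have e1 : pinv (E t) *m W^T = invmx ((E t)^T *m E t) *m E'^T.
  rewrite trmx_mul /pinv trmx_mul trmxK trmx_inv trmx_gram.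
  by rewrite !mulmxA -(mulmxA (invmx _) (E t)^T) mulVmx // mul1mx.
rewrite e1 proj_pinv // mulmxBr mulmx1 /pinv mulNmx mulmxDr !mulmxDl opprD !mulmxA.
by rewrite -addrA addrC.
Qed.

(** The trace of [F *m pinv E] is the divergence of an affine field whose
    nodal values have the differences F. With F fixed this is, up to the
    factor (d-1)!, the derivative of the integral of the divergence of a field
    carried by the simplex. *)
Lemma td_div (F : 'M[R]_(n.+2, n.+1)) (K := F *m pinv (E t)) :
  td (fun s => area s * \tr (F *m pinv (E s)))
     (area t * (\tr W * \tr K + \tr (K *m W^T) - \tr (K *m W^T *m Pt) - \tr (K *m W))).
Proof.
have h := td_trace ht (tdmM ht (tdm_cst T t F) tdm_pinv).
have := tdM ht td_area h; rewrite mul0mx add0r.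
rewrite (_ : _ + _ = area t * (\tr W * \tr K + \tr (K *m W^T) - \tr (K *m W^T *m Pt)
   - \tr (K *m W))) //.
rewrite -mulrA -mulrDr; congr (_ * _); rewrite -!addrA; congr (_ + _).
rewrite mulmxBr raddfB /= !mulmxA mulmxBr mulmx1 raddfB /= ?addrA.
by rewrite /K /pinv !mulmxA.
Qed.

End EvolvingSimplex.

(** * Fields carried by the mesh and the boundary at rest *)

Section ConstantInTime.
Context {R : realType}.
Variable T : R.

Lemma tderiv0_constant (f : R -> R) :
  (forall t, 0 < t <= T -> is_tderiv (V := R^o) T f t 0) ->
  forall s t, 0 < s <= T -> 0 < t <= T -> f s = f t.
Proof.
move=> df; suff lt s t : 0 < s <= T -> 0 < t <= T -> s < t -> f s = f t.
  by move=> s t hs h; case: (ltgtP s t) => [|ts|->//]; [exact: lt|apply/esym/lt].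
move=> /andP[s0 sT] /andP[t0 tT] st.
have df0 u : u \in `]s, t[%R -> is_derive (u : R) 1 f 0.
  rewrite in_itv /= => /andP[su ut].
  have hu : 0 < u <= T by rewrite (lt_trans s0 su) (le_trans (ltW ut) tT).
  have := df u hu => /(td_cvg) fu.
  have fu' : (f v - f u) / (v - u) @[v --> u^'] --> (0 : R).
    move=> A /fu hA.
    have hA' : \forall v \near u^', `[0, T]%classic v -> A ((f v - f u) / (v - u)) by exact: hA.
    suff : \forall v \near u^', A ((f v - f u) / (v - u)) by [].
    have inT : \forall v \near u^', `[0, T]%classic v.
      apply: nbhs_dnbhs; have : \forall v \near u, v \in `]0, T[%R.
        by apply: (@near_in_itvoo R 0 T u); rewrite in_itv /= (lt_trans s0 su) (lt_le_trans ut tT).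
      by apply: filterS => v; rewrite /= !in_itv /= => /andP[v0 vT]; rewrite !ltW.
    by move: hA' inT; apply: filterS2 => v h hv; exact: h.
  have fh : h^-1 *: ((f \o shift u) (h *: (1 : R)) - f u) @[h --> (0 : R)^'] --> (0 : R).
    have c : h + u @[h --> (0 : R)^'] --> u^'.
      move=> A [e /= e0 eA]; suff : \forall h \near (0 : R)^', A (h + u) by [].
      exists e => //= h; rewrite /ball_ /= sub0r normrN => he h0; apply: eA => /=.
        by rewrite /ball_ /= opprD addrCA subrr addr0 normrN.
      by rewrite -subr_eq0 addrK.
    have := cvg_comp _ _ c fu'; apply: cvg_trans; apply: near_eq_cvg.
    near=> h => /=; rewrite addrK mulrC; congr (_ * (f _ - _)).
    by rewrite /GRing.scale /= mulr1.
  split; first by apply/cvg_ex; exists 0.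
  exact: (cvg_lim (@Rhausdorff R)).
have cf : {within `[s, t], continuous f}.
  apply/subspace_continuousP => u; rewrite /= in_itv /= => /andP[su ut].
  have hu : 0 < u <= T by rewrite (lt_le_trans s0 su) (le_trans ut tT).
  have := td_continuous hu (df u hu) => fu.
  apply/cvgrPdist_lt => e e0; have /cvgrPdist_lt /(_ e e0) := fu.
  rewrite !near_withinE => h.
  move: h; apply: filterS => v h; rewrite /= in_itv /= => /andP[sv vt].
  have [->|vu] := eqVneq v u; first by rewrite subrr normr0.
  by apply: h => //; rewrite /= in_itv /= (le_trans (ltW s0) sv) (le_trans vt tT).
have [c _] := MVT st df0 cf.
by rewrite mul0r => /eqP; rewrite subr_eq0 => /eqP.
Unshelve. all: by end_near. Qed.

End ConstantInTime.

Section Interpolation.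
Context {R : realType} {n J K : nat} (M : mesh R n J K).
Local Notation vec := 'cV[R]_n.+2.
Hypothesis hM : polyhedral_surface M.

Lemma interp_comb (a b : 'I_K -> R) j : weights (vset M j) b -> (forall k, 0 <= b k) ->
  interp M a (combination M b) = \sum_k b k * a k.
Proof.
move=> wb b0; have bj : cell M (vset M j) (combination M b) by exists b.
rewrite (interpE hM a bj) (@sum_vset _ _ _ _ _ hM _ _ j).
  by apply: eq_bigr => i _; rewrite (bary_weights hM _ wb).
by case: wb => h _ k /h ->; rewrite mul0r.
Qed.

Lemma facet_sub j i : facet M j i \subset vset M j.
Proof. by apply/fintype.subsetP => k /imsetP[l _ ->]; exact: in_vset. Qed.

Lemma weights_sub (F H : {set 'I_K}) (b : 'I_K -> R) : F \subset H ->
  weights F b -> weights H b.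
Proof.
move=> /fintype.subsetP FH [b0 b1]; split=> // k kH; apply: b0.
by apply: contra kH; exact: FH.
Qed.

Lemma boundary_surface x : boundary M x -> surface M x.
Proof.
move=> [j [a [_ [b [wb b0 ->]]]]]; exists j, b; split=> //.
exact: weights_sub (facet_sub j a) wb.
Qed.

(** Integrals over a facet only involve combinations of the vertices of that
    facet. *)
Lemma facet_point j a s : ref_simplex s ->
  exists b, [/\ weights (facet M j a) b, forall k, 0 <= b k &
    facet_verts M j a ord0 + edge_mx (facet_verts M j a) *m s = combination M b].
Proof.
case=> s0 s1.
pose c i := oapp (fun k => s k 0) (1 - \sum_k s k 0) (unlift ord0 i) : R.
have cS k : c (lift ord0 k) = s k 0 by rewrite /c liftK.
have c0 : c ord0 = 1 - \sum_k s k 0 by rewrite /c unlift_none.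
have c1 : \sum_i c i = 1.
  by rewrite big_ord_recl; under eq_bigr do rewrite cS; rewrite c0 subrK.
have cp i : 0 <= c i.
  by case: (unliftP ord0 i) => [k ->|->]; [rewrite cS ltW|rewrite c0 subr_ge0 ltW].
pose b i := oapp c 0 (unlift a i).
have bS k : b (lift a k) = c k by rewrite /b liftK.
have ba : b a = 0 by rewrite /b unlift_none.
have b1 : \sum_i b i = 1.
  by rewrite (bigD1_ord a) //= ba add0r; under eq_bigr do rewrite bS.
exists (spread M j b); split.
- split; last by case: (spread_weights hM j b1).
  move=> k kf; rewrite /spread big1 // => i _.
  case: eqP => [ik|]; last by rewrite mul0r.
  have [->|ia] := eqVneq i a; first by rewrite ba mulr0.
  by move: kf; rewrite -ik; case/negP; apply/imsetP; exists i.
- move=> k; apply: sumr_ge0 => i _; rewrite mulr_ge0 ?ler0n // /b.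
  by case: (unlift a i) => //= l; exact: cp.
- rewrite spread_comb // (bigD1_ord a) //= ba scale0r add0r.
  under eq_bigr do rewrite bS.
  rewrite edge_mx_mul [RHS]big_ord_recl.
  under [in RHS]eq_bigr do rewrite cS.
  rewrite c0 scalerBl scale1r -addrA; congr (_ + _).
  rewrite addrC scaler_suml -sumrB; apply: eq_bigr => k _; exact: scalerBr.
Qed.

End Interpolation.

Lemma simplex_int_ext (R : realType) d p (v : 'I_p.+1 -> 'cV[R]_d) (F H : 'cV[R]_d -> R) :
  (forall s, ref_simplex s -> F (v ord0 + edge_mx v *m s) = H (v ord0 + edge_mx v *m s)) ->
  simplex_int v F = simplex_int v H.
Proof.
move=> FH; rewrite /simplex_int; congr (_ * fine (leb_int _)); apply/funext => s.
rewrite indicE; case: (boolP (s \in _)); rewrite ?mul0r // inE => hs.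
by rewrite !mul1r FH.
Qed.

Lemma leb_int0 (R : realType) p : leb_int (fun _ : 'cV[R]_p => 0%E) = 0%E.
Proof.
elim: p => //= p ih; rewrite (_ : (fun _ => leb_int _) = fun=> 0%E) ?integral0 //.
by apply/funext.
Qed.

Lemma simplex_int0 (R : realType) d p (v : 'I_p.+1 -> 'cV[R]_d) :
  simplex_int v (fun=> 0) = 0.
Proof.
rewrite /simplex_int (_ : (fun s => _) = fun=> 0%E) ?leb_int0 ?mulr0 //.
by apply/funext => s; rewrite mulr0.
Qed.

Section EvolvingMesh.
Context {R : realType} {n J K : nat}.
Variable G : evolution R n J K.
Hypothesis hG : evolving_polyhedral_surface G.
Local Notation vec := 'cV[R]_n.+2.
Local Notation T := (final_time G).
Local Notation M := (at_time G).

Lemma mesh_ok s : 0 < s <= T -> polyhedral_surface (M s).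
Proof. by move=> /andP[s0 sT]; case: hG => _ h _ _; apply: h; rewrite ltW. Qed.

Lemma time_cc s : 0 < s <= T -> 0 <= s <= T.
Proof. by move=> /andP[/ltW -> ->]. Qed.

Definition nodal_velocity t (k : 'I_K) : vec := tderiv T (fun s => pos G s k) t.

Lemma tdm_pos t k : 0 < t <= T -> tdm T t (fun s => pos G s k) (nodal_velocity t k).
Proof.
move=> ht; have PF := time_proper ht.
case: hG => /(_ k) [/(_ t (time_cc ht)) [l hl] _] _ _ _ i j.
have -> : nodal_velocity t k = l by exact: norm_cvg_lim.
have := cvg_comp _ _ hl (@coord_continuous R _ _ i j l).
apply: cvg_trans; apply: near_eq_cvg; near=> s => /=.
by rewrite !mxE.
Unshelve. all: by end_near. Qed.

Lemma velocity_vtx t k : 0 < t <= T -> velocity G t (vtx (M t) k) = nodal_velocity t k.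
Proof.
move=> /mesh_ok hM; rewrite /velocity.
under eq_bigr => l _ do rewrite (nodal_basisE hM l).2 eq_sym.
rewrite (bigD1 k) //= eqxx scale1r big1 ?addr0 // => l /negPf ->.
by rewrite scale0r.
Qed.

Lemma tdm_edge t j : 0 < t <= T -> tdm T t (fun s => edge_mx (verts (M s) j))
  (edge_mx (fun i => nodal_velocity t (conn G j i))).
Proof.
move=> ht a b; rewrite mxE.
have h k := @tdm_pos t k ht a 0.
by apply: (td_ext ht _ (tdB ht (h _) (h _))) => s _; rewrite mxE.
Qed.

(** Interpolants carried by the mesh: their discrete material derivative is
    zero. *)
Definition frozen (a : 'I_K -> vec) s (x : vec) : vec :=
  \col_l interp (M s) (fun k => a k l 0) x.

Lemma frozen_Vh a s : 0 < s <= T -> vectorial (Vh (M s)) (frozen a s).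
Proof.
move=> /mesh_ok hM i; have := interp_Vh hM (fun k => a k i 0).
by congr (Vh _ _); apply/funext => x; rewrite mxE.
Qed.

Lemma frozen_vtx a s k : 0 < s <= T -> frozen a s (vtx (M s) k) = a k.
Proof. by move=> /mesh_ok hM; apply/colP => l; rewrite mxE interp_vtx. Qed.

Hypothesis still : forall s, 0 < s <= T -> vectorial (Vh0 (M s)) (velocity G s).

(** The connectivity is constant in time, so the mesh at time 0 names the
    boundary facets of all times. *)
Definition boundary_vertex (k : 'I_K) :=
  exists j a, boundary_facet (M 0) j a /\ k \in facet (M 0) j a.

Lemma boundary_vertex_velocity t k : 0 < t <= T -> boundary_vertex k ->
  nodal_velocity t k = 0.
Proof.
move=> ht [j [a [bf kf]]]; apply/colP => i; rewrite -velocity_vtx // [RHS]mxE.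
have [_ ->//] := still ht i; exists j, a; split=> //.
exists (fun l => (l == k)%:R); split.
- split=> [l|].
    by case: eqP => // -> /negP; case; exact: kf.
  by rewrite (bigD1 k) //= eqxx big1 ?addr0 // => l /negPf ->.
- by move=> l; rewrite ler0n.
- rewrite /combination (bigD1 k) //= eqxx scale1r big1 ?addr0 // => l /negPf ->.
  by rewrite scale0r.
Qed.

Lemma boundary_vertex_fixed k s t : boundary_vertex k ->
  0 < s <= T -> 0 < t <= T -> pos G s k = pos G t k.
Proof.
move=> bk hs ht; apply/colP => i.
apply: (@tderiv0_constant _ T (fun s => pos G s k i 0)) => // u hu.
have := @tdm_pos u k hu i 0; rewrite boundary_vertex_velocity //.
by rewrite mxE.
Qed.

Lemma boundary_combination (b : 'I_K -> R) j a s t : boundary_facet (M 0) j a ->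
  weights (facet (M 0) j a) b -> 0 < s <= T -> 0 < t <= T ->
  combination (M s) b = combination (M t) b.
Proof.
move=> bf [b0 _] hs ht; apply: eq_bigr => k _.
case: (boolP (k \in facet (M 0) j a)) => [kf|/b0 ->]; last by rewrite !scale0r.
by congr (_ *: _); apply: boundary_vertex_fixed => //; exists j, a.
Qed.

Lemma frozen_boundary c (b : 'I_K -> R) j a s t : boundary_facet (M 0) j a ->
  weights (facet (M 0) j a) b -> (forall k, 0 <= b k) -> 0 < s <= T -> 0 < t <= T ->
  frozen c s (combination (M s) b) = frozen c t (combination (M s) b).
Proof.
move=> bf wb b0 hs ht; have bst := boundary_combination bf wb hs ht.
have h u : 0 < u <= T -> frozen c u (combination (M u) b) = \sum_k b k *: c k.
  move=> hu; apply/colP => l; rewrite mxE summxE.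
  rewrite (interp_comb (mesh_ok hu) _ (weights_sub (facet_sub (M 0) j a) wb)) //.
  by apply: eq_bigr => k _; rewrite mxE.
by rewrite h // bst h.
Qed.

Lemma frozen_Vbd1 c s t : 0 < s <= T -> 0 < t <= T ->
  vectorial (Vbd1 G t) (frozen c t) -> vectorial (Vbd1 G s) (frozen c s).
Proof.
move=> hs ht cV i; split; first exact: frozen_Vh.
move=> x x1; have [_ c0] := cV i.
suff -> : frozen c s x = frozen c t x by exact: c0.
have : boundary (M s) x by case: hG => _ _ /(_ s (time_cc hs)) -> _; left.
by move=> [j [a [bf [b [wb b0 xE]]]]]; rewrite xE (frozen_boundary c bf wb b0 hs ht).
Qed.

(** Neither the boundary nor the values on it of a field carried by the mesh
    move. This is why the datum on the boundary does not contribute to the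
    derivative of the curvature equation. *)
Lemma boundary_ip_frozen mu c s t : 0 < s <= T -> 0 < t <= T ->
  boundary_ip (M s) (bd2 G) mu (frozen c s) = boundary_ip (M t) (bd2 G) mu (frozen c t).
Proof.
move=> hs ht; apply: eq_bigr => j _; apply: eq_bigr => a bf.
have <- : facet_verts (M s) j a = facet_verts (M t) j a.
  apply/funext => i; apply: boundary_vertex_fixed => //; exists j, a; split=> //.
  by apply/imsetP; exists (lift a i) => //; rewrite inE eq_sym neq_lift.
apply: simplex_int_ext => sg /(facet_point (mesh_ok hs) j a) [b [wb b0 ->]].
by rewrite (frozen_boundary c bf wb b0 hs ht).
Qed.

Lemma boundary_ip_zero mu t f : 0 < t <= T -> vectorial (Vh0 (M t)) f ->
  boundary_ip (M t) (bd2 G) mu f = 0.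
Proof.
move=> ht fV; rewrite /boundary_ip big1 // => j _; rewrite big1 // => a bf.
rewrite -[RHS](simplex_int0 (facet_verts (M t) j a)); apply: simplex_int_ext => sg.
move=> /(facet_point (mesh_ok ht) j a) [b [wb b0 ->]].
rewrite (_ : f _ = 0) ?dot0r ?mulr0 //; apply/colP => i; rewrite mxE.
by have [_ ->//] := fV i; exists j, a; split=> //; exists b.
Qed.

End EvolvingMesh.

Section MaterialDerivative.
Context {R : realType} {n J K : nat}.
Variable G : evolution R n J K.
Hypothesis hG : evolving_polyhedral_surface G.
Local Notation vec := 'cV[R]_n.+2.
Local Notation T := (final_time G).
Local Notation M := (at_time G).

Lemma trajectory_vertex t j i s : 0 < t <= T -> 0 < s <= T ->
  trajectory G t j (verts (M t) j i) s = pos G s (conn G j i).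
Proof.
move=> ht hs; have hM := mesh_ok hG ht; rewrite /trajectory /barycentric.
rewrite (barycentricE hM (cell_verts hM j i)).
rewrite -[LHS]/(combination (M s) (spread (M s) j (bary (M t) j (verts (M t) j i)))).
rewrite (spread_comb (mesh_ok hG hs)) ?sum_bary //.
by under eq_bigr do rewrite (bary_verts hM); rewrite (sum_delta i (verts (M s) j)).
Qed.

(** A vertex is transported to itself, so the material derivative at a vertex
    is the derivative of the nodal value; its continuity in space-time
    provides the elementwise limits of the lumped products. *)
Lemma VT_nodal chi : VT G chi -> exists g : R -> 'I_K -> R, forall t, 0 < t <= T ->
  (forall k, is_tderiv (V := R^o) T (fun s => chi s (pos G s k)) t (g t k)) /\
  forall j i, material_deriv G chi t j x
    @[x --> within (open_cell (M t) (vset (M t) j)) (nbhs (verts (M t) j i))]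
    --> g t (conn G j i).
Proof.
move=> [_ _ [g [gc gd]]]; exists (fun t k => g (t, pos G t k)) => t ht.
have hM := mesh_ok hG ht; split=> [k|j i].
  case: (hM) => _ _ _ /(_ k) [j [i /= <-]] _.
  have := gd t j _ (time_cc ht) (cell_verts hM j i).
  by apply: (td_ext ht) => s hs; rewrite trajectory_vertex.
have md x : open_cell (M t) (vset (M t) j) x -> material_deriv G chi t j x = g (t, x).
  move=> xj; have PF := time_proper ht; apply: norm_cvg_lim.
  by apply: gd; [exact: time_cc|exact: open_cell_sub].
apply: (cvg_eq_within md).
have /subspace_continuousP gc' := gc.
have stv : spacetime G (t, verts (M t) j i).
  by split; [exact: time_cc|exists j; exact: cell_verts].
have := gc' _ stv => h A /h.
rewrite /= /within /= => -[[A1 A2] /= [h1 h2] hA].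
rewrite nbhs_simpl /= /within /=.
apply: filterS h2 => x x2 xj; apply: (hA (t, x)).
  by split => //=; exact: nbhs_singleton.
by split; [exact: time_cc|exists j; exact: open_cell_sub].
Qed.

End MaterialDerivative.

(** * Conservation of the area and dissipation of the energy *)

Section PlaneAlgebra.
Context {R : realType} {n : nat} (E : 'M[R]_(n.+2, n.+1)).
Hypothesis rkE : \rank E = n.+1.

Lemma pinv_projT : (E *m pinv E)^T = E *m pinv E.
Proof. by rewrite -proj_pinv // raddfB /= trmx1 trmx_mul trmxK. Qed.

Lemma frob_id_grad (F : 'M[R]_(n.+2, n.+1)) :
  frob (E *m pinv E) (F *m pinv E) = \tr (F *m pinv E).
Proof. by rewrite /frob pinv_projT mxtrace_mulC -(mulmxA F) (mulmxA (pinv E) E) pinvK // mul1mx. Qed.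

End PlaneAlgebra.

Arguments Vh_cvg {R n J K M} hM {f} j i fV.
Arguments td_div {R n T t} ht {E E'} rkE dE F.
Arguments tdm_normal {R n T t} ht {E E'} rkE dE.
Arguments tdm_edge {R n J K G} hG t j ht.

Section EnergyLaws.
Context {R : realType} {n J K : nat}.
Variable G : evolution R n J K.
Hypothesis hd : n.+2 \in [:: 2; 3]%N.
Hypothesis hG : evolving_polyhedral_surface G.
Local Notation vec := 'cV[R]_n.+2.
Local Notation T := (final_time G).
Local Notation M := (at_time G).
Variables (alpha : R) (mu : vec -> vec) (kap : R -> vec -> R) (k : R -> vec -> vec)
  (lam : R -> vec -> R) (p : R -> vec -> vec) (lamA lamV : R -> R).
Hypothesis hkap : VT G kap.
Hypothesis hk : forall i, VT G (fun t x => k t x i 0).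
Hypothesis hsys : forall t : R, 0 < t <= T ->
  helfrich_system G alpha mu t (kap t) (k t) (lam t) (p t) (lamA t) (lamV t).
Hypothesis htr : forall t : R, 0 < t <= T -> discrete_transport G kap t.

Lemma still_boundary s : 0 < s <= T -> vectorial (Vh0 (M s)) (velocity G s).
Proof. by move=> /hsys [[]]. Qed.

Variable t : R.
Hypothesis ht : 0 < t <= T.
Local Notation hM := (mesh_ok hG ht).
Local Notation E j := (edge_mx (verts (M t) j)).
Local Notation E' j := (edge_mx (fun i => nodal_velocity G t (conn G j i))).
Local Notation W j := (E' j *m pinv (E j)).
Local Notation nu j := (unormal (E j)).
Local Notation Pt j := (1%:M - nu j *m (nu j)^T).
Local Notation ea j := (elt_area (M t) j).
Local Notation ocell j := (open_cell (M t) (vset (M t) j)).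
Local Notation td f l := (is_tderiv (V := R^o) T f t l).

Let rkE j : \rank (E j) = n.+1. Proof. exact: (edge_rank hM). Qed.

Lemma Vh0_Vh f : vectorial (Vh0 (M t)) f -> vectorial (Vh (M t)) f.
Proof. by move=> h i; case: (h i). Qed.

Lemma velocity_grad j x : ocell j x -> sgradv (M t) (velocity G t) j x = W j.
Proof.
move=> xj; rewrite (Vh_sgradv hM (Vh0_Vh (still_boundary ht)) xj).
congr (edge_mx _ *m _); apply/funext => i.
exact: velocity_vtx.
Qed.

Lemma td_elt_area j : td (fun s => elt_area (M s) j) (ea j * \tr (W j)).
Proof.
have rk s : 0 < s <= T -> \rank (edge_mx (verts (M s) j)) = n.+1.
  by move=> hs; exact: (edge_rank (mesh_ok hG hs)).
have := td_area ht rk (tdm_edge hG t j ht).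
move=> /(tdZ ht (c := n.+1`!%:R^-1)).
rewrite mulrA (mulrC _ (enorm _)) -[in X in X -> _](elt_areaE hd hM).
by apply: (td_ext ht) => s hs; rewrite (elt_areaE hd (mesh_ok hG hs)) mulrC.
Qed.

Lemma ip_id_grad s f : 0 < s <= T -> vectorial (Vh (M s)) f ->
  ip (M s) frob (sgradv (M s) id) (sgradv (M s) f)
  = \sum_j elt_area (M s) j *
      \tr (edge_mx (fun i => f (verts (M s) j i)) *m pinv (edge_mx (verts (M s) j))).
Proof.
move=> hs fV; apply: (ip_cst hd (mesh_ok hG hs)) => j x xj.
rewrite (sgradv_id (mesh_ok hG hs) xj) (Vh_sgradv (mesh_ok hG hs) fV xj).
by rewrite frob_id_grad // (edge_rank (mesh_ok hG hs)).
Qed.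

(** The velocity is a test field of the curvature equation, because it
    vanishes on the boundary; there the lumped term is zero by the area
    constraint, and the remaining term is the derivative of the area. *)
Lemma area_conserved : td (fun s => area (M s)) 0.
Proof.
suff <- : \sum_j ea j * \tr (W j) = 0.
  by apply: td_sum => // j _; exact: td_elt_area.
have [_ _ S2 _ [_ S6]] := hsys ht.
have wV := still_boundary ht.
have wB : vectorial (Vbd1 G t) (velocity G t).
  move=> i; have [wVi w0] := wV i; split=> // x x1; apply: w0.
  by case: hG => _ _ /(_ t (time_cc ht)) -> _; left.
have := S2 _ wB; rewrite -S6 (boundary_ip_zero hG _ ht wV) add0r subr0.
rewrite (ip_id_grad ht (Vh0_Vh wV)) => /esym e; rewrite -[RHS]e.
apply: eq_bigr => j _; congr (_ * \tr (edge_mx _ *m _)); apply/funext => i.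
exact/esym/velocity_vtx.
Qed.

(** The evolution equation tested with w. The terms with lamA and lamV are
    zero by the area and volume constraints. The terms with p add up to the
    tangential equation tested with p, up to its term with lam, which is zero
    by the constraint on the normal component of p. *)
Lemma dissipation :
  0 = iph (M t) *%R (fun j x => dot (velocity G t x) (normal (M t) j))
                    (fun j x => dot (velocity G t x) (normal (M t) j))
      + Bh (M t) (k t) (kap t) (velocity G t).
Proof.
have [[wV _ lV pV] S1 _ [S3 S4] [S5 S6]] := hsys ht.
have e := S4 _ pV; rewrite -(S3 _ lV) addr0 in e.
by have := S1 _ wV; rewrite -S5 -S6 !mulr0 !addr0 -addrA -e addr0.
Qed.

Lemma k_Vh s : 0 < s <= T -> vectorial (Vh (M s)) (k s).
Proof. by move=> hs i; case: (hk i) => _ /(_ s (time_cc hs)). Qed.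

Lemma kap_Vh s : 0 < s <= T -> Vh (M s) (kap s).
Proof. by move=> hs; case: hkap => _ /(_ s (time_cc hs)). Qed.

Local Notation kn j i := (k t (verts (M t) j i)).
Local Notation kapn j i := (kap t (verts (M t) j i)).
Local Notation F j := (edge_mx (fun i => kn j i)).
Local Notation gK j := (F j *m pinv (E j)).
Local Notation wh := (velocity G t).

Lemma nodal_k_derivative : exists dk : 'I_K -> vec,
  forall l, tdm T t (fun s => k s (pos G s l)) (dk l).
Proof.
have h i : exists g : 'I_K -> R, forall l, td (fun s => k s (pos G s l) i 0) (g l).
  by have [g /(_ t ht) [hg _]] := VT_nodal hG (hk i); exists (g t).
exists (fun l => \col_i projT1 (cid (h i)) l) => l i b.
by rewrite (ord1 b) mxE; exact: (projT2 (cid (h i)) l).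
Qed.

(** The transport equation says that the nodal function with values the
    material derivatives of kap solves the linear system that defines C_h(kap;
    w), which has one solution only. *)
Lemma transported_kap : exists dkap : 'I_K -> R,
  [/\ forall l, td (fun s => kap s (pos G s l)) (dkap l),
      Vh (M t) (Ch (M t) (kap t) wh)
    & forall l, Ch (M t) (kap t) wh (vtx (M t) l) = dkap l].
Proof.
have [g /(_ t ht) [gd gm]] := VT_nodal hG hkap; exists (g t).
pose c := interp (M t) (g t).
have cV : Vh (M t) c by exact: (interp_Vh hM).
have cE l : c (vtx (M t) l) = g t l by rewrite /c (interp_vtx hM).
have ct phi : Vh (M t) phi -> iph (M t) *%R (fun=> c) (fun=> phi) =
    iph (M t) *%R (fun j x => dot (wh x) (sgrad (M t) (kap t) j x)) (fun=> phi).
  move=> phiV; have /eqP := htr ht phiV; rewrite eq_sym subr_eq0 => /eqP <-.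
  rewrite (iph_cvg hM (c := fun j i => g t (conn G j i) * phi (verts (M t) j i))).
    apply/esym; apply: (iph_cvg hM) => j i; apply: cvgM; first exact: gm.
    exact: (Vh_cvg hM j i phiV).
  move=> j i; rewrite -cE; apply: cvgM; first exact: (Vh_cvg hM j i cV).
  exact: (Vh_cvg hM j i phiV).
have [CV Ct] : Vh (M t) (Ch (M t) (kap t) wh) /\ forall phi, Vh (M t) phi ->
    iph (M t) *%R (fun=> Ch (M t) (kap t) wh) (fun=> phi) =
    iph (M t) *%R (fun j x => dot (wh x) (sgrad (M t) (kap t) j x)) (fun=> phi).
  rewrite /Ch; case: xgetP => [f -> //|/(_ c)] []; by split.
split=> // l; rewrite -cE; apply: (Vh_uniq hd hM _ CV cV) => phi phiV.
by rewrite Ct ?ct.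
Qed.

Lemma sum_cst_nodes (c : 'I_J -> R) :
  n.+2%:R^-1 * \sum_j ea j * \sum_(i < n.+2) c j = \sum_j ea j * c j.
Proof.
rewrite mulr_sumr; apply: eq_bigr => j _; rewrite sumr_const card_ord -[c j *+ _]mulr_natl.
by rewrite [LHS]mulrCA mulKf // pnatr_eq0.
Qed.

Lemma cvg_k j i l : k t x l 0 @[x --> within (ocell j) (nbhs (verts (M t) j i))] --> kn j i l 0.
Proof. exact: (Vh_cvg hM j i (k_Vh ht l)). Qed.

Lemma cvg_kap j i :
  kap t x @[x --> within (ocell j) (nbhs (verts (M t) j i))] --> kapn j i.
Proof. exact: (Vh_cvg hM j i (kap_Vh ht)). Qed.

(** The fields in the form are affine or constant on each simplex: the exact
    integrals become element sums, the lumped ones vertex sums. *)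
Lemma Bh_nodal (dkap : 'I_K -> R) : Vh (M t) (Ch (M t) (kap t) wh) ->
  (forall l, Ch (M t) (kap t) wh (vtx (M t) l) = dkap l) ->
  Bh (M t) (k t) (kap t) wh
  = - (\sum_j ea j * frob (gK j) (W j)) - \sum_j ea j * (\tr (gK j) * \tr (W j))
    + \sum_j ea j * frob (gK j)^T ((W j + (W j)^T) *m (E j *m pinv (E j))^T)
    - n.+2%:R^-1 * (\sum_j ea j * \sum_i
        (2^-1 * dot (kn j i) (kn j i) + kapn j i * dot (nu j) (kn j i)) * \tr (W j))
    + n.+2%:R^-1 * (\sum_j ea j * \sum_i
        dot (kapn j i *: ((W j)^T *m nu j)) (kn j i))
    - n.+2%:R^-1 * (\sum_j ea j * \sum_i
        dot (dkap (conn G j i) *: nu j) (kn j i)).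
Proof.
move=> CV CE; have kV := k_Vh ht; have gk j x := Vh_sgradv hM kV (x := x) (j := j).
have gw := velocity_grad; have gi j x := sgradv_id hM (x := x) (j := j).
congr (_ - _ + _ - _ + _ - _).
- by congr (- _); apply: (ip_cst hd hM) => j x xj; rewrite gk ?gw.
- by apply: (ip_cst hd hM) => j x xj; rewrite /sdiv gk ?gw.
- rewrite -sum_cst_nodes; apply: (iph_cvg hM) => j i.
  apply: (cvg_eq_within (g := fun=> frob (gK j)^T ((W j + (W j)^T) *m (E j *m pinv (E j))^T))).
    by move=> x xj; rewrite /symgrad gk ?gw ?gi.
  exact: cvg_cst.
- apply: (iph_cvg hM) => j i.
  apply: (cvg_eq_within (g := fun x => (2^-1 * dot (k t x) (k t x) +
      kap t x * dot (nu j) (k t x)) * \tr (W j))).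
    by move=> x xj; rewrite gi ?gw ?frob_id_grad.
  apply: cvgM; last exact: cvg_cst.
  apply: cvgD; apply: cvgM; [exact: cvg_cst| |exact: cvg_kap|].
    by apply: cvg_dot => l; exact: cvg_k.
  by apply: cvg_dot => l; [exact: cvg_cst|exact: cvg_k].
- apply: (iph_cvg hM) => j i.
  apply: (cvg_eq_within (g := fun x => dot (kap t x *: ((W j)^T *m nu j)) (k t x))).
    by move=> x xj; rewrite gw.
  apply: cvg_dot => l; last exact: cvg_k.
  rewrite [X in _ --> X]mxE; under eq_fun do rewrite mxE.
  by apply: cvgM; [exact: cvg_kap|exact: cvg_cst].
- apply: (iph_cvg hM) => j i.
  apply: cvg_dot => l; last exact: cvg_k.
  rewrite [X in _ --> X]mxE -CE; under eq_fun do rewrite mxE.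
  by apply: cvgM; [exact: (Vh_cvg hM j i CV)|exact: cvg_cst].
Qed.

Lemma scaled_sum (S : 'I_J -> R) :
  n.+2%:R^-1 * (\sum_j ea j * S j) = \sum_j ea j * (n.+2%:R^-1 * S j).
Proof. by rewrite mulr_sumr; apply: eq_bigr => j _; rewrite [LHS]mulrCA. Qed.

Lemma td_dot d (f g : R -> 'cV[R]_d) f' g' : tdm T t f f' -> tdm T t g g' ->
  td (fun s => dot (f s) (g s)) (dot f' (g t) + dot (f t) g').
Proof.
move=> ff gg; rewrite !dotE -big_split /=.
apply: (td_ext ht (f := fun s => \sum_i f s i 0 * g s i 0)); first by move=> s _; rewrite dotE.
by apply: (td_sum ht) => i _; apply: (tdM ht); [exact: ff|exact: gg].
Qed.

Lemma td_dot_cst d (f : R -> 'cV[R]_d) f' c : tdm T t f f' ->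
  td (fun s => dot (f s) c) (dot f' c).
Proof. by move=> /td_dot /(_ (tdm_cst T t c)); rewrite dot0r addr0. Qed.

Lemma tdm_add m q (f g : R -> 'M[R]_(m, q)) f' g' : tdm T t f f' -> tdm T t g g' ->
  tdm T t (fun s => f s + g s) (f' + g').
Proof.
move=> ff gg a b; rewrite mxE; apply: (td_ext ht _ (tdD (ff a b) (gg a b))) => s _.
by rewrite mxE.
Qed.

(** The curvature vector of time t, carried by the mesh to the other times. It
    is an admissible test field at all times. *)
Let eta := frozen G (fun l => k t (pos G t l)).

Lemma eta_Vbd1 s : 0 < s <= T -> vectorial (Vbd1 G s) (eta s).
Proof.
move=> hs; apply: (frozen_Vbd1 hG still_boundary hs ht) => i.
split; first exact: frozen_Vh.
move=> x x1; have [[_ kB _ _] _ _ _ _] := hsys ht.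
have [_ k0] := kB i; rewrite -[RHS](k0 x x1) mxE; apply/esym.
apply: (Vh_interp hM (k_Vh ht i)); apply: boundary_surface => //.
by case: hG => _ _ /(_ t (time_cc ht)) -> _; left.
Qed.

Lemma eta_vertex s j i : 0 < s <= T -> eta s (verts (M s) j i) = kn j i.
Proof. by move=> hs; rewrite /eta /verts frozen_vtx. Qed.

(** The curvature equation at time s tested with [eta]. The point is that the
    right-hand side does not depend on s. *)
Lemma first_variation_nodal s : 0 < s <= T ->
  n.+2%:R^-1 * (\sum_j elt_area (M s) j * \sum_i
    dot (k s (verts (M s) j i) + kap s (verts (M s) j i) *: normal (M s) j) (kn j i))
  + \sum_j elt_area (M s) j * \tr (F j *m pinv (edge_mx (verts (M s) j)))
  = boundary_ip (M t) (bd2 G) mu (eta t).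
Proof.
move=> hs; have hMs := mesh_ok hG hs; have [_ _ S2 _ _] := hsys hs.
have := S2 _ (eta_Vbd1 hs); rewrite (boundary_ip_frozen hG still_boundary _ _ hs ht).
move=> /eqP; rewrite eq_sym subr_eq0 => /eqP <-.
congr (_ + _).
  apply/esym/(iph_cvg hMs) => j i.
  rewrite -(eta_vertex j i hs); apply: cvg_dot => l; last first.
    by apply: (Vh_cvg hMs j i); exact: (frozen_Vh hG).
  rewrite [X in _ --> X]mxE [X in _ --> _ + X]mxE.
  under eq_fun do rewrite mxE [X in _ + X]mxE.
  apply: cvgD; first exact: (Vh_cvg hMs j i (k_Vh hs l)).
  by apply: cvgM; [exact: (Vh_cvg hMs j i (kap_Vh hs))|exact: cvg_cst].
rewrite (ip_id_grad hs); last exact: (frozen_Vh hG).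
apply: eq_bigr => j _; congr (_ * \tr (edge_mx _ *m _)); apply/funext => i.
exact/esym/eta_vertex.
Qed.

Section Derivatives.
Variables (dk : 'I_K -> vec) (dkap : 'I_K -> R).
Hypothesis hdk : forall l, tdm T t (fun s => k s (pos G s l)) (dk l).
Hypothesis hdkap : forall l, td (fun s => kap s (pos G s l)) (dkap l).

Lemma quot_mul (a b c : R) : a / b * c = b^-1 * (a * c).
Proof. by rewrite mulrA (mulrC a). Qed.

Lemma td_div_elt j : td (fun s => elt_area (M s) j * \tr (F j *m pinv (edge_mx (verts (M s) j))))
  (ea j * (\tr (W j) * \tr (gK j) + \tr (gK j *m (W j)^T)
           - \tr (gK j *m (W j)^T *m Pt j) - \tr (gK j *m W j))).
Proof.
have rk s : 0 < s <= T -> \rank (edge_mx (verts (M s) j)) = n.+1.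
  by move=> hs; exact: (edge_rank (mesh_ok hG hs)).
rewrite (elt_areaE hd hM) quot_mul.
apply: (td_ext ht _ (tdZ ht (td_div ht rk (tdm_edge hG t j ht) (F j)))) => s hs.
by rewrite (elt_areaE hd (mesh_ok hG hs)) quot_mul.
Qed.

Lemma tdm_unit_normal j : tdm T t (fun s => normal (M s) j) (- ((W j)^T *m nu j)).
Proof.
have rk s : 0 < s <= T -> \rank (edge_mx (verts (M s) j)) = n.+1.
  by move=> hs; exact: (edge_rank (mesh_ok hG hs)).
exact: (tdm_normal ht rk (tdm_edge hG t j ht)).
Qed.

Lemma first_variation_derivative :
  \sum_j ea j * (n.+2%:R^-1 * (\tr (W j) * \sum_i dot (kn j i + kapn j i *: nu j) (kn j i)
     + \sum_i dot (dk (conn G j i) + (dkap (conn G j i) *: nu j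
                    + kapn j i *: - ((W j)^T *m nu j))) (kn j i))
   + (\tr (W j) * \tr (gK j) + \tr (gK j *m (W j)^T)
           - \tr (gK j *m (W j)^T *m Pt j) - \tr (gK j *m W j))) = 0.
Proof.
have h0 := td_cst T t (boundary_ip (M t) (bd2 G) mu (eta t)).
have h1 := td_ext ht (fun s hs => esym (first_variation_nodal hs)) h0.
have h2 : td (fun s => n.+2%:R^-1 * (\sum_j elt_area (M s) j * \sum_i
    dot (k s (verts (M s) j i) + kap s (verts (M s) j i) *: normal (M s) j) (kn j i))
  + \sum_j elt_area (M s) j * \tr (F j *m pinv (edge_mx (verts (M s) j))))
  (n.+2%:R^-1 * (\sum_j ((ea j * \tr (W j)) * (\sum_i dot (kn j i + kapn j i *: nu j) (kn j i))
     + ea j * \sum_i dot (dk (conn G j i) + (dkap (conn G j i) *: nu j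
                    + kapn j i *: - ((W j)^T *m nu j))) (kn j i)))
   + \sum_j ea j * (\tr (W j) * \tr (gK j) + \tr (gK j *m (W j)^T)
           - \tr (gK j *m (W j)^T *m Pt j) - \tr (gK j *m W j))).
  apply: tdD; last by apply: (td_sum ht) => j _; exact: td_div_elt.
  apply: (tdZ ht); apply: (td_sum ht) => j _; apply: (tdM ht); first exact: td_elt_area.
  apply: (td_sum ht) => i _; apply: td_dot_cst.
  apply: tdm_add; first exact: hdk.
  by apply: (tdmZ ht); [exact: hdkap|exact: tdm_unit_normal].
rewrite -[RHS](td_unique ht h2 h1) mulr_sumr -big_split /=; apply: eq_bigr => j _.
set A := ea j; ring.
Qed.

Lemma td_energy : td (fun s => bending_energy (M s) (k s))
  (\sum_j ea j * (n.+2%:R^-1 * (2^-1 * (\tr (W j) * \sum_i dot (kn j i) (kn j i))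
     + \sum_i dot (dk (conn G j i)) (kn j i)))).
Proof.
apply: (td_ext ht (f := fun s => 2^-1 * (n.+2%:R^-1 * \sum_j elt_area (M s) j *
    \sum_i dot (k s (verts (M s) j i)) (k s (verts (M s) j i))))) => [s hs|].
  have hMs := mesh_ok hG hs; congr (_ * _); apply/esym/(iph_cvg hMs) => j i.
  rewrite -[X in _ --> X]mulr1; apply: cvgM; last exact: cvg_cst.
  by apply: cvg_dot => l; exact: (Vh_cvg hMs j i (k_Vh hs l)).
have h : td (fun s => 2^-1 * (n.+2%:R^-1 * \sum_j elt_area (M s) j *
    \sum_i dot (k s (verts (M s) j i)) (k s (verts (M s) j i))))
  (2^-1 * (n.+2%:R^-1 * \sum_j ((ea j * \tr (W j)) * (\sum_i dot (kn j i) (kn j i)) +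
    ea j * \sum_i (dot (dk (conn G j i)) (kn j i) + dot (kn j i) (dk (conn G j i)))))).
  do 2 apply: (tdZ ht); apply: (td_sum ht) => j _; apply: (tdM ht); first exact: td_elt_area.
  by apply: (td_sum ht) => i _; apply: td_dot; exact: hdk.
rewrite (_ : \sum_j _ = 2^-1 * (n.+2%:R^-1 * \sum_j ((ea j * \tr (W j)) *
    (\sum_i dot (kn j i) (kn j i)) +
    ea j * \sum_i (dot (dk (conn G j i)) (kn j i) + dot (kn j i) (dk (conn G j i)))))); first exact: h.
rewrite !mulr_sumr; apply: eq_bigr => j _.
have -> : \sum_i (dot (dk (conn G j i)) (kn j i) + dot (kn j i) (dk (conn G j i)))
    = 2 * \sum_i dot (dk (conn G j i)) (kn j i).
  rewrite mulr_sumr; apply: eq_bigr => i _; rewrite (dotC (kn j i)); ring.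
set A := ea j; set B := \sum_i dot (dk _) _.
by set d := n.+2%:R^-1; field.
Qed.

(** The derivative of the energy contains the products of the derivative of k
    with k, which [first_variation_derivative] eliminates. Element by element
    what is left is the form B_h: the surface gradients of k contribute its
    first three terms, the derivative of the area the fourth, and those of the
    normal and of kap the last two. *)
Lemma energy_rate : Vh (M t) (Ch (M t) (kap t) wh) ->
  (forall l, Ch (M t) (kap t) wh (vtx (M t) l) = dkap l) ->
  \sum_j ea j * (n.+2%:R^-1 * (2^-1 * (\tr (W j) * \sum_i dot (kn j i) (kn j i))
     + \sum_i dot (dk (conn G j i)) (kn j i))) = Bh (M t) (k t) (kap t) wh.
Proof.
move=> CV CE; rewrite (Bh_nodal CV CE) !scaled_sum; apply/eqP; rewrite -subr_eq0.
rewrite -[X in _ == X]first_variation_derivative; apply/eqP.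
rewrite -!sumrN -!big_split /= -!sumrN -!big_split /=.
apply: eq_bigr => j _.
have Wp : W j *m (E j *m pinv (E j)) = W j.
  by rewrite -(mulmxA (E' j)) (mulmxA (pinv (E j)) (E j)) pinvK // mul1mx.
have f1 : frob (gK j) (W j) = \tr (gK j *m (W j)^T).
  by rewrite /frob -mxtrace_tr trmx_mul trmxK mxtrace_mulC.
have f2 : frob (gK j)^T ((W j + (W j)^T) *m (E j *m pinv (E j))^T)
    = \tr (gK j *m W j) + \tr (gK j *m (W j)^T *m Pt j).
  rewrite /frob trmxK pinv_projT // mulmxDl Wp mulmxDr raddfD /=.
  by congr (_ + \tr _); rewrite -(proj_pinv (rkE j)) (mulmxA (gK j)).
rewrite f1 f2.
have -> : \sum_i dot (kn j i + kapn j i *: nu j) (kn j i)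
    = \sum_i dot (kn j i) (kn j i) + \sum_i kapn j i * dot (nu j) (kn j i).
  by rewrite -big_split; apply: eq_bigr => i _; rewrite dotDl dotZl.
have -> : \sum_i dot (dk (conn G j i) + (dkap (conn G j i) *: nu j
                    + kapn j i *: - ((W j)^T *m nu j))) (kn j i)
   = \sum_i dot (dk (conn G j i)) (kn j i) + \sum_i dot (dkap (conn G j i) *: nu j) (kn j i)
     - \sum_i dot (kapn j i *: ((W j)^T *m nu j)) (kn j i).
  rewrite -sumrN -!big_split; apply: eq_bigr => i _ /=.
  by rewrite !dotDl scalerN dotNl addrA.
have -> : \sum_i (2^-1 * dot (kn j i) (kn j i) + kapn j i * dot (nu j) (kn j i)) * \tr (W j)
   = (2^-1 * \sum_i dot (kn j i) (kn j i) + \sum_i kapn j i * dot (nu j) (kn j i)) * \tr (W j).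
  by rewrite -mulr_suml big_split /= -mulr_sumr.
set A := ea j; set B := \sum_i dot (kn j i) (kn j i); set C := \sum_i kapn j i * _.
set D1 := \sum_i dot (dk _) _; set D2 := \sum_i dot (dkap _ *: _) _.
set D3 := \sum_i dot (kapn _ _ *: _) _; set X := \tr (W j).
by set d := n.+2%:R^-1; field.
Qed.

End Derivatives.

Lemma energy_law : exists2 dE : R,
  td (fun s => bending_energy (M s) (k s)) dE
  & dE + iph (M t) *%R (fun j x => dot (wh x) (normal (M t) j))
                       (fun j x => dot (wh x) (normal (M t) j)) = 0.
Proof.
have [dk hdk] := nodal_k_derivative; have [dkap [hdkap CV CE]] := transported_kap.
exists (Bh (M t) (k t) (kap t) wh); last by rewrite addrC -dissipation.
by rewrite -(energy_rate hdk hdkap CV CE); exact: td_energy.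
Qed.

End EnergyLaws.

(** * Integrals of functions with jumps *)

Section JumpIntegral.
Context {R : realType}.

Lemma locally_constant (v : R -> R) :
  (forall z, \forall y \near z, v y = v z) -> forall x y, v x = v y.
Proof.
move=> lv x y; apply: is_derive_0_is_cst => z.
have h : h^-1 *: ((v \o shift z) (h *: (1 : R)) - v z) @[h --> (0 : R)^'] --> (0 : R).
  apply: cvg_near_cst.
  have : \forall h \near (0 : R)^', v (h + z) = v z.
    apply: nbhs_dnbhs; have : h + z @[h --> (0 : R)] --> 0 + z.
      by apply: cvgD; [exact: cvg_id|exact: cvg_cst].
    by rewrite add0r => /(_ _ (lv z)).
  by apply: filterS => h /= vz; rewrite /GRing.scale /= mulr1 vz subrr mulr0.
split; first by apply/cvg_ex; exists 0.
exact: (cvg_lim (@Rhausdorff R)).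
Qed.

Definition below (a z : R) : R := (z < a)%R%:R.

Lemma below_left a z : \forall h \near 0^'+, below a (z - h) = (z <= a)%R%:R.
Proof.
case: (leP z a) => za.
  by near=> h; rewrite /below ltrBlDr ltr_pwDr.
have az : 0 < z - a by rewrite subr_gt0.
near=> h; rewrite /below ltNge (_ : a <= z - h) //.
by rewrite lerBrDr -lerBrDl; near: h; exact: nbhs_right_le.
Unshelve. all: by end_near. Qed.

Lemma below_right a z : \forall h \near 0^'+, below a (z + h) = (z < a)%R%:R.
Proof.
case: (ltP z a) => za.
  have az : 0 < a - z by rewrite subr_gt0.
  by near=> h; rewrite /below (_ : z + h < a) // -ltrBrDl; near: h; exact: nbhs_right_lt.
near=> h; rewrite /below ltNge (_ : a <= z + h) //.
by rewrite (le_trans za) // lerDl.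
Unshelve. all: by end_near. Qed.

(** f is constant on either side of z, near z, and drops by d across z. The
    proposition smooth is meant to say that there is no jump at z; only then
    is the value at the point z itself prescribed. *)
Definition jump_at (f : R -> R) (z d : R) (smooth : Prop) :=
  exists l r, [/\ \forall h \near 0^'+, f (z - h) = l,
    \forall h \near 0^'+, f (z + h) = r, l - r = d & smooth -> f z = l].

Lemma jump_atB f g z d e (P Q : Prop) : jump_at f z d P -> jump_at g z e Q ->
  jump_at (fun x => f x - g x) z (d - e) (P /\ Q).
Proof.
move=> [l [r [fl fr ld fz]]] [l' [r' [gl gr le gz]]]; exists (l - l'), (r - r'); split.
- by move: fl gl; apply: filterS2 => h -> ->.
- by move: fr gr; apply: filterS2 => h -> ->.
- by rewrite -ld -le; ring.
- by move=> [/fz -> /gz ->].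
Qed.

Variables (I : finType) (P : pred I) (a c : I -> R) (f : R -> R) (m : R).
Hypothesis supp : forall z, m <= `|z| -> f z = 0.
Hypothesis jumps : forall z,
  jump_at f z (\sum_(i | P i && (a i == z)) c i) (forall i, P i -> a i != z).

Let g z := f z - \sum_(i | P i) c i * below (a i) z.

Lemma jump_residual z : exists v, (\forall y \near z^', g y = v) /\
  ((forall i, P i -> a i != z) -> g z = v).
Proof.
have [l [r [fl fr ld fz]]] := jumps z.
exists (r - \sum_(i | P i) c i * (z < a i)%R%:R).
have e : l - \sum_(i | P i) c i * (z <= a i)%R%:R = r - \sum_(i | P i) c i * (z < a i)%R%:R.
  have -> : l = r + \sum_(i | P i && (a i == z)) c i by rewrite -ld addrC subrK.
  rewrite -addrA; congr (_ + _); apply/eqP; rewrite subr_eq; apply/eqP.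
  rewrite big_mkcondr -sumrN -big_split /=; apply: eq_bigr => i _.
  by rewrite eq_sym; case: (ltgtP z (a i)) => _ /=; ring.
split.
  have left : \forall h \near 0^'+, g (z - h) = l - \sum_(i | P i) c i * (z <= a i)%R%:R.
    have : \forall h \near 0^'+, forall i, below (a i) (z - h) = (z <= a i)%R%:R.
      by apply: (@filter_forall _ _ _ (0 : R)^'+) => i; exact: below_left.
    move: fl; apply: filterS2 => h fl hb; rewrite /g fl; congr (_ - _).
    by apply: eq_bigr => i _; rewrite hb.
  have right : \forall h \near 0^'+, g (z + h) = r - \sum_(i | P i) c i * (z < a i)%R%:R.
    have : \forall h \near 0^'+, forall i, below (a i) (z + h) = (z < a i)%R%:R.
      by apply: (@filter_forall _ _ _ (0 : R)^'+) => i; exact: below_right.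
    move: fr; apply: filterS2 => h fr hb; rewrite /g fr; congr (_ - _).
    by apply: eq_bigr => i _; rewrite hb.
  rewrite e in left.
  move: left right => [e1 /= e10 h1] [e2 /= e20 h2].
  exists (Num.min e1 e2); first by rewrite /= lt_min e10.
  move=> y /=; rewrite /ball_ /= lt_min => /andP[y1 y2] yz.
  case: (ltgtP y z) yz => // yz _.
    have -> : y = z - (z - y) by rewrite subKr.
    by apply: h1 => /=; rewrite ?subr_gt0 // sub0r normrN.
  have -> : y = z + (y - z) by rewrite addrC subrK.
  by apply: h2 => /=; rewrite ?subr_gt0 // sub0r normrN distrC.
move=> na; rewrite /g fz // -e; congr (_ - _); apply: eq_bigr => i Pi.
by rewrite /below le_eqVlt eq_sym (negPf (na _ Pi)).
Qed.

Let V z := projT1 (cid (jump_residual z)).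

Lemma residual_constant x y : V x = V y.
Proof.
apply: locally_constant => z; rewrite /V; case: (cid (jump_residual z)) => v [vn _] /=.
have : \forall y \near z, y != z -> \forall x \near y, x != z -> g x = v.
  move: vn => [e /= e0 h]; exists e => //= u uz nuz.
  have : \forall x \near u, ball z e x by apply: open_nbhs_nbhs; split => //; exact: ball_open.
  by apply: filterS => w bw; exact: h.
apply: filterS => u; have [-> _|uz /(_ isT) h] := eqVneq u z.
  case: (cid (jump_residual z)) => v' [vn' _] /=.
  have : \forall y \near z^', v' = v by move: vn vn'; apply: filterS2 => w <- <-.
  by move/filter_ex => [].
case: (cid (jump_residual u)) => v' [vn' _] /=.
have h' : \forall x \near u^', x != z -> g x = v by exact: nbhs_dnbhs.
have uz' : \forall x \near u^', x != z.
  by apply: nbhs_dnbhs; apply: open_nbhs_nbhs; split => //; exact: open_neq.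
have : \forall y \near u^', v' = v.
  by near=> w; rewrite -(near vn' w) //; apply: (near h' w) => //; near: w.
by move/filter_ex => [].
Unshelve. all: by end_near. Qed.

Let bound := \sum_i `|a i| + `|m| + 1.

Let a_bound i : `|a i| < bound.
Proof.
rewrite /bound (bigD1 i) //= -!addrA ltrDl addrA ltr_wpDl // addr_ge0 //.
exact: sumr_ge0.
Qed.

Let m_bound : m < bound.
Proof.
rewrite /bound (le_lt_trans (ler_norm m)) // addrAC ltrDr ltr_wpDl //.
exact: sumr_ge0.
Qed.

Let away z : bound <= `|z| -> f z = 0 /\ forall i, a i != z.
Proof.
move=> bz; split; first by apply: supp; rewrite (le_trans (ltW m_bound)).
by move=> i; apply: contraTneq bz => <-; rewrite -ltNge.
Qed.

Let bound0 : 0 < bound.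
Proof. by rewrite /bound ltr_wpDl // addr_ge0 // sumr_ge0. Qed.

Let V0 z : V z = 0.
Proof.
rewrite (residual_constant z bound) /V.
case: (cid (jump_residual bound)) => v [_] /= <-.
  rewrite /g (away _).1 ?ger0_norm ?(ltW bound0) // sub0r big1 ?oppr0 // => i _.
  by rewrite /below ltNge (le_trans (ler_norm _) (ltW (a_bound i))) mulr0.
by move=> i _; apply: (away _).2; rewrite ger0_norm // ltW.
Qed.

Let f_below z : (forall i, P i -> a i != z) -> f z = \sum_(i | P i) c i * below (a i) z.
Proof.
move=> na; apply/eqP; rewrite -subr_eq0; apply/eqP; rewrite -[LHS]/(g z) -(V0 z) /V.
by case: (cid (jump_residual z)) => v [_ ] /=; apply.
Qed.

Let sum_jumps : \sum_(i | P i) c i = 0.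
Proof.
have nb : bound <= `|- bound| by rewrite normrN ger0_norm // ltW.
transitivity (f (- bound)); last exact: (away nb).1.
rewrite (f_below (z := - bound)); last by move=> i _; exact: (away nb).2.
apply: eq_bigr => i _; rewrite /below ltrNl.
by rewrite (le_lt_trans (ler_norm _)) ?mulr1 // normrN.
Qed.

(** The difference of f and the combination of half-line indicators with the
    same jumps is locally constant up to finitely many points, hence constant,
    and zero far to the right. Far to the left this says that the jumps add up
    to zero, so the half-lines may be cut at a common point without changing
    the sum of the [c i * a i]. *)
Lemma jump_integral : has_int f (\sum_(i | P i) c i * a i).
Proof.
pose F z := \sum_(i | P i) c i * (\1_`]- bound, a i[ z * 1).
have bi i : - bound <= a i.
  by rewrite lerNl (le_trans (ler_norm _)) // normrN ltW.
have hF : has_int F (\sum_(i | P i) c i * ((a i - - bound) * 1)).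
  apply: has_int_sum => i _; apply: has_intZ; exact: has_int_itv_cst.
have -> : \sum_(i | P i) c i * a i = \sum_(i | P i) c i * ((a i - - bound) * 1).
  rewrite [RHS](eq_bigr (fun i => c i * a i + c i * bound)).
    by rewrite big_split /= -mulr_suml sum_jumps mul0r addr0.
  by move=> i _; rewrite opprK mulr1 mulrDr.
apply: (has_int_except (s := map a (enum I)) hF) => z za.
have na i : a i != z.
  by apply: contraNneq za => <-; apply: map_f; rewrite mem_enum.
rewrite f_below // /F; have [zb|bz] := leP z (- bound).
  have nz : bound <= `|z| by rewrite -normrN (le_trans _ (ler_norm _)) // lerNr.
  rewrite -f_below // (away nz).1 big1 // => i _.
  by rewrite indicE memNset ?mul0r ?mulr0 //= in_itv /= ltNge zb.
apply: eq_bigr => i _; rewrite mulr1 indicE; congr (_ * (nat_of_bool _)%:R).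
by apply/idP/idP; rewrite inE /= in_itv /= bz.
Qed.

End JumpIntegral.

(** * Vertical lines through the enclosed region *)

Section Sides.
Context {R : realType} {n J K : nat} (M : mesh R n J K).
Local Notation vec := 'cV[R]_n.+2.
Hypothesis hM : polyhedral_surface M.
Variables (cap Om : set vec).
Hypothesis oOm : open Om.
Hypothesis frontier : closure Om `\` Om = surface M `|` cap.
Hypothesis ccap : closed cap.
Hypothesis cap_surface : cap `&` surface M = boundary M.
Hypothesis outward : forall j x, open_cell M (vset M j) x ->
  \forall e \near 0^'+, Om (x - e *: normal M j) /\ ~ Om (x + e *: normal M j).
Local Notation E j := (edge_mx (verts M j)).
Local Notation cellj j := (cell M (vset M j)).
Local Notation ocell j := (open_cell M (vset M j)).
Local Notation nu j := (normal M j).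

Lemma off_frontier x : ~ surface M x -> ~ cap x -> closure Om x -> Om x.
Proof.
move=> xs xc xO; apply: contrapT => nO.
have : (closure Om `\` Om) x by [].
by rewrite frontier => -[].
Qed.

(** A segment is connected. Off the frontier, the part of it inside the open
    set Om is both open and closed. *)
Lemma segment_same_side p q :
  (forall h, 0 <= h <= 1 -> ~ surface M (p + h *: (q - p)) /\ ~ cap (p + h *: (q - p))) ->
  Om p <-> Om q.
Proof.
move=> off; suff lr p' q' : (forall h, 0 <= h <= 1 ->
    ~ surface M (p' + h *: (q' - p')) /\ ~ cap (p' + h *: (q' - p'))) -> Om p' -> Om q'.
  split; first exact: lr.
  apply: lr => h /andP[h0 h1].
  have -> : q + h *: (p - q) = p + (1 - h) *: (q - p).
    by apply/matrixP => a b; rewrite !mxE; ring.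
  by apply: off; rewrite subr_ge0 h1 gerBl.
move=> {p q off} + Op; move: p' q' Op => p q Op off.
pose y h : vec := p + h *: (q - p).
have cy : continuous y.
  by move=> h; apply: cvgD; [exact: cvg_cst|apply: cvgZr_tmp; exact: cvg_id].
pose B := `[0, 1]%classic `&` (y @^-1` Om).
have BE : B = `[0, 1]%classic.
  apply: (@segment_connected R 0 1).
  - by exists 0; split; rewrite /= ?in_itv /= ?lexx ?ler01 // /y scale0r addr0.
  - exists (y @^-1` Om); last by [].
    by apply: open_comp => // h _; exact: cy.
  - exists (y @^-1` (closure Om)).
      by apply: preimage_closed; [move=> h _; exact: cy|exact: closed_closure].
    apply/seteqP; split => h [h01 hO]; split => //; first exact: subset_closure.
    have h01' : 0 <= h <= 1 by move: h01; rewrite /= in_itv.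
    by have [hs hc] := off h h01'; exact: off_frontier.
have : B 1 by rewrite BE /= in_itv /= ler01 lexx.
by case=> _; rewrite /= /y scale1r addrC subrK.
Qed.

Lemma cell_facet j x : cellj j x -> (exists a, cell M (facet M j a) x) \/ ocell j x.
Proof.
move=> xj; have [xE x0] := (cellP hM j x).1 xj.
case: (pselect (exists a, bary M j x a = 0)) => [[a xa]|na]; last first.
  right; apply/(open_cellP hM); split=> // i; rewrite lt_def x0 andbT.
  by apply/eqP => xi; apply: na; exists i.
left; exists a, (spread M j (bary M j x)).
have [w0 w1] := spread_weights hM j (sum_bary M j x); split.
- split=> // k kf; rewrite /spread big1 // => i _.
  case: eqP => [ik|]; last by rewrite mul0r.
  have [->|ia] := eqVneq i a; first by rewrite xa mulr0.
  by move: kf; rewrite -ik; case/negP; apply/imsetP; exists i.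
- by move=> k; apply: sumr_ge0 => i _; rewrite mulr_ge0 ?ler0n.
- by rewrite spread_comb ?sum_bary.
Qed.

Lemma ocell_facet j a x : ocell j x -> ~ cell M (facet M j a) x.
Proof.
move=> /(open_cellP hM) [_ x0] [b [wb _ xE]].
have := x0 a; rewrite xE (bary_weights hM _ (weights_sub (facet_sub M j a) wb)).
have [w0 _] := wb; rewrite w0 ?ltxx //.
apply/imsetP => -[i]; rewrite inE => ia /(elt_inj hM) e.
by rewrite e eqxx in ia.
Qed.

(** All the weights of x in the simplex j are positive. If x were in another
    cell, then by conformity the two simplices would have the same vertices
    and their open cells would meet. *)
Lemma ocell_other i j x : i != j -> ocell j x -> ~ cellj i x.
Proof.
move=> ij xj xi; have [b [wb wi wj b0 xE]] := cell2_weights hM xi (open_cell_sub hM xj).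
(* A vertex of j outside i would have weight zero. *)
have sub : vset M j \subset vset M i.
  apply/fintype.subsetP => k /imsetP[l _ ->].
  have [_ /(_ l)] := (open_cellP hM j x).1 xj; rewrite xE (bary_weights hM _ wj).
  case: (boolP (elt M j l \in vset M i)) => // nl.
  by have [w0 _] := wi; rewrite w0 ?ltxx.
have card l : #|vset M l| = n.+2 by rewrite card_imset ?card_ord //; exact: elt_inj.
have eqs : vset M j = vset M i by apply/eqP; rewrite eqEcard sub !card leqnn.
case: hM => _ /(_ i j ij) h _ _ _.
have : (open_cell M (vset M i) `&` open_cell M (vset M j)) x by rewrite -eqs.
by rewrite h.
Qed.

Lemma ocell_boundary j x : ocell j x -> ~ boundary M x.
Proof.
move=> xj [i [a [_ xi]]]; have [ij|ij] := eqVneq i j.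
  by rewrite ij in xi; exact: (ocell_facet xj xi).
apply: (ocell_other ij xj); case: xi => b [wb b0 ->]; exists b; split=> //.
exact: weights_sub (facet_sub M i a) wb.
Qed.

Lemma ocell_cap j x : ocell j x -> ~ cap x.
Proof.
move=> xj xc; apply: (ocell_boundary xj); rewrite -cap_surface; split=> //.
by exists j; exact: open_cell_sub.
Qed.

Lemma cell_plane j x y : cellj j x -> cellj j y -> dot (y - x) (nu j) = 0.
Proof.
move=> /(cellP hM) [xE _] /(cellP hM) [yE _].
rewrite xE yE !affine_comb ?sum_bary // opprD addrACA subrr add0r -mulmxBr.
rewrite dotC dot_mulmxr -[nu j]/(unormal (E j)) unormal_orth ?dot0l //.
Qed.

Lemma ocell_near j x : ocell j x -> \forall y \near x,
  dot (y - x) (nu j) != 0 -> ~ surface M y /\ ~ cap y.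
Proof.
move=> xj.
have capn : \forall y \near x, ~ cap y.
  exact: (open_nbhs_nbhs (conj (closed_openC ccap) (ocell_cap xj))).
have othern : \forall y \near x, forall i, i != j -> ~ cellj i y.
  apply: (@filter_forall _ _ _ (nbhs x)) => i; have [_|ij] := eqVneq i j.
    by apply: nearW => y.
  by apply: filterS (cell_away hM (ocell_other ij xj)) => y h _.
move: capn othern; apply: filterS2 => y yc yo yx; split=> // -[i yi].
have [ij|ij] := eqVneq i j; last exact: (yo i ij yi).
move: yx; rewrite -ij (cell_plane _ yi) ?eqxx // ij; exact: open_cell_sub.
Qed.

Lemma small_shift (x u : vec) (A : set vec) : (\forall y \near x, A y) ->
  exists2 e, 0 < e & forall h, `|h| < e -> A (x + h *: u).
Proof.
move=> Ax; have : x + h *: u @[h --> (0 : R)] --> x + (0 : R) *: u.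
  by apply: cvgD; [exact: cvg_cst|apply: cvgZr_tmp; exact: cvg_id].
rewrite scale0r addr0.
move=> /(_ _ Ax) [e /= e0 he]; exists e => // h hh; apply: he.
by rewrite /ball_ /= sub0r normrN.
Qed.

Lemma convex_pos (th a b : R) : 0 <= th <= 1 -> 0 < a -> 0 < b ->
  0 < (1 - th) * a + th * b.
Proof.
move=> /andP[t0 t1] a0 b0; have [->|tn] := eqVneq th 0.
  by rewrite subr0 mul1r mul0r addr0.
by rewrite ltr_wpDl ?mulr_ge0 ?subr_ge0 ?(ltW a0) // mulr_gt0 // lt_def tn.
Qed.

(** The hypothesis on the normal only concerns the direction nu itself. The
    points [x + h *: u] and [x + g *: nu j], where g has the sign of the
    normal component of u, are joined by a segment that stays close to x and
    on one side of the plane of the simplex, hence off the frontier. *)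
Lemma cross_side j x u : ocell j x -> dot u (nu j) != 0 ->
  \forall h \near 0^'+, Om (x + h *: u) <-> dot u (nu j) < 0.
Proof.
move=> xj u0; have /nbhs_ballP [e /= e0 he] := ocell_near xj.
have nn : dot (nu j) (nu j) = 1 by exact: unormal1 (edge_rank hM j).
(* Bounds for both directions, so that the steps h and g below e / (2 A)
   keep the whole segment in the ball of radius e. *)
pose A := Num.max `|u| `|nu j| + 1.
have A0 : 0 < A by rewrite /A ltr_wpDl // le_max normr_ge0.
have uA : `|u| < A by rewrite /A ltr_pwDr // le_max lexx.
have nA : `|nu j| < A by rewrite /A ltr_pwDr // le_max lexx orbT.
have key h g : 0 < h < e / (2 * A) -> 0 < `|g| < e / (2 * A) -> 0 < g * dot u (nu j) ->
    (Om (x + h *: u) <-> Om (x + g *: nu j)).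
  move=> /andP[h0 hA] /andP[g0 gA] gu; apply: segment_same_side => th /andP[t0 t1].
  have -> : x + h *: u + th *: (x + g *: nu j - (x + h *: u))
     = x + ((1 - th) * h) *: u + (th * g) *: nu j.
    by apply/matrixP => a b; rewrite !mxE; ring.
  set y := _ + _ + _.
  apply: he.
    rewrite -ball_normE /= /y -addrA opprD addrA subrr add0r normrN.
    rewrite (le_lt_trans (ler_normD _ _)) // (normrZ (_ * h)) (normrZ (_ * g)).
    have b1 : `|(1 - th) * h| * `|u| < e / 2.
      rewrite normrM (ger0_norm (ltW h0)) ger0_norm ?subr_ge0 //.
      have : (1 - th) * h * `|u| <= h * A.
        rewrite ler_pM ?(ltW uA) ?normr_ge0 // ?mulr_ge0 ?subr_ge0 ?(ltW h0) //.
        by rewrite ler_piMl ?(ltW h0) // gerBl.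
      move/le_lt_trans; apply; rewrite -ltr_pdivlMr //.
      by rewrite (lt_le_trans hA) // invfM mulrA.
    have b2 : `|th * g| * `|nu j| < e / 2.
      rewrite normrM (ger0_norm t0).
      have : th * `|g| * `|nu j| <= `|g| * A.
        rewrite ler_pM ?(ltW nA) ?normr_ge0 // ?mulr_ge0 //.
        by rewrite ler_piMl ?normr_ge0.
      move/le_lt_trans; apply; rewrite -ltr_pdivlMr //.
      by rewrite (lt_le_trans gA) // invfM mulrA.
    by have := ltrD b1 b2; rewrite -splitr.
  rewrite /y -(addrA x) [x + _]addrC addrK dotDl (dotZl (_ * h)) (dotZl (_ * g)) nn mulr1.
  move: gu; rewrite -[g * _]mulrC.
  set a := dot u (nu j) => gu.
  have [a0|a0] := ltP a 0.
    have g1 : g < 0 by rewrite -(nmulr_rgt0 _ a0).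
    rewrite -oppr_eq0; apply: lt0r_neq0.
    have -> : - ((1 - th) * h * a + th * g) = (1 - th) * (h * - a) + th * - g by ring.
    by apply: convex_pos; rewrite ?t0 ?oppr_gt0 // mulr_gt0 // oppr_gt0.
  have a1 : 0 < a by rewrite lt_def u0 a0.
  have g1 : 0 < g by rewrite -(pmulr_rgt0 _ a1).
  apply: lt0r_neq0; rewrite -(mulrA _ h).
  by apply: convex_pos; rewrite ?t0 // mulr_gt0.
have eA : 0 < e / (2 * A) by rewrite divr_gt0 // mulr_gt0.
have [c /= [c0 cA [Oc nOc]]] : exists c, [/\ 0 < c, c < e / (2 * A) &
    Om (x - c *: nu j) /\ ~ Om (x + c *: nu j)].
  have : \forall c \near (0 : R)^'+, [/\ 0 < c, c < e / (2 * A) &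
      Om (x - c *: nu j) /\ ~ Om (x + c *: nu j)].
    have o := outward xj; near=> c; split; last by near: c.
      by near: c; exact: nbhs_right_gt.
    by near: c; exact: nbhs_right_lt.
  by move/filter_ex.
near=> h.
have h0 : 0 < h < e / (2 * A).
  by apply/andP; split; near: h; [exact: nbhs_right_gt|exact: nbhs_right_lt].
have [a0|a0] := ltP (dot u (nu j)) 0.
  split=> // _; apply/(key h (- c)) => //; rewrite ?normrN ?gtr0_norm ?c0 //.
    by rewrite mulNr oppr_gt0 pmulr_rlt0.
  by rewrite scaleNr.
split=> //; rewrite (key h c) ?gtr0_norm ?c0 // mulr_gt0 // lt_def u0.
by rewrite a0.
Unshelve. all: by end_near. Qed.

End Sides.

Section VerticalLine.
Context {R : realType} {n J K : nat} (M : mesh R n J K).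
Local Notation vec := 'cV[R]_n.+2.
Local Notation E j := (edge_mx (verts M j)).
Local Notation cellj j := (cell M (vset M j)).
Local Notation ocell j := (open_cell M (vset M j)).
Local Notation nu j := (normal M j).

Definition vertical : vec := delta_mx ord_max 0.

(** Up to the factor (d-1)!, the signed area of the projection of the simplex
    along the vertical. *)
Definition wedged j : R := wedge M j ord_max 0.

(** Vertical lines that meet the surface only in the relative interiors of
    simplices and transversally. *)
Definition generic_line (x : vec) :=
  (forall j a z, ~ cell M (facet M j a) (x + z *: vertical)) /\
  (forall j z, wedged j = 0 -> ~ cellj j (x + z *: vertical)).

(** Where the vertical line through x meets the hyperplane of the j-th
    simplex. *)
Definition height (x : vec) j : R := dot (verts M j ord0 - x) (wedge M j) / wedged j.

Definition crosses (x : vec) j : bool :=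
  (wedged j != 0) && `[< cellj j (x + height x j *: vertical) >].

Definition crossing_sum (x : vec) : R :=
  \sum_(j | crosses x j) Num.sg (wedged j) * height x j.

Hypothesis hM : polyhedral_surface M.

Lemma wedge_plane j x y : cellj j x -> cellj j y -> dot (y - x) (wedge M j) = 0.
Proof.
move=> xj yj; rewrite -[wedge M j]/(cross (E j)) crossE ?edge_rank // dotZr.
by rewrite (cell_plane hM xj yj) mulr0.
Qed.

Lemma crossesP x j z : generic_line x ->
  cellj j (x + z *: vertical) <-> crosses x j /\ height x j = z.
Proof.
move=> [_ gw]; split=> [xj|[/andP[_ /asboolP xj] <-] //].
have w0 : wedged j != 0 by apply/eqP => /gw; apply; exact: xj.
have hz : height x j = z.
  apply: (mulIf w0); rewrite divfK //.
  apply/eqP; rewrite -subr_eq0; apply/eqP.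
  rewrite -[RHS](wedge_plane xj (cell_verts hM j ord0)) opprD addrA [RHS]dotBl.
  by rewrite dotZl dot_delta.
by rewrite /crosses w0 hz; split=> //; apply/asboolP.
Qed.

Variables (cap Om : set vec).
Hypothesis oOm : open Om.
Hypothesis frontier : closure Om `\` Om = surface M `|` cap.
Hypothesis ccap : closed cap.
Hypothesis cap_surface : cap `&` surface M = boundary M.
Hypothesis outward : forall j x, open_cell M (vset M j) x ->
  \forall e \near 0^'+, Om (x - e *: normal M j) /\ ~ Om (x + e *: normal M j).

Lemma off_frontier_near x : ~ surface M x -> ~ cap x -> \forall y \near x, Om y <-> Om x.
Proof.
move=> xs xc; case: (pselect (Om x)) => Ox.
  have : \forall y \near x, Om y by exact: (open_nbhs_nbhs (conj oOm Ox)).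
  by apply: filterS => y.
have ncl : ~ closure Om x by move/(off_frontier frontier xs xc).
have : \forall y \near x, ~ closure Om y.
  exact: (open_nbhs_nbhs (conj (closed_openC (@closed_closure _ Om)) ncl)).
by apply: filterS => y ny; split=> // /subset_closure.
Qed.

Lemma near_right (x u : vec) (A : set vec) : (\forall y \near x, A y) ->
  \forall h \near 0^'+, A (x + h *: u).
Proof.
move=> /(small_shift u) [e e0 he]; near=> h; apply: he.
by rewrite ger0_norm; near: h; [exact: nbhs_right_lt|exact: nbhs_right_ge].
Unshelve. all: by end_near. Qed.

Lemma line_shift (x : vec) (z h : R) :
  x + (z + h) *: vertical = x + z *: vertical + h *: vertical.
Proof. by rewrite scalerDl addrA. Qed.

(** Going up through a simplex leaves the region if the normal points upwards
    and enters it otherwise. *)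
Lemma line_jump x z : generic_line x -> ~ cap (x + z *: vertical) ->
  jump_at (fun z => \1_Om (x + z *: vertical)) z
    (\sum_(j | crosses x j && (height x j == z)) Num.sg (wedged j))
    (forall j, crosses x j -> height x j != z).
Proof.
move=> gx; set y := x + z *: vertical => yc.
case: (pselect (surface M y)) => ys; last first.
  have ind w : (Om w <-> Om y) -> \1_Om w = \1_Om y :> R.
    by move=> e; rewrite !indicE; congr (nat_of_bool _)%:R; apply/idP/idP; rewrite !inE => /e.
  have near_y := off_frontier_near ys yc.
  exists (\1_Om y), (\1_Om y); split=> //.
  - have := near_right (- vertical) near_y; apply: filterS => h hy.
    by rewrite line_shift scaleNr -scalerN; exact: ind.
  - have := near_right vertical near_y; apply: filterS => h hy.
    by rewrite line_shift; exact: ind.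
  - rewrite subrr big1 // => j /andP[cj /eqP hz]; case: ys; exists j.
    by apply/(crossesP j z gx).
case: (ys) => j yj; have [cj hj] := (crossesP j z gx).1 yj.
have oj : ocell j y.
  by have [[a ya]|//] := cell_facet hM yj; case: gx => /(_ j a z).
have w0 : wedged j != 0 by case/andP: cj.
have nuw : dot vertical (nu j) = wedged j / enorm (cross (E j)).
  by rewrite dot_delta mxE mulrC.
have c0 : 0 < enorm (cross (E j)) by rewrite enorm_cross_gt0 // edge_rank.
have nu0 : dot vertical (nu j) != 0 by rewrite nuw mulf_neq0 // invr_eq0 gt_eqF.
have nuN0 : dot (- vertical) (nu j) != 0 by rewrite dotNl oppr_eq0.
have side u (b : bool) : dot u (nu j) != 0 -> (dot u (nu j) < 0) = b ->
    \forall h \near 0^'+, \1_Om (y + h *: u) = b%:R :> R.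
  move=> u0 ub; have := cross_side hM oOm frontier ccap cap_surface outward oj u0.
  apply: filterS => h [h1 h2]; rewrite indicE; congr (nat_of_bool _)%:R.
  by rewrite -ub; apply/idP/idP; rewrite inE.
exists (0 < wedged j)%R%:R, (wedged j < 0)%R%:R; split.
- have := side (- vertical) (0 < wedged j) nuN0.
  rewrite dotNl oppr_lt0 nuw pmulr_lgt0 ?invr_gt0 // => /(_ erefl).
  by apply: filterS => h <-; rewrite line_shift scaleNr -scalerN.
- have := side vertical (wedged j < 0) nu0.
  rewrite nuw pmulr_llt0 ?invr_gt0 // => /(_ erefl).
  by apply: filterS => h <-; rewrite line_shift.
- rewrite (bigD1 j) /=; last by rewrite cj hj eqxx.
  rewrite big1 ?addr0; last first.
    move=> i /andP[/andP[ci /eqP hi] ij]; case: (ocell_other hM ij oj).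
    by apply/(crossesP i z gx).
  by move: w0; case: sgrP => //; rewrite ?subr0 ?sub0r //.
- by move=> /(_ j cj); rewrite hj eqxx.
Qed.

End VerticalLine.

Lemma coord_norm (R : realType) m p (x : 'M[R]_(m, p)) i j : `|x i j| <= `|x|.
Proof.
rewrite [leRHS]/Num.norm /= mx_normrE.
exact: (le_bigmax _ (fun ij => `|x ij.1 ij.2|) (i, j)).
Qed.

Section SliceDifference.
Context {R : realType} {n J K : nat}.
Variable G : evolution R n J K.
Hypothesis hG : evolving_polyhedral_surface G.
Local Notation vec := 'cV[R]_n.+2.
Local Notation T := (final_time G).
Local Notation M := (at_time G).
Variables (cap : set vec) (Om : R -> set vec).
Hypothesis hOm : encloses G cap Om.

Lemma cap_boundary s : 0 < s <= T -> cap `&` surface (M s) = boundary (M s).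
Proof.
move=> hs; case: hOm => _ /(_ s (time_cc hs)) -> _ _ _.
by case: hG => _ _ /(_ s (time_cc hs)) ->.
Qed.

(** Both indicators jump in the same way on the cap, so their difference jumps
    on the two surfaces only; since the regions are bounded, [jump_integral]
    applies. *)
Lemma slice_difference s t x : 0 < s <= T -> 0 < t <= T ->
  generic_line (M s) x -> generic_line (M t) x ->
  has_int (fun z => \1_(Om s) (x + z *: vertical) - \1_(Om t) (x + z *: vertical))
    (crossing_sum (M s) x - crossing_sum (M t) x).
Proof.
move=> hs ht gs gt.
case: (hOm) => [[ccap _] _ hreg hout hcap].
have [os bs fs] := hreg s (time_cc hs); have [ot bt ft] := hreg t (time_cc ht).
pose P (i : 'I_J + 'I_J) := match i with inl j => crosses (M s) x j | inr j => crosses (M t) x j end.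
pose a (i : 'I_J + 'I_J) := match i with inl j => height (M s) x j | inr j => height (M t) x j end.
pose c (i : 'I_J + 'I_J) := match i with
  inl j => Num.sg (wedged (M s) j) | inr j => - Num.sg (wedged (M t) j) end.
have -> : crossing_sum (M s) x - crossing_sum (M t) x = \sum_(i | P i) c i * a i.
  rewrite big_sumType /=; congr (_ + _); rewrite /crossing_sum -sumrN.
  by apply: eq_bigr => j _; rewrite mulNr.
have [m hm] : exists m : R, forall z, m <= `|z| ->
    ~ Om s (x + z *: vertical) /\ ~ Om t (x + z *: vertical).
  have [ms [_ hms]] := bs; have [mt [_ hmt]] := bt.
  (* Beyond this height the vertical coordinate alone exceeds the bounds of
     both regions. *)
  exists (Num.max ms mt + 1 + `|x| + 1) => z hz.
  have zn : `|z| - `|x| <= `|x + z *: vertical|.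
    apply: le_trans (coord_norm _ ord_max 0).
    rewrite (_ : (x + z *: vertical) ord_max 0 = z + x ord_max 0); last first.
      by rewrite !mxE !eqxx mulr1 addrC.
    rewrite (le_trans _ (lerB_normD _ _)) // lerD2l lerN2; exact: coord_norm.
  have big : Num.max ms mt + 1 < `|x + z *: vertical|.
    rewrite (lt_le_trans _ zn) // ltrBrDr (lt_le_trans _ hz) //.
    by rewrite ltrDl.
  split=> O.
    have : `|x + z *: vertical| <= Num.max ms mt + 1.
      by apply: (hms _ _ _ O); rewrite ltr_pwDr // le_max lexx.
    by rewrite leNgt big.
  have : `|x + z *: vertical| <= Num.max ms mt + 1.
    by apply: (hmt _ _ _ O); rewrite ltr_pwDr // le_max lexx orbT.
  by rewrite leNgt big.
apply: (@jump_integral _ _ P a c _ m).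
  by move=> z /hm [ns nt]; rewrite !indicE !memNset // subrr.
move=> z; case: (pselect (cap (x + z *: vertical))) => zc.
  have nb u : 0 < u <= T -> generic_line (M u) x -> ~ boundary (M u) (x + z *: vertical).
    by move=> hu [gu _] [j [b [_ /gu]]].
  have nbd : ~ (bd1 G `|` bd2 G) (x + z *: vertical).
    have := nb s hs gs; case: hG => _ _ /(_ s (time_cc hs)) <- _; exact.
  have nearc := hcap s t _ (time_cc hs) (time_cc ht) zc nbd.
  have ind w : (Om s w <-> Om t w) -> \1_(Om s) w - \1_(Om t) w = 0 :> R.
    move=> e; rewrite !indicE (_ : (w \in Om s) = (w \in Om t)) ?subrr //.
    by apply/idP/idP; rewrite !inE => /e.
  exists 0, 0; split.
  - have := near_right (- vertical) nearc; apply: filterS => h hy.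
    by rewrite line_shift scaleNr -scalerN; exact: ind.
  - have := near_right vertical nearc; apply: filterS => h hy.
    by rewrite line_shift; exact: ind.
  - rewrite subrr big1 // => i /andP[Pi /eqP ai]; exfalso.
    case: i Pi ai => j /= Pj hj.
      apply: (nb s hs gs); rewrite -cap_boundary //; split=> //; exists j.
      by apply/(crossesP (mesh_ok hG hs) j z gs).
    apply: (nb t ht gt); rewrite -cap_boundary //; split=> //; exists j.
    by apply/(crossesP (mesh_ok hG ht) j z gt).
  - by move=> _; apply: ind; exact: (nbhs_singleton nearc).
have js := line_jump (mesh_ok hG hs) os fs ccap (cap_boundary hs)
  (fun j y => hout s j y (time_cc hs)) gs zc.
have jt := line_jump (mesh_ok hG ht) ot ft ccap (cap_boundary ht)
  (fun j y => hout t j y (time_cc ht)) gt zc.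
have [l [r [h1 h2 h3 h4]]] := jump_atB js jt.
exists l, r; split=> //; last first.
  by move=> na; apply: h4; split=> j; [exact: (na (inl j))|exact: (na (inr j))].
rewrite h3 big_sumType /=; congr (_ + _).
by rewrite -sumrN.
Qed.

End SliceDifference.

(** * Volume by slices *)

Section Slices.
Context {R : realType}.
Local Notation mu := (@lebesgue_measure R).
Local Notation RT := (measurableTypeR R).

(** An open set is a countable union of boxes with rational centres, so
    measurability of the coordinates is enough. *)
Lemma open_preimage_measurable d (X : measurableType d) p (U : set 'cV[R]_p)
    (f : X -> 'cV[R]_p) : open U ->
  (forall i, measurable_fun setT (fun x => f x i 0 : RT)) -> measurable (f @^-1` U).
Proof.
move=> oU mf.
pose box (c : 'cV[rat]_p * nat) : set 'cV[R]_p :=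
  [set y | forall i, `|y i 0 - ratr (c.1 i 0)| < c.2.+1%:R^-1].
pose B c := if `[< box c `<=` U >] then f @^-1` (box c) else set0.
have -> : f @^-1` U = \bigcup_c B c.
  apply/seteqP; split=> [x Ux|x [c _]]; last first.
    by rewrite /B; case: asboolP => // cU; exact: cU.
  have /nbhs_ballP [e /= e0 eU] : nbhs (f x) U by exact: (open_nbhs_nbhs (conj oU Ux)).
  have [m me] : exists m : nat, (m.+1%:R^-1 : R) < e / 2.
    have e20 : 0 < e / 2 by rewrite divr_gt0.
    have [m _ hm] := near_infty_natSinv_lt (PosNum e20).
    by exists m; apply: (hm m) => /=.
  have m0 : 0 < (m.+1%:R^-1 : R) by rewrite invr_gt0 ltr0n.
  have near_rat (r : R) : exists q : rat, `|r - ratr q| < m.+1%:R^-1.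
    have : r - m.+1%:R^-1 < r + m.+1%:R^-1 by rewrite ltrD2l -subr_gt0 opprK addr_gt0.
    move=> /rat_in_itvoo [q]; rewrite in_itv /= => qr; exists q.
    by rewrite distrC ltr_distl.
  (* A box of half-width 1/(m+1) around a rational point near f x lies in
     the ball of radius e > 2/(m+1). *)
  pose c : 'cV[rat]_p := \col_i projT1 (cid (near_rat (f x i 0))).
  have fxc : box (c, m) (f x) by move=> i; rewrite mxE; exact: (projT2 (cid (near_rat (f x i 0)))).
  exists (c, m) => //; rewrite /B; case: asboolP => // -[] y yb.
  apply: eU; split=> // i j; rewrite (ord1 j) /ball /=.
  have h1 := fxc i; have h2 := yb i; rewrite /= in h1 h2.
  rewrite (le_lt_trans (ler_distD (ratr (c i 0)) _ _)) //.
  rewrite [e]splitr ltrD ?(lt_trans _ me) //.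
  by rewrite distrC.
apply: countable_bigcupT_measurable => // c; rewrite /B; case: ifP => // _.
have -> : f @^-1` box c = \bigcap_(i in [set: 'I_p])
    ((fun x => f x i 0) @^-1` [set y : RT | `|y - ratr (c.1 i 0)| < c.2.+1%:R^-1]).
  by apply/seteqP; split=> [x h i _|x h i]; [exact: h|exact: (h i)].
apply: fin_bigcap_measurable => [|i _]; first exact: finite_finset.
rewrite -[X in measurable X]setTI; apply: mf => //.
rewrite (_ : [set y | _] = `]ratr (c.1 i 0) - c.2.+1%:R^-1, ratr (c.1 i 0) + c.2.+1%:R^-1[%classic).
  exact: measurable_itv.
by apply/seteqP; split=> y /=; rewrite in_itv /= ltr_distl.
Qed.

Lemma measurable_vcons d (X : measurableType d) p (f : X -> RT) (g : X -> 'cV[R]_p) :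
  measurable_fun setT f -> (forall i, measurable_fun setT (fun x => g x i 0 : RT)) ->
  forall i, measurable_fun setT (fun x => vcons (f x) (g x) i 0 : RT).
Proof.
move=> mf mg i; case: (unliftP ord0 i) => [k ->|->].
  by under eq_fun do rewrite vconsS; exact: mg.
by under eq_fun do rewrite vcons0; exact: mf.
Qed.

Lemma measurable_nil d (X : measurableType d) i :
  measurable_fun setT (fun _ : X => (0 : 'cV[R]_0) i 0 : RT).
Proof. by case: i. Qed.

Lemma has_int_le (f g : R -> R) v w : has_int f v -> has_int g w ->
  (forall x, f x <= g x) -> v <= w.
Proof.
move=> [fi fv] [gi gw] fg; rewrite -lee_fin -fv -gw.
by apply: le_integral => // x _; rewrite lee_fin.
Qed.

Lemma has_int_bounded (f : R -> R) b m : measurable_fun setT (f : RT -> R) ->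
  (forall x, 0 <= f x <= b) -> (forall x, m < `|x| -> f x = 0) ->
  has_int f (fine (\int[mu]_x (f x)%:E)).
Proof.
move=> mf fb supp.
have b0 : 0 <= b by have /andP[h1 h2] := fb 0; exact: le_trans h1 h2.
pose r := `|m| + 1.
have r0 : 0 <= r by rewrite addr_ge0.
have [bi _] : has_int (fun x => \1_`]- r, r[ x * b) ((r - - r) * b).
  by apply: has_int_itv_cst; rewrite ge0_cp.
have fi : mu.-integrable setT (EFin \o f).
  apply: le_integrable bi => //; first exact/measurable_EFinP.
  move=> x _ /=; rewrite lee_fin !ger0_norm; last 2 first.
    by rewrite mulr_ge0.
    by case/andP: (fb x).
  rewrite indicE; case: (boolP (x \in _)) => [_|]; first by rewrite mul1r; case/andP: (fb x).
  rewrite notin_setE /= in_itv /= -ltr_norml => /negP xr.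
  rewrite supp ?mul0r //; apply: (le_lt_trans (ler_norm m)).
  by apply: (@lt_le_trans _ _ r); [rewrite /r ltrDl|rewrite leNgt].
by split=> //; rewrite fineK //; exact: integrable_fin_num.
Qed.

Lemma slice_bound (f : R -> R) b m v : has_int f v -> 0 <= b ->
  (forall x, 0 <= f x <= b) -> (forall x, m < `|x| -> f x = 0) ->
  0 <= v <= 2 * (`|m| + 1) * b.
Proof.
move=> fv b0 fb supp; apply/andP; split.
  by apply: (has_int_le (@has_int0 R) fv) => x; case/andP: (fb x).
pose r := `|m| + 1.
have r0 : 0 <= r by rewrite addr_ge0.
have bi : has_int (fun x => \1_`]- r, r[ x * b) ((r - - r) * b).
  by apply: has_int_itv_cst; rewrite ge0_cp.
have -> : 2 * (`|m| + 1) * b = (r - - r) * b by rewrite /r; ring.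
apply: (has_int_le fv bi) => x; rewrite indicE.
case: (boolP (x \in _)) => [_|]; first by rewrite mul1r; case/andP: (fb x).
rewrite notin_setE /= in_itv /= -ltr_norml => /negP xr.
rewrite supp ?mul0r //; apply: (le_lt_trans (ler_norm m)).
by apply: (@lt_le_trans _ _ r); [rewrite /r ltrDl|rewrite leNgt].
Qed.

Definition slice2 (A : set 'cV[R]_2) x : R := fine (\int[mu]_z (\1_A (vcons x (vcons z 0)))%:E).

Lemma vcons_norm p (x : R) (y : 'cV[R]_p) : `|x| <= `|vcons x y| /\ `|y| <= `|vcons x y|.
Proof.
split; first by rewrite -{1}(vcons0 x y); exact: coord_norm.
rewrite [leLHS]/Num.norm /= mx_normrE; apply/bigmax_leP; split=> // -[i j] _ /=.
by rewrite (ord1 j) -(vconsS x); exact: coord_norm.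
Qed.

Lemma indic01 T (A : set T) x : 0 <= (\1_A x : R) <= 1.
Proof. by rewrite indicE; case: (_ \in _); rewrite ?lexx ?ler01. Qed.

Lemma bounded_indic p (A : set 'cV[R]_p) : bounded_set A ->
  exists m : R, forall x, m < `|x| -> (\1_A x : R) = 0.
Proof.
move=> [m [_ hm]]; exists (m + 1) => x mx; rewrite indicE memNset // => Ax.
have : `|x| <= m + 1 by apply: (hm _ _ _ Ax); rewrite ltrDl.
by rewrite leNgt mx.
Qed.

Lemma indic_slice_measurable d (X : measurableType d) p (A : set 'cV[R]_p)
    (f : X -> 'cV[R]_p) : open A ->
  (forall i, measurable_fun setT (fun x => f x i 0 : RT)) ->
  measurable_fun setT (fun x => \1_A (f x) : R).
Proof.
move=> oA mf; have -> : (fun x => \1_A (f x) : R) = \1_(f @^-1` A) by [].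
by apply: measurable_indic; exact: open_preimage_measurable.
Qed.

(** A bounded set lies in a box, which bounds its slices and their lengths;
    the lengths are measurable functions by Tonelli's theorem. *)
Lemma slice2_int (A : set 'cV[R]_2) : open A -> bounded_set A ->
  (forall x, has_int (fun z => \1_A (vcons x (vcons z 0))) (slice2 A x)) /\
  has_int (slice2 A) (fine (leb_vol A)).
Proof.
move=> oA /bounded_indic [m hm].
have hs x : has_int (fun z => \1_A (vcons x (vcons z 0))) (slice2 A x).
  apply: (@has_int_bounded _ 1 m).
  - apply: (@indic_slice_measurable _ RT) => //.
    apply: measurable_vcons; first exact: measurable_cst.
    by apply: measurable_vcons => //; exact: measurable_nil.
  - by move=> z; exact: indic01.
  - move=> z mz; apply: hm; apply: (lt_le_trans mz).
    by apply: le_trans (vcons_norm _ _).2; exact: (vcons_norm _ _).1.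
split=> //.
have E x : (\int[mu]_z (\1_A (vcons x (vcons z 0)))%:E = (slice2 A x)%:E)%E by exact: (hs x).2.
have -> : leb_vol A = (\int[mu]_x (slice2 A x)%:E)%E.
  by apply: eq_integral => x _; exact: E.
apply: (@has_int_bounded _ (2 * (`|m| + 1) * 1) m).
- apply/measurable_EFinP.
  have -> : EFin \o slice2 A = fubini_F mu
      (EFin \o \1_[set u : RT * RT | A (vcons u.1 (vcons u.2 0))]).
    by apply/funext => x; rewrite /= -E.
  apply: indic_measurable_fun_fubini_tonelli_F.
  apply: (@open_preimage_measurable _ (RT * RT)%type _ A (fun u => vcons u.1 (vcons u.2 0))) => //.
  apply: measurable_vcons => //.
  by apply: measurable_vcons => //; exact: measurable_nil.
- move=> x; apply: (slice_bound (hs x)) => // [z|z mz]; first exact: indic01.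
  apply: hm; apply: (lt_le_trans mz).
  by apply: le_trans (vcons_norm _ _).2; exact: (vcons_norm _ _).1.
- move=> x mx; apply: (has_int_unique (hs x)); have := @has_int0 R.
  congr has_int; apply/funext => z; rewrite hm // (lt_le_trans mx) //.
  exact: (vcons_norm _ _).1.
Qed.

Definition slice3 (A : set 'cV[R]_3) x y : R :=
  fine (\int[mu]_z (\1_A (vcons x (vcons y (vcons z 0))))%:E).

Definition slab3 (A : set 'cV[R]_3) x : R := fine (\int[mu]_y (slice3 A x y)%:E).

Lemma slice3_int (A : set 'cV[R]_3) : open A -> bounded_set A ->
  [/\ forall x y, has_int (fun z => \1_A (vcons x (vcons y (vcons z 0)))) (slice3 A x y),
     forall x, has_int (slice3 A x) (slab3 A x) & has_int (slab3 A) (fine (leb_vol A))].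
Proof.
move=> oA /bounded_indic [m hm].
have nz x y z : `|z| <= `|vcons x (vcons y (vcons z (0 : 'cV[R]_0)))|.
  apply: le_trans (vcons_norm _ _).2; apply: le_trans (vcons_norm _ _).2.
  exact: (vcons_norm _ _).1.
have ny x y z : `|y| <= `|vcons x (vcons y (vcons z (0 : 'cV[R]_0)))|.
  by apply: le_trans (vcons_norm _ _).2; exact: (vcons_norm _ _).1.
have nx x y z : `|x| <= `|vcons x (vcons y (vcons z (0 : 'cV[R]_0)))|.
  exact: (vcons_norm _ _).1.
have hs x y : has_int (fun z => \1_A (vcons x (vcons y (vcons z 0)))) (slice3 A x y).
  apply: (@has_int_bounded _ 1 m).
  - apply: (@indic_slice_measurable _ RT) => //.
    apply: measurable_vcons; first exact: measurable_cst.
    apply: measurable_vcons; first exact: measurable_cst.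
    by apply: measurable_vcons => //; exact: measurable_nil.
  - by move=> z; exact: indic01.
  - by move=> z mz; apply: hm; exact: lt_le_trans (nz _ _ _).
have E x y : (\int[mu]_z (\1_A (vcons x (vcons y (vcons z 0))))%:E = (slice3 A x y)%:E)%E.
  exact: (hs x y).2.
have b3 x y : 0 <= slice3 A x y <= 2 * (`|m| + 1) * 1.
  apply: (slice_bound (hs x y)) => // [z|z mz]; first exact: indic01.
  by apply: hm; exact: lt_le_trans (nz _ _ _).
have b0 : 0 <= 2 * (`|m| + 1) * 1 :> R by rewrite !mulr_ge0 ?addr_ge0.
have y3 x y : m < `|y| -> slice3 A x y = 0.
  move=> my; apply: (has_int_unique (hs x y)); have := @has_int0 R.
  by congr has_int; apply/funext => z; rewrite hm // (lt_le_trans my).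
have x3 x y : m < `|x| -> slice3 A x y = 0.
  move=> mx; apply: (has_int_unique (hs x y)); have := @has_int0 R.
  by congr has_int; apply/funext => z; rewrite hm // (lt_le_trans mx).
have mF : measurable_fun setT (fun u : RT * RT => (slice3 A u.1 u.2)%:E).
  have -> : (fun u : RT * RT => (slice3 A u.1 u.2)%:E) = fubini_F mu (EFin \o
      \1_[set u : (RT * RT) * RT | A (vcons u.1.1 (vcons u.1.2 (vcons u.2 0)))]).
    by apply/funext => u; rewrite -E.
  apply: indic_measurable_fun_fubini_tonelli_F.
  apply: (@open_preimage_measurable _ ((RT * RT) * RT)%type _ A
    (fun u => vcons u.1.1 (vcons u.1.2 (vcons u.2 0)))) => //.
  apply: measurable_vcons; first exact: measurableT_comp.
  apply: measurable_vcons; first exact: measurableT_comp.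
  by apply: measurable_vcons => //; exact: measurable_nil.
have h2 x : has_int (slice3 A x) (slab3 A x).
  apply: (@has_int_bounded _ (2 * (`|m| + 1) * 1) m) => //; last exact: y3.
  apply/measurable_EFinP.
  have -> : EFin \o slice3 A x = fubini_F mu (EFin \o
      \1_[set u : RT * RT | A (vcons x (vcons u.1 (vcons u.2 0)))]).
    by apply/funext => y; rewrite /= -E.
  apply: indic_measurable_fun_fubini_tonelli_F.
  apply: (@open_preimage_measurable _ (RT * RT)%type _ A
    (fun u => vcons x (vcons u.1 (vcons u.2 0)))) => //.
  apply: measurable_vcons; first exact: measurable_cst.
  apply: measurable_vcons => //.
  by apply: measurable_vcons => //; exact: measurable_nil.
have E2 x : (\int[mu]_y (slice3 A x y)%:E = (slab3 A x)%:E)%E by exact: (h2 x).2.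
split=> //.
have -> : leb_vol A = (\int[mu]_x (slab3 A x)%:E)%E.
  apply: eq_integral => x _; rewrite -E2; apply: eq_integral => y _; exact: E.
apply: (@has_int_bounded _ (2 * (`|m| + 1) * (2 * (`|m| + 1) * 1)) m).
- apply/measurable_EFinP.
  have -> : EFin \o slab3 A = fubini_F mu (fun u : RT * RT => (slice3 A u.1 u.2)%:E).
    by apply/funext => x; rewrite /= -E2.
  apply: measurable_fun_fubini_tonelli_F => // u.
  by rewrite lee_fin; case/andP: (b3 u.1 u.2).
- by move=> x; apply: (slice_bound (h2 x)) => //; exact: y3.
- move=> x mx; apply: (has_int_unique (h2 x)); have := @has_int0 R.
  by congr has_int; apply/funext => y; rewrite x3.
Qed.

End Slices.

(** * Integrals over projected segments and triangles *)

Section ProjectedIntegrals.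
Context {R : realType}.

(** The factor in front of f is the indicator of an oriented interval, up to
    endpoints: it is negative if b is less than a. *)
Lemma oriented_int (F f : R -> R) a b : (forall x : R, is_derive x 1 F (f x)) ->
  continuous f -> has_int (fun x => (below b x - below a x) * f x) (F b - F a).
Proof.
move=> dF cf.
have pos u v : u <= v -> has_int (fun x => (below v x - below u x) * f x) (F v - F u).
  move=> uv; apply: (has_int_except (s := [:: u]) (has_int_itv uv dF cf)) => x.
  rewrite inE => xu; congr (_ * _); rewrite /below indicE.
  rewrite (_ : (x \in _) = (u < x < v)); last by apply/idP/idP; rewrite inE /= in_itv.
  case: (ltgtP x u) xu => // xu _; first by rewrite (lt_le_trans xu uv) subrr.
  by rewrite subr0.
have [|ba] := leP a b; first exact: pos.
have := has_intZ (-1) (pos _ _ (ltW ba)); rewrite mulN1r opprB.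
by congr has_int; apply/funext => x; ring.
Qed.

Lemma segment_int (x0 x1 z0 z1 : R) :
  has_int (fun x => (below x1 x - below x0 x) * (((x1 - x) * z0 + (x - x0) * z1) / (x1 - x0)))
    ((x1 - x0) * ((z0 + z1) / 2)).
Proof.
have [->|ne] := eqVneq x1 x0.
  rewrite subrr mul0r; have := @has_int0 R; congr has_int; apply/funext => x.
  by rewrite subrr mul0r.
have d0 : x1 - x0 != 0 by rewrite subr_eq0.
pose F (x : R) := (z0 * (x1 * x - x ^+ 2 / 2) + z1 * (x ^+ 2 / 2 - x0 * x)) / (x1 - x0).
rewrite (_ : _ * (_ / 2) = F x1 - F x0); last by rewrite /F; field.
apply: oriented_int.
  by move=> x; rewrite /F; apply: is_derive_eq; rewrite /GRing.scale /=; field.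
move=> x; apply: cvgM; last exact: cvg_cst.
apply: cvgD; apply: cvgM; try exact: cvg_cst.
  by apply: cvgB; [exact: cvg_cst|exact: cvg_id].
by apply: cvgB; [exact: cvg_id|exact: cvg_cst].
Qed.

Section Triangle.
Variables (al be ga : R).

(** Primitive in y of the affine function [al + be * x + ga * y]. *)
Definition column (x y : R) : R := (al + be * x) * y + ga * (y ^+ 2 / 2).

Definition edge_line (p q : R * R) (x : R) : R :=
  p.2 + (q.2 - p.2) / (q.1 - p.1) * (x - p.1).

(** Simpson's rule, which is exact because [column] is quadratic along an
    edge. *)
Definition edge_flux (p q : R * R) : R :=
  (q.1 - p.1) * ((column p.1 p.2 + 4 * column ((p.1 + q.1) / 2) ((p.2 + q.2) / 2)
     + column q.1 q.2) / 6).

Lemma edge_int p q :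
  has_int (fun x => (below q.1 x - below p.1 x) * column x (edge_line p q x)) (edge_flux p q).
Proof.
have [e|ne] := eqVneq q.1 p.1.
  rewrite /edge_flux e subrr mul0r; have := @has_int0 R; congr has_int; apply/funext => x.
  by rewrite subrr mul0r.
have d0 : q.1 - p.1 != 0 by rewrite subr_eq0.
pose m := (q.2 - p.2) / (q.1 - p.1); pose c := p.2 - m * p.1.
(* Term by term primitive of [column] along the line y = m x + c. *)
pose F (x : R) := al * c * x + (al * m + be * c) * (x ^+ 2 / 2) + be * m * (x ^+ 3 / 3)
  + ga / 2 * (c ^+ 2 * x + c * m * x ^+ 2 + m ^+ 2 * (x ^+ 3 / 3)).
have eF : edge_flux p q = F q.1 - F p.1.
  by rewrite /edge_flux /F /column /c /m; field.
rewrite eF; apply: oriented_int.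
  move=> x; rewrite /F /column /edge_line; apply: is_derive_eq.
  by rewrite /GRing.scale /= /c -/m; field.
have cl : continuous (edge_line p q).
  move=> x; apply: cvgD; first exact: cvg_cst.
  by apply: cvgM; [exact: cvg_cst|apply: cvgB; [exact: cvg_id|exact: cvg_cst]].
move=> x; apply: cvgD; apply: cvgM.
- by apply: cvgD; [exact: cvg_cst|apply: cvgM; [exact: cvg_cst|exact: cvg_id]].
- exact: cl.
- exact: cvg_cst.
- apply: cvgM; last exact: cvg_cst.
  by rewrite expr2; apply: cvgM; exact: cl.
Qed.

Lemma column_int x a : has_int (fun y => (below a y - below 0 y) * (al + be * x + ga * y))
  (column x a).
Proof.
have -> : column x a = column x a - column x 0 by rewrite /column; ring.
apply: (oriented_int (F := column x)).
  by move=> y; rewrite /column; apply: is_derive_eq; rewrite /GRing.scale /=; field.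
move=> y; apply: cvgD; first exact: cvg_cst.
by apply: cvgM; [exact: cvg_cst|exact: cvg_id].
Qed.

(** Green's formula for the integral of an affine function over an oriented
    triangle, equal to the signed area times the mean of the values at the
    vertices. *)
Lemma triangle_flux p q r :
  - (edge_flux p q + edge_flux q r + edge_flux r p)
  = ((q.1 - p.1) * (r.2 - p.2) - (q.2 - p.2) * (r.1 - p.1)) / 2 *
    (((al + be * p.1 + ga * p.2) + (al + be * q.1 + ga * q.2) + (al + be * r.1 + ga * r.2)) / 3).
Proof. by rewrite /edge_flux /column; field. Qed.

Definition edge_sign (p q : R * R) x : R := below q.1 x - below p.1 x.

Definition triangle_column p q r x : R :=
  - (edge_sign p q x * column x (edge_line p q x)
     + edge_sign q r x * column x (edge_line q r x)
     + edge_sign r p x * column x (edge_line r p x)).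

Lemma triangle_column_int p q r : has_int (triangle_column p q r)
  (- (edge_flux p q + edge_flux q r + edge_flux r p)).
Proof.
have := has_intZ (-1) (has_intD (has_intD (edge_int p q) (edge_int q r)) (edge_int r p)).
rewrite mulN1r; congr has_int; apply/funext => x.
by rewrite /triangle_column mulN1r.
Qed.

Lemma triangle_slice_int p q r x :
  has_int (fun y => - (edge_sign p q x * below (edge_line p q x) y
      + edge_sign q r x * below (edge_line q r x) y
      + edge_sign r p x * below (edge_line r p x) y) * (al + be * x + ga * y))
   (triangle_column p q r x).
Proof.
have h p' q' := has_intZ (edge_sign p' q' x) (column_int x (edge_line p' q' x)).
have := has_intZ (-1) (has_intD (has_intD (h p q) (h q r)) (h r p)).
rewrite mulN1r; congr has_int; apply/funext => y; rewrite /edge_sign; ring.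
Qed.

End Triangle.

(** Twice the signed area of the triangle with vertices p, q and (x, y). *)
Definition edge_area (p q : R * R) (x y : R) : R :=
  (q.1 - p.1) * (y - p.2) - (q.2 - p.2) * (x - p.1).

Lemma edge_areaE p q x y : q.1 != p.1 ->
  edge_area p q x y = (q.1 - p.1) * (y - edge_line p q x).
Proof. by move=> ne; rewrite /edge_area /edge_line; field; rewrite subr_eq0. Qed.

(** The quotients are barycentric coordinates. *)
Definition inside (p q r : R * R) x y : bool :=
  let D := edge_area p q r.1 r.2 in
  [&& 0 <= edge_area q r x y / D, 0 <= edge_area r p x y / D & 0 <= edge_area p q x y / D].

(** The sign analysis of [lone_indicator]. There u is the abscissa, relative
    to the line, of the lone vertex, v and w are those of the two others, and
    b, c the areas spanned with the two edges through the lone vertex; the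
    third area is eliminated by [edge_area_moment]. *)
Lemma lone_vertex (b c u v w D : R) :
  b != 0 -> c != 0 -> 0 < u -> v < 0 -> w < 0 -> D = - (b * v + c * w) / u + b + c ->
  Num.sg D * ([&& 0 <= - (b * v + c * w) / u / D, 0 <= b / D & 0 <= c / D])%:R
  = ((0 < c)%R%:R - (b < 0)%R%:R).
Proof.
move=> b0 c0 u0 v0 w0 DE.
have bv : 0 < b -> 0 < - (b * v) by move=> h; rewrite oppr_gt0 nmulr_llt0.
have cw : 0 < c -> 0 < - (c * w) by move=> h; rewrite oppr_gt0 nmulr_llt0.
have bv' : b < 0 -> - (b * v) < 0 by move=> h; rewrite oppr_lt0 nmulr_lgt0.
have cw' : c < 0 -> - (c * w) < 0 by move=> h; rewrite oppr_lt0 nmulr_lgt0.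
case: (ltgtP b 0) b0 => // bs _; case: (ltgtP c 0) c0 => // cs _.
- have A0 : - (b * v + c * w) / u < 0.
    by rewrite pmulr_llt0 ?invr_gt0 // opprD; have := bv' bs; have := cw' cs; lra.
  have D0 : D < 0 by rewrite DE; lra.
  have q0 z : z < 0 -> 0 <= z / D by move=> z0; rewrite nmulr_lge0 ?invr_lt0 ?ltW.
  by rewrite ltr0_sg // !q0 //= mulr1 sub0r.
- have [D0|D0|->] := ltgtP D 0; last by rewrite sgr0 mul0r subrr.
    by rewrite (nmulr_lge0 c) ?invr_lt0 // (leNgt c 0) cs !andbF mulr0 subrr.
  by rewrite (pmulr_lge0 b) ?invr_gt0 // (leNgt 0 b) bs !andbF mulr0 subrr.
- have [D0|D0|->] := ltgtP D 0; last by rewrite sgr0 mul0r subrr.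
    by rewrite (nmulr_lge0 b) ?invr_lt0 // (leNgt b 0) bs !andbF mulr0 subrr.
  by rewrite (pmulr_lge0 c) ?invr_gt0 // (leNgt 0 c) cs !andbF mulr0 subrr.
- have A0 : 0 < - (b * v + c * w) / u.
    by rewrite pmulr_lgt0 ?invr_gt0 // opprD; have := bv bs; have := cw cs; lra.
  have D0 : 0 < D by rewrite DE; lra.
  by rewrite gtr0_sg // !(ltW (divr_gt0 _ D0)) //= mulr1 subr0.
Qed.

Section TriangleIndicator.
Variables (x y : R).
Implicit Types p q r : R * R.

Definition edge_term p q : R := edge_sign p q x * below (edge_line p q x) y.

Lemma edge_area_rot p q r : edge_area q r p.1 p.2 = edge_area p q r.1 r.2.
Proof. by rewrite /edge_area; ring. Qed.

Lemma edge_area_sum p q r :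
  edge_area q r x y + edge_area r p x y + edge_area p q x y = edge_area p q r.1 r.2.
Proof. by rewrite /edge_area; ring. Qed.

Lemma edge_area_moment p q r : edge_area q r x y * (p.1 - x)
  + edge_area r p x y * (q.1 - x) + edge_area p q x y * (r.1 - x) = 0.
Proof. by rewrite /edge_area; ring. Qed.

Lemma edge_area_neq0 p q : q.1 != p.1 -> y != edge_line p q x -> edge_area p q x y != 0.
Proof. by move=> ne yl; rewrite edge_areaE // mulf_neq0 // subr_eq0. Qed.

Lemma inside_rot p q r : inside q r p x y = inside p q r x y.
Proof. by rewrite /inside edge_area_rot andbA andbC. Qed.

Lemma edge_term_up p q : p.1 < x -> x < q.1 -> edge_term p q = (edge_area p q x y < 0)%R%:R.
Proof.
move=> px xq; have pq : p.1 < q.1 by exact: lt_trans xq.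
rewrite edge_areaE ?gt_eqF // pmulr_rlt0 ?subr_gt0 // subr_lt0.
by rewrite /edge_term /edge_sign /below xq (ltNge x) (ltW px) subr0 mul1r.
Qed.

Lemma edge_term_down p q : q.1 < x -> x < p.1 -> edge_term p q = - (0 < edge_area p q x y)%R%:R.
Proof.
move=> qx xp; have qp : q.1 < p.1 by exact: lt_trans xp.
rewrite edge_areaE ?lt_eqF // nmulr_rgt0 ?subr_lt0 //.
by rewrite /edge_term /edge_sign /below xp (ltNge x) (ltW qx) sub0r mulN1r.
Qed.

Lemma edge_term_same p q : (x < p.1) = (x < q.1) -> edge_term p q = 0.
Proof. by move=> e; rewrite /edge_term /edge_sign /below e subrr mul0r. Qed.

(** The line of abscissa x separates p from q and r. It meets the two edges
    through p, and its points in the triangle are those between these edges. *)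
Lemma lone_indicator p q r :
  y != edge_line p q x -> y != edge_line r p x ->
  (p.1 - x) * (q.1 - x) < 0 -> (p.1 - x) * (r.1 - x) < 0 ->
  Num.sg (edge_area p q r.1 r.2) * (inside p q r x y)%:R
  = - (edge_term p q + edge_term q r + edge_term r p).
Proof.
move=> ypq yrp uv uw.
have u0 : p.1 - x != 0 by apply: contraTneq uv => ->; rewrite mul0r ltxx.
have aE : edge_area q r x y
    = - (edge_area r p x y * (q.1 - x) + edge_area p q x y * (r.1 - x)) / (p.1 - x).
  apply: (mulIf u0); rewrite divfK //; have := edge_area_moment p q r; lra.
have DE : edge_area p q r.1 r.2 = - (edge_area r p x y * (q.1 - x)
    + edge_area p q x y * (r.1 - x)) / (p.1 - x) + edge_area r p x y + edge_area p q x y.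
  by rewrite -aE edge_area_sum.
rewrite /inside aE.
case: (ltgtP (p.1 - x) 0) u0 => // us _.
  have v0 : 0 < q.1 - x by rewrite -(nmulr_rlt0 _ us).
  have w0 : 0 < r.1 - x by rewrite -(nmulr_rlt0 _ us).
  rewrite subr_lt0 in us; rewrite subr_gt0 in v0; rewrite subr_gt0 in w0.
  have b0 : edge_area r p x y != 0 by rewrite edge_area_neq0 // lt_eqF // (lt_trans us).
  have c0 : edge_area p q x y != 0 by rewrite edge_area_neq0 // gt_eqF // (lt_trans us).
  have u1 : 0 < x - p.1 by rewrite subr_gt0.
  have v1 : x - q.1 < 0 by rewrite subr_lt0.
  have w1 : x - r.1 < 0 by rewrite subr_lt0.
  have e : - (edge_area r p x y * (q.1 - x) + edge_area p q x y * (r.1 - x)) / (p.1 - x)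
    = - (edge_area r p x y * (x - q.1) + edge_area p q x y * (x - r.1)) / (x - p.1).
    by field; rewrite ?subr_eq0 ?(lt_eqF us) ?(gt_eqF us).
  rewrite e in DE *; rewrite (lone_vertex b0 c0 u1 v1 w1 DE).
  rewrite (edge_term_up us v0) (@edge_term_same q r) ?v0 ?w0 // (edge_term_down us w0).
  by case: (ltgtP (edge_area r p x y) 0) b0; case: (ltgtP (edge_area p q x y) 0) c0 => //= *; ring.
have v0 : q.1 - x < 0 by rewrite -(pmulr_rlt0 _ us).
have w0 : r.1 - x < 0 by rewrite -(pmulr_rlt0 _ us).
have us' := us; have v0' := v0; have w0' := w0.
rewrite subr_gt0 in us; rewrite subr_lt0 in v0; rewrite subr_lt0 in w0.
have b0 : edge_area r p x y != 0 by rewrite edge_area_neq0 // gt_eqF // (lt_trans w0).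
have c0 : edge_area p q x y != 0 by rewrite edge_area_neq0 // lt_eqF // (lt_trans v0).
rewrite (lone_vertex b0 c0 us' v0' w0' DE).
rewrite (edge_term_down v0 us) (@edge_term_same q r); last by rewrite !ltNge !ltW.
by rewrite (edge_term_up w0 us); ring.
Qed.

(** The signed indicator of a triangle as a sum over its oriented edges, as in
    Green's formula. Either one vertex is alone on its side of the line of
    abscissa x, or all lie on one side and both members are zero. *)
Lemma triangle_indicator p q r : edge_area p q r.1 r.2 != 0 ->
  x != p.1 -> x != q.1 -> x != r.1 ->
  y != edge_line p q x -> y != edge_line q r x -> y != edge_line r p x ->
  Num.sg (edge_area p q r.1 r.2) * (inside p q r x y)%:R
  = - (edge_term p q + edge_term q r + edge_term r p).
Proof.
move=> D0 xp xq xr ypq yqr yrp.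
have n0 s : x != s -> s - x != 0 by rewrite subr_eq0 eq_sym.
have [uv|uv] := ltP ((p.1 - x) * (q.1 - x)) 0.
  have [uw|uw] := ltP ((p.1 - x) * (r.1 - x)) 0; first exact: lone_indicator.
  have := @lone_indicator q r p yqr ypq; rewrite (mulrC (q.1 - x) (p.1 - x)) => /(_ _ uv).
  rewrite edge_area_rot inside_rot => ->; first by congr (- _); ring.
  have up : 0 < (p.1 - x) ^+ 2 by rewrite exprn_even_gt0 //= n0.
  have uw' : 0 < (p.1 - x) * (r.1 - x) by rewrite lt_def uw mulf_neq0 // n0.
  have : (p.1 - x) ^+ 2 * ((q.1 - x) * (r.1 - x)) < 0.
    by rewrite (_ : _ * _ = ((p.1 - x) * (q.1 - x)) * ((p.1 - x) * (r.1 - x))); [rewrite pmulr_llt0|ring].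
  by rewrite pmulr_rlt0.
have uv' : 0 < (p.1 - x) * (q.1 - x) by rewrite lt_def uv mulf_neq0 // n0.
have up : 0 < (p.1 - x) ^+ 2 by rewrite exprn_even_gt0 //= n0.
have [uw|uw] := ltP ((p.1 - x) * (r.1 - x)) 0.
  have := @lone_indicator r p q yrp yqr; rewrite (mulrC (r.1 - x) (p.1 - x)) => /(_ uw).
  rewrite -edge_area_rot -inside_rot => ->; first by congr (- _); ring.
  have : (p.1 - x) ^+ 2 * ((r.1 - x) * (q.1 - x)) < 0.
    by rewrite (_ : _ * _ = ((p.1 - x) * (r.1 - x)) * ((p.1 - x) * (q.1 - x))); [rewrite pmulr_llt0|ring].
  by rewrite pmulr_rlt0.
have uw' : 0 < (p.1 - x) * (r.1 - x) by rewrite lt_def uw mulf_neq0 // n0.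
have same s : 0 < (p.1 - x) * (s - x) -> (x < p.1) = (x < s).
  rewrite -(subr_gt0 x p.1) -(subr_gt0 x s) => h.
  have [a|a|a] := ltgtP (p.1 - x) 0.
  - by apply/esym/negbTE; rewrite -leNgt ltW // -(nmulr_rgt0 _ a).
  - by apply/esym; rewrite -(pmulr_rgt0 _ a).
  - by move: h; rewrite a mul0r ltxx.
have ep := same _ uv'; have er := same _ uw'.
rewrite !edge_term_same -?ep -?er // !addr0 oppr0.
case: (boolP (inside p q r x y)) => [|_]; last by rewrite mulr0.
rewrite /inside => /and3P[]; set D := edge_area p q r.1 r.2.
set a := edge_area q r x y; set b := edge_area r p x y; set c := edge_area p q x y.
move=> a0 b0 c0; exfalso.
have s1 : a / D + b / D + c / D = 1.
  by rewrite -!mulrDl /a /b /c edge_area_sum mulfV.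
have s2 : (a / D) * (p.1 - x) ^+ 2 + (b / D) * ((p.1 - x) * (q.1 - x))
    + (c / D) * ((p.1 - x) * (r.1 - x)) = 0.
  have m0 := edge_area_moment p q r; rewrite -/a -/b -/c in m0.
  rewrite -[RHS](mulr0 ((p.1 - x) / D)) -m0; ring.
have t1 : 0 <= (a / D) * (p.1 - x) ^+ 2 by rewrite mulr_ge0 // ltW.
have t2 : 0 <= (b / D) * ((p.1 - x) * (q.1 - x)) by rewrite mulr_ge0.
have t3 : 0 <= (c / D) * ((p.1 - x) * (r.1 - x)) by rewrite mulr_ge0.
have z1 : a / D = 0.
  have : (a / D) * (p.1 - x) ^+ 2 == 0 by rewrite eq_le t1 andbT; lra.
  by rewrite mulf_eq0 (gt_eqF up) orbF => /eqP.
have z2 : b / D = 0.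
  have : (b / D) * ((p.1 - x) * (q.1 - x)) == 0 by rewrite eq_le t2 andbT; lra.
  by rewrite mulf_eq0 (gt_eqF uv') orbF => /eqP.
have z3 : c / D = 0.
  have : (c / D) * ((p.1 - x) * (r.1 - x)) == 0 by rewrite eq_le t3 andbT; lra.
  by rewrite mulf_eq0 (gt_eqF uw') orbF => /eqP.
move: s1; rewrite z1 z2 z3 !addr0 => /eqP.
by rewrite eq_sym oner_eq0.
Qed.

End TriangleIndicator.

End ProjectedIntegrals.

(** * The volume as a polynomial in the vertices *)

Section SmallDeterminants.
Context {R : comRingType}.

Lemma det2E (A : 'M[R]_2) :
  \det A = A ord0 ord0 * A (lift ord0 ord0) (lift ord0 ord0)
         - A ord0 (lift ord0 ord0) * A (lift ord0 ord0) ord0.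
Proof.
rewrite (expand_det_row _ ord0) !big_ord_recl big_ord0 /cofactor !det_mx11 !mxE /=.
have -> : lift (lift ord0 ord0) ord0 = ord0 :> 'I_2 by apply: val_inj.
ring.
Qed.

Lemma det3E (A : 'M[R]_3) (o0 := ord0 : 'I_3) (o1 := lift ord0 ord0 : 'I_3)
    (o2 := lift ord0 (lift ord0 ord0) : 'I_3) :
  \det A = A o0 o0 * (A o1 o1 * A o2 o2 - A o1 o2 * A o2 o1)
         - A o0 o1 * (A o1 o0 * A o2 o2 - A o1 o2 * A o2 o0)
         + A o0 o2 * (A o1 o0 * A o2 o1 - A o1 o1 * A o2 o0).
Proof.
rewrite (expand_det_row _ ord0) !big_ord_recl big_ord0 /cofactor !det2E !mxE /=.
have -> : lift (lift ord0 ord0) ord0 = o0 :> 'I_3 by apply: val_inj.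
have -> : lift (lift ord0 ord0) (lift ord0 ord0) = o2 :> 'I_3 by apply: val_inj.
have -> : lift (lift ord0 (lift ord0 ord0)) ord0 = o0 :> 'I_3 by apply: val_inj.
have -> : lift (lift ord0 (lift ord0 ord0)) (lift ord0 ord0) = o1 :> 'I_3 by apply: val_inj.
rewrite -/o0 -/o1 -/o2; ring.
Qed.

End SmallDeterminants.

Section CellCoordinates.
Context {R : realType} {n J K : nat} (M : mesh R n J K).
Hypothesis hM : polyhedral_surface M.

(** Divided by d!, the sum of the signed volumes of the columns between the
    simplices and the coordinate hyperplane, where the vertical coordinate is
    zero. *)
Definition column_moment : R := \sum_j wedged M j * \sum_i verts M j i ord_max 0.

Lemma facet_coords j a (x : 'cV[R]_n.+2) : cell M (facet M j a) x ->
  exists b : 'I_n.+2 -> R, [/\ \sum_i b i = 1, b a = 0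
    & forall l, x l 0 = \sum_i b i * verts M j i l 0].
Proof.
move=> [b [wb b0 ->]]; have wj := weights_sub (facet_sub M j a) wb.
exists (fun i => b (elt M j i)); split.
- exact: weights_sum.
- case: wb => -> //; apply/imsetP => -[i]; rewrite inE => ia /(elt_inj hM) e.
  by rewrite e eqxx in ia.
- move=> l; rewrite (weights_comb hM wj) summxE; apply: eq_bigr => i _; by rewrite mxE.
Qed.

Lemma cell_coords j (x : 'cV[R]_n.+2) : cell M (vset M j) x ->
  exists b : 'I_n.+2 -> R, [/\ \sum_i b i = 1, forall i, 0 <= b i
    & forall l, x l 0 = \sum_i b i * verts M j i l 0].
Proof.
move=> /(cellP hM) [xE x0]; exists (bary M j x); split=> //; first exact: sum_bary.
by move=> l; rewrite {1}xE summxE; apply: eq_bigr => i _; rewrite mxE.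
Qed.

Lemma coords_cell j (b : 'I_n.+2 -> R) (x : 'cV[R]_n.+2) : \sum_i b i = 1 -> (forall i, 0 <= b i) ->
  (forall l, x l 0 = \sum_i b i * verts M j i l 0) -> cell M (vset M j) x.
Proof.
move=> b1 b0 xE; have e : x = \sum_i b i *: verts M j i.
  by apply/colP => l; rewrite xE summxE; apply: eq_bigr => i _; rewrite mxE.
by apply/(cellP hM); split=> [|i]; rewrite e ?bary_comb //; apply: eq_bigr => i _; rewrite bary_comb.
Qed.

Lemma wedgedE j : wedged M j
  = \det (row_mx (delta_mx ord_max 0 : 'cV[R]_n.+2) (edge_mx (verts M j)) : 'M[R]_n.+2).
Proof. by rewrite /wedged mxE. Qed.

End CellCoordinates.

Section Plane.
Context {R : realType} {J K : nat} (M : mesh R 0 J K).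
Hypothesis hM : polyhedral_surface M.
Local Notation o1 := (lift ord0 ord0 : 'I_2).
Local Notation base x := (vcons x 0 : 'cV[R]_2).
Local Notation vx j i := (verts M j i ord0 0).
Local Notation vz j i := (verts M j i o1 0).

Let max2 : ord_max = o1 :> 'I_2. Proof. exact: val_inj. Qed.

Lemma point2 (x z : R) : vcons x (vcons z 0) = base x + z *: vertical.
Proof.
apply/colP => l; rewrite [RHS]mxE [X in _ + X]mxE [X in _ * X]mxE eqxx andbT.
case: (unliftP ord0 l) => [k ->|->]; last by rewrite !vcons0 mulr0 addr0.
by rewrite (ord1 k) !vconsS vcons0 mxE max2 eqxx add0r mulr1.
Qed.

Lemma point2x (x z : R) : (base x + z *: vertical) ord0 0 = x.
Proof. by rewrite -point2 vcons0. Qed.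

Lemma point2z (x z : R) : (base x + z *: vertical) o1 0 = z.
Proof. by rewrite -point2 vconsS vcons0. Qed.

Lemma wedged2 j : wedged M j = - (vx j o1 - vx j ord0).
Proof.
rewrite wedgedE det2E !row_mx0 !row_mxS !mxE max2 eqxx /=; ring.
Qed.

Lemma generic2 x : x \notin [seq vtx M k ord0 0 | k : 'I_K] -> generic_line M (base x).
Proof.
move=> xn; have nx j i : x != vx j i.
  by apply: contraNneq xn => ->; apply: map_f; rewrite mem_enum.
split=> [j a z|j z w0].
  move=> /(facet_coords hM) [b [b1 ba bx]].
  have := bx ord0; rewrite point2x; move: b1; rewrite !big_ord_recl !big_ord0 !addr0.
  case: (unliftP ord0 a) ba => [k ->|-> ba]; first rewrite (ord1 k) => ba.
    rewrite ba mul0r !addr0 => ->; rewrite mul1r => /eqP.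
    by rewrite (negPf (nx _ _)).
  rewrite ba mul0r !add0r => ->; rewrite mul1r => /eqP.
  by rewrite (negPf (nx _ _)).
move=> /(cell_coords hM) [b [b1 b0 bx]].
have := bx ord0; rewrite point2x; move: b1; rewrite !big_ord_recl !big_ord0 !addr0.
move: w0; rewrite wedged2 => /eqP; rewrite oppr_eq0 subr_eq0 => /eqP -> b1.
by rewrite -mulrDl b1 mul1r => /eqP; rewrite (negPf (nx _ _)).
Qed.

(** The sign of the normal is also the orientation of the projected segment,
    which the difference of the half-line indicators takes into account. *)
Lemma crossing2 x j : x \notin [seq vtx M k ord0 0 | k : 'I_K] ->
  (if crosses M (base x) j then Num.sg (wedged M j) * height M (base x) j else 0)
  = - ((below (vx j o1) x - below (vx j ord0) x) *
      (((vx j o1 - x) * vz j ord0 + (x - vx j ord0) * vz j o1) / (vx j o1 - vx j ord0))).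
Proof.
move=> xn; have nx i : x != vx j i.
  by apply: contraNneq xn => ->; apply: map_f; rewrite mem_enum.
have gx := generic2 xn.
set x0 := vx j ord0; set x1 := vx j o1; set z0 := vz j ord0; set z1 := vz j o1.
have xx0 : x != x0 by exact: nx.
have xx1 : x != x1 by exact: nx.
case: ifPn => [cj|ncj].
  have := (crossesP hM j (height M (base x) j) gx).2 (conj cj erefl).
  move=> /(cell_coords hM) [b [b1 b0 bx]].
  have := bx ord0; have := bx o1; rewrite point2x point2z; move: b1.
  rewrite !big_ord_recl !big_ord0 !addr0 -/x0 -/x1 -/z0 -/z1 => b1 -> xE.
  have w0 : wedged M j != 0 by case/andP: cj.
  move: w0; rewrite wedged2 -/x0 -/x1 oppr_eq0 => d0.
  have e1 : b o1 * (x1 - x0) = x - x0.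
    by rewrite xE (_ : b ord0 = 1 - b o1); [ring|rewrite -b1 addrK].
  have e0 : b ord0 * (x1 - x0) = x1 - x.
    by rewrite xE (_ : b ord0 = 1 - b o1); [ring|rewrite -b1 addrK].
  have -> : b ord0 * z0 + b o1 * z1 = ((x1 - x) * z0 + (x - x0) * z1) / (x1 - x0).
    by rewrite -e0 -e1; field.
  rewrite -[RHS]mulNr; congr (_ * _); rewrite sgrN /below.
  have := b0 ord0; have := b0 o1.
  case: (ltgtP (x1 - x0) 0) d0 => // ds _ p1 p0.
    have q1 : x - x0 <= 0 by rewrite -e1 mulr_ge0_le0 // ltW.
    have q0 : x1 - x <= 0 by rewrite -e0 mulr_ge0_le0 // ltW.
    rewrite ltr0_sg // (_ : x < x1 = false) 1?(_ : x < x0); first by rewrite /=; ring.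
      by rewrite lt_neqAle xx0 -subr_le0.
    by apply/negbTE; rewrite -leNgt -subr_le0.
  have q1 : 0 <= x - x0 by rewrite -e1 mulr_ge0 // ltW.
  have q0 : 0 <= x1 - x by rewrite -e0 mulr_ge0 // ltW.
  rewrite gtr0_sg // (_ : x < x0 = false) 1?(_ : x < x1); first by rewrite /=; ring.
    by rewrite lt_neqAle xx1 -subr_ge0.
  by apply/negbTE; rewrite -leNgt -subr_ge0.
have [d0|d0] := eqVneq (x1 - x0) 0.
  by move/eqP: d0; rewrite subr_eq0 => /eqP ->; rewrite subrr mul0r oppr0.
suff -> : below x1 x = below x0 x by rewrite subrr mul0r oppr0.
apply: contrapT => nb; move/negP: ncj; apply.
pose b (i : 'I_2) := if i == ord0 then (x1 - x) / (x1 - x0) else (x - x0) / (x1 - x0).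
pose z := b ord0 * z0 + b o1 * z1.
suff /(crossesP hM j z gx) [] : cell M (vset M j) (base x + z *: vertical) by [].
apply: (coords_cell hM (b := b)).
- by rewrite !big_ord_recl big_ord0 /b /=; field.
- have : 0 <= (x1 - x) / (x1 - x0) /\ 0 <= (x - x0) / (x1 - x0).
    have := nb; rewrite /below.
    case: (ltgtP x x1) xx1 => // s1 _; case: (ltgtP x x0) xx0 => // s0 _ // _.
      have ds : x1 - x0 > 0 by rewrite subr_gt0 (lt_trans s0).
      by rewrite !ltW // divr_gt0 // subr_gt0.
    have ds : x1 - x0 < 0 by rewrite subr_lt0 (lt_trans s1).
    by rewrite !nmulr_lge0 ?invr_lt0 // !subr_le0 !ltW.
  by move=> [h1 h2] i; rewrite /b; case: ifP.
- move=> l; rewrite !big_ord_recl big_ord0 addr0.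
  case: (unliftP ord0 l) => [k ->|->].
    by rewrite (ord1 k) point2z.
  by rewrite point2x -/x0 -/x1 /b /=; field.
Qed.

Lemma crossing_sum_int2 : has_int (fun x => crossing_sum M (base x)) (column_moment M / 2).
Proof.
have h : has_int (fun x => \sum_j - ((below (vx j o1) x - below (vx j ord0) x) *
      (((vx j o1 - x) * vz j ord0 + (x - vx j ord0) * vz j o1) / (vx j o1 - vx j ord0))))
   (\sum_j - ((vx j o1 - vx j ord0) * ((vz j ord0 + vz j o1) / 2))).
  apply: has_int_sum => j _.
  have := has_intZ (-1) (segment_int (vx j ord0) (vx j o1) (vz j ord0) (vz j o1)).
  by rewrite mulN1r; congr has_int; apply/funext => x; rewrite mulN1r.
rewrite (_ : _ / 2 = \sum_j - ((vx j o1 - vx j ord0) * ((vz j ord0 + vz j o1) / 2))); last first.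
  rewrite /column_moment mulr_suml; apply: eq_bigr => j _.
  by rewrite wedged2 !big_ord_recl big_ord0 max2 addr0; ring.
apply: (has_int_except (s := [seq vtx M k ord0 0 | k : 'I_K]) h) => x xn.
rewrite /crossing_sum big_mkcond; apply: eq_bigr => j _; exact: crossing2.
Qed.

End Plane.

Section Space.
Context {R : realType} {J K : nat} (M : mesh R 1 J K).
Hypothesis hM : polyhedral_surface M.
Local Notation o1 := (lift ord0 ord0 : 'I_3).
Local Notation o2 := (lift ord0 (lift ord0 ord0) : 'I_3).
Local Notation base x y := (vcons x (vcons y 0) : 'cV[R]_3).
Local Notation vp j i := (verts M j i ord0 0, verts M j i o1 0).
Local Notation vz j i := (verts M j i o2 0).
Local Notation D j := (edge_area (vp j ord0) (vp j o1) (vp j o2).1 (vp j o2).2).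

Let max3 : ord_max = o2 :> 'I_3. Proof. exact: val_inj. Qed.

Lemma point3 (x y z : R) : vcons x (vcons y (vcons z 0)) = base x y + z *: vertical.
Proof.
apply/colP => l; rewrite [RHS]mxE [X in _ + X]mxE [X in _ * X]mxE eqxx andbT max3.
case: (unliftP ord0 l) => [k ->|->]; last by rewrite !vcons0 mulr0 addr0.
rewrite !vconsS; case: (unliftP ord0 k) => [m ->|->]; last by rewrite !vcons0 mulr0 addr0.
by rewrite (ord1 m) !vconsS vcons0 mxE eqxx add0r mulr1.
Qed.

Lemma point3x (x y z : R) : (base x y + z *: vertical) ord0 0 = x.
Proof. by rewrite -point3 vcons0. Qed.

Lemma point3y (x y z : R) : (base x y + z *: vertical) o1 0 = y.
Proof. by rewrite -point3 vconsS vcons0. Qed.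

Lemma point3z (x y z : R) : (base x y + z *: vertical) o2 0 = z.
Proof. by rewrite -point3 !vconsS vcons0. Qed.

Lemma wedged3 j : wedged M j = D j.
Proof.
rewrite wedgedE det3E !row_mx0 !row_mxS !mxE max3 eqxx /= /edge_area /=; ring.
Qed.

Definition plan (k : 'I_K) : R * R := (vtx M k ord0 0, vtx M k o1 0).

(** The vertical lines over the projected vertices and edges are not generic;
    those with abscissa in [special_x] or ordinate in [special_y] include
    them. *)
Definition special_x : seq R := [seq (plan k).1 | k : 'I_K].

Definition special_y x : seq R :=
  [seq edge_line (plan kl.1) (plan kl.2) x | kl : 'I_K * 'I_K].

Lemma special_xP x j i : x \notin special_x -> x != (vp j i).1.
Proof. by apply: contraNneq => ->; apply: (map_f (fun k => (plan k).1)); rewrite mem_enum. Qed.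

Lemma special_yP x y j i l : y \notin special_y x -> y != edge_line (vp j i) (vp j l) x.
Proof.
apply: contraNneq => ->.
by apply: (map_f (fun kl => edge_line (plan kl.1) (plan kl.2) x) (x := (elt M j i, elt M j l)));
  rewrite mem_enum.
Qed.

Lemma on_edge (p q : R * R) b c x y : b + c = 1 -> x = b * p.1 + c * q.1 -> y = b * p.2 + c * q.2 ->
  x != p.1 -> y != edge_line p q x -> False.
Proof.
move=> b1 xE yE xp; apply/negP; rewrite negbK; apply/eqP.
have bE : b = 1 - c by rewrite -b1 addrK.
have qp : q.1 - p.1 != 0.
  apply: contraNneq xp => /eqP; rewrite subr_eq0 => /eqP e.
  by rewrite xE e -mulrDl b1 mul1r.
by rewrite /edge_line xE yE bE; field.
Qed.

Lemma collinear_edge (p q : R * R) x y : edge_area p q x y = 0 -> q.1 != p.1 -> y = edge_line p q x.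
Proof.
move=> /eqP + qp; rewrite edge_areaE // mulf_eq0 !subr_eq0 (negPf qp) /=.
by move/eqP.
Qed.

Lemma generic3 x y : x \notin special_x -> y \notin special_y x -> generic_line M (base x y).
Proof.
move=> xn yn; have nx j i := special_xP j i xn; have ny j i l := special_yP j i l yn.
split=> [j a z|j z w0].
  move=> /(facet_coords hM) [b [b1 ba bx]].
  have := bx ord0; have := bx o1; rewrite point3x point3y; move: b1.
  rewrite !big_ord_recl !big_ord0 !addr0.
  case: (unliftP ord0 a) ba => [k ->|-> ba].
    case: (unliftP ord0 k) => [m ->|-> ba].
      rewrite (ord1 m) => ba; rewrite ba !mul0r !addr0 => b1 yE xE.
      exact: (@on_edge (vp j ord0) (vp j o1) _ _ x y b1 xE yE (nx j ord0) (ny j ord0 o1)).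
    rewrite ba !mul0r !add0r => b1 yE xE.
    exact: (@on_edge (vp j ord0) (vp j o2) _ _ x y b1 xE yE (nx j ord0) (ny j ord0 o2)).
  rewrite ba !mul0r !add0r => b1 yE xE.
  exact: (@on_edge (vp j o1) (vp j o2) _ _ x y b1 xE yE (nx j o1) (ny j o1 o2)).
move=> /(cell_coords hM) [b [b1 b0 bx]].
have := bx ord0; have := bx o1; rewrite point3x point3y; move: b1.
rewrite !big_ord_recl !big_ord0 !addr0 => b1 yE xE.
rewrite wedged3 in w0.
have bE : b ord0 = 1 - b o1 - b o2 by rewrite -b1; ring.
have [e|qp] := eqVneq (vp j o1).1 (vp j ord0).1; last first.
  have /collinear_edge : edge_area (vp j ord0) (vp j o1) x y = 0.
    rewrite -(mulr0 (b o2)) -w0 /edge_area xE yE bE /=; ring.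
  by move=> /(_ qp) /eqP; rewrite (negPf (ny _ _ _)).
have [e'|qp] := eqVneq (vp j o2).1 (vp j o1).1.
  have := nx j ord0; rewrite xE /= in e e' *; rewrite e' e -!mulrDl.
  by rewrite b1 mul1r eqxx.
have /collinear_edge : edge_area (vp j o1) (vp j o2) x y = 0.
  rewrite -(mulr0 (b ord0)) -w0 /edge_area xE yE bE /=; ring.
by move=> /(_ qp) /eqP; rewrite (negPf (ny _ _ _)).
Qed.

(** Coefficients of the affine function of (x, y) whose graph carries the j-th triangle. *)
Definition slope_x j : R := ((vz j o1 - vz j ord0) * ((vp j o2).2 - (vp j ord0).2)
  - (vz j o2 - vz j ord0) * ((vp j o1).2 - (vp j ord0).2)) / D j.
Definition slope_y j : R := (((vp j o1).1 - (vp j ord0).1) * (vz j o2 - vz j ord0)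
  - ((vp j o2).1 - (vp j ord0).1) * (vz j o1 - vz j ord0)) / D j.
Definition intercept j : R := vz j ord0 - slope_x j * (vp j ord0).1 - slope_y j * (vp j ord0).2.

Lemma graph_comb j x y : D j != 0 ->
  (edge_area (vp j o1) (vp j o2) x y * vz j ord0 + edge_area (vp j o2) (vp j ord0) x y * vz j o1
   + edge_area (vp j ord0) (vp j o1) x y * vz j o2) / D j
  = intercept j + slope_x j * x + slope_y j * y.
Proof. by rewrite /intercept /slope_x /slope_y /edge_area /= => D0; field. Qed.

Lemma graph_vertex j i : D j != 0 ->
  intercept j + slope_x j * (vp j i).1 + slope_y j * (vp j i).2 = vz j i.
Proof.
move=> D0; case: (unliftP ord0 i) => [k ->|->]; last first.
  by rewrite /intercept; ring.
case: (unliftP ord0 k) => [m ->|->]; rewrite ?(ord1 m).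
  by move: D0; rewrite /intercept /slope_x /slope_y /edge_area /= => D0; field.
by move: D0; rewrite /intercept /slope_x /slope_y /edge_area /= => D0; field.
Qed.

Lemma crossing3 x y j : x \notin special_x -> y \notin special_y x -> D j != 0 ->
  (if crosses M (base x y) j then Num.sg (wedged M j) * height M (base x y) j else 0)
  = - (edge_term x y (vp j ord0) (vp j o1) + edge_term x y (vp j o1) (vp j o2)
       + edge_term x y (vp j o2) (vp j ord0)) * (intercept j + slope_x j * x + slope_y j * y).
Proof.
move=> xn yn D0; have gx := generic3 xn yn.
rewrite -(@triangle_indicator _ x y (vp j ord0) (vp j o1) (vp j o2)) //;
  try exact: special_xP; try exact: special_yP.
rewrite -wedged3 -(graph_comb x y D0) -wedged3.
have w0 : wedged M j != 0 by rewrite wedged3.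
case: ifPn => [cj|ncj].
  have := (crossesP hM j (height M (base x y) j) gx).2 (conj cj erefl).
  move=> /(cell_coords hM) [b [b1 b0 bx]].
  have := bx ord0; have := bx o1; have := bx o2; rewrite point3x point3y point3z; move: b1.
  rewrite !big_ord_recl !big_ord0 !addr0 => b1 -> yE xE.
  have bE : b ord0 = 1 - b o1 - b o2 by rewrite -b1; ring.
  have a0 : edge_area (vp j o1) (vp j o2) x y = b ord0 * wedged M j.
    by rewrite wedged3 /edge_area xE yE bE /=; ring.
  have a1 : edge_area (vp j o2) (vp j ord0) x y = b o1 * wedged M j.
    by rewrite wedged3 /edge_area xE yE bE /=; ring.
  have a2 : edge_area (vp j ord0) (vp j o1) x y = b o2 * wedged M j.
    by rewrite wedged3 /edge_area xE yE bE /=; ring.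
  rewrite /inside -wedged3 a0 a1 a2 !mulfK // !b0 /= mulr1; congr (_ * _).
  by field.
case: (boolP (inside _ _ _ _ _)) => [ins|_]; last by rewrite mulr0 mul0r.
exfalso; move/negP: ncj; apply.
pose b (i : 'I_3) := (if i == ord0 then edge_area (vp j o1) (vp j o2) x y
  else if i == o1 then edge_area (vp j o2) (vp j ord0) x y
  else edge_area (vp j ord0) (vp j o1) x y) / wedged M j.
pose z := b ord0 * vz j ord0 + b o1 * vz j o1 + b o2 * vz j o2.
suff /(crossesP hM j z gx) [] : cell M (vset M j) (base x y + z *: vertical) by [].
have wE : wedged M j = ((vp j o1).1 - (vp j ord0).1) * ((vp j o2).2 - (vp j ord0).2)
   - ((vp j o1).2 - (vp j ord0).2) * ((vp j o2).1 - (vp j ord0).1).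
  exact: wedged3.
apply: (coords_cell hM (b := b)).
- rewrite !big_ord_recl big_ord0 /b /= addr0 -!mulrDl addrA edge_area_sum -wedged3.
  by rewrite mulfV.
- move: ins; rewrite /inside -wedged3 => /and3P[h0 h1 h2] i.
  by rewrite /b; case: ifP => // _; case: ifP.
- move=> l; rewrite !big_ord_recl big_ord0 addr0 addrA.
  case: (unliftP ord0 l) => [k ->|->].
    case: (unliftP ord0 k) => [m ->|->]; first by rewrite (ord1 m) point3z.
    rewrite point3y /b /= /edge_area; move: w0; rewrite wE /= => w0; field; exact: w0.
  rewrite point3x /b /= /edge_area; move: w0; rewrite wE /= => w0; field; exact: w0.
Qed.

Lemma crossing3_flat x y j : D j = 0 ->
  (if crosses M (base x y) j then Num.sg (wedged M j) * height M (base x y) j else 0) = 0.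
Proof. by rewrite /crosses wedged3 => ->; rewrite eqxx. Qed.

(** Vertical triangles are not met by generic lines, and they are not graphs. *)
Definition column_sum x : R := \sum_j (if D j == 0 then 0 else
  triangle_column (intercept j) (slope_x j) (slope_y j) (vp j ord0) (vp j o1) (vp j o2) x).

Lemma crossing_sum_int3_slice x : x \notin special_x ->
  has_int (fun y => crossing_sum M (base x y)) (column_sum x).
Proof.
move=> xn.
have h : has_int (fun y => \sum_j (if D j == 0 then 0 else
   - (edge_term x y (vp j ord0) (vp j o1) + edge_term x y (vp j o1) (vp j o2)
       + edge_term x y (vp j o2) (vp j ord0)) * (intercept j + slope_x j * x + slope_y j * y)))
   (column_sum x).
  apply: has_int_sum => j _; case: ifP => _; first exact: has_int0.
  exact: triangle_slice_int.
apply: (has_int_except h (s := special_y x)) => y yn.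
rewrite /crossing_sum big_mkcond; apply: eq_bigr => j _.
by case: eqP => [|/eqP] D0; [rewrite crossing3_flat|rewrite crossing3].
Qed.

Lemma column_sum_int : has_int column_sum (column_moment M / 6).
Proof.
have -> : column_moment M / 6 = \sum_j (if D j == 0 then 0 else
   - (edge_flux (intercept j) (slope_x j) (slope_y j) (vp j ord0) (vp j o1)
    + edge_flux (intercept j) (slope_x j) (slope_y j) (vp j o1) (vp j o2)
    + edge_flux (intercept j) (slope_x j) (slope_y j) (vp j o2) (vp j ord0))).
  rewrite /column_moment mulr_suml; apply: eq_bigr => j _; rewrite wedged3.
  case: eqP => [->|/eqP D0]; first by rewrite !mul0r.
  rewrite triangle_flux !graph_vertex // !big_ord_recl big_ord0 max3.
  by rewrite -[_ - _ * _]/(D j); set d := D j; field.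
apply: has_int_sum => j _; case: ifP => _; first exact: has_int0.
exact: triangle_column_int.
Qed.

End Space.

(** Integrate [slice_difference] over the horizontal coordinate; finitely many
    lines are not generic. *)
Lemma volume_difference2 (R : realType) J K (G : evolution R 0 J K)
    (hG : evolving_polyhedral_surface G) cap Om (hOm : encloses G cap Om) s t :
  0 < s <= final_time G -> 0 < t <= final_time G ->
  fine (leb_vol (Om s)) - fine (leb_vol (Om t))
  = column_moment (at_time G s) / 2 - column_moment (at_time G t) / 2.
Proof.
move=> hs ht; case: (hOm) => [_ _ hreg _ _].
have [os bs _] := hreg s (time_cc hs); have [ot bt _] := hreg t (time_cc ht).
have [ss vs] := slice2_int os bs; have [st vt] := slice2_int ot bt.
apply: (has_int_unique (has_intB vs vt)).
have Cs := crossing_sum_int2 (mesh_ok hG hs); have Ct := crossing_sum_int2 (mesh_ok hG ht).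
apply: (has_int_except (has_intB Cs Ct)
  (s := [seq vtx (at_time G s) k ord0 0 | k : 'I_K] ++ [seq vtx (at_time G t) k ord0 0 | k : 'I_K])).
move=> x; rewrite mem_cat negb_or => /andP[xs xt].
apply: (has_int_unique (has_intB (ss x) (st x))).
have := slice_difference hG hOm hs ht (generic2 (mesh_ok hG hs) xs) (generic2 (mesh_ok hG ht) xt).
by congr has_int; apply/funext => z; rewrite point2.
Qed.

Lemma volume_difference3 (R : realType) J K (G : evolution R 1 J K)
    (hG : evolving_polyhedral_surface G) cap Om (hOm : encloses G cap Om) s t :
  0 < s <= final_time G -> 0 < t <= final_time G ->
  fine (leb_vol (Om s)) - fine (leb_vol (Om t))
  = column_moment (at_time G s) / 6 - column_moment (at_time G t) / 6.
Proof.
move=> hs ht; case: (hOm) => [_ _ hreg _ _].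
have [os bs _] := hreg s (time_cc hs); have [ot bt _] := hreg t (time_cc ht).
have [ss bs' vs] := slice3_int os bs; have [st bt' vt] := slice3_int ot bt.
have hMs := mesh_ok hG hs; have hMt := mesh_ok hG ht.
apply: (has_int_unique (has_intB vs vt)).
apply: (has_int_except (has_intB (column_sum_int (at_time G s)) (column_sum_int (at_time G t)))
  (s := special_x (at_time G s) ++ special_x (at_time G t))).
move=> x; rewrite mem_cat negb_or => /andP[xs xt].
apply: (has_int_unique (has_intB (bs' x) (bt' x))).
apply: (has_int_except (has_intB (crossing_sum_int3_slice hMs xs) (crossing_sum_int3_slice hMt xt))
  (s := special_y (at_time G s) x ++ special_y (at_time G t) x)).
move=> y; rewrite mem_cat negb_or => /andP[ys yt].
apply: (has_int_unique (has_intB (ss x y) (st x y))).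
have := slice_difference hG hOm hs ht (generic3 hMs xs ys) (generic3 hMt xt yt).
by congr has_int; apply/funext => z; rewrite point3.
Qed.

(** * Cancellation on interior facets *)

Section FacetCancellation.
Context {R : realType} {n J K : nat} (M : mesh R n J K).
Hypothesis hM : polyhedral_surface M.

Definition facet_map (j : 'I_J) (a : 'I_n.+2) : 'I_n.+1 -> 'I_K :=
  fun m => elt M j (lift a m).

Lemma facet_mapP j a m : facet_map j a m \in facet M j a.
Proof. by apply/imsetP; exists (lift a m) => //; rewrite inE eq_sym neq_lift. Qed.

Lemma shared_facet i j a b : facet M i b = facet M j a ->
  exists s : 'S_n.+1, forall m, facet_map i b (s m) = facet_map j a m.
Proof.
move=> fe.
have h m : exists m', facet_map i b m' = facet_map j a m.
  have := facet_mapP j a m; rewrite -fe => /imsetP[k]; rewrite inE => kb ->.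
  by case: (unliftP b k) kb => [m' ->|->]; [exists m'|rewrite eqxx].
pose f m := projT1 (cid (h m)).
have fP m : facet_map i b (f m) = facet_map j a m by exact: projT2 (cid (h m)).
have fi : injective f.
  move=> m1 m2 e; have := fP m1; rewrite e fP => /(elt_inj hM) /lift_inj.
  by move=> ->.
by exists (perm fi) => m; rewrite permE.
Qed.

Lemma shared_facet_odd i j a b (s : 'S_n.+1) : i != j ->
  (forall m, facet_map i b (s m) = facet_map j a m) -> odd_perm (lift_perm a b s).
Proof.
move=> ij h; case: hM => _ _ _ _ /(_ j i a (lift_perm a b s)); rewrite eq_sym; apply=> //.
move=> k; case: (unliftP a k) => [m ->|->]; last by rewrite eqxx.
by move=> _; rewrite lift_perm_lift; exact: (h m).
Qed.

Lemma facet_opposite_uniq i a b : facet M i a = facet M i b -> a = b.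
Proof.
move=> fe; apply/eqP; rewrite -[_ == _]negbK; apply/negP => ab.
have : elt M i b \in facet M i a by apply/imsetP; exists b => //; rewrite inE eq_sym.
by rewrite fe => /imsetP[k]; rewrite inE => kb /(elt_inj hM) e; rewrite e eqxx in kb.
Qed.

Definition adjacent (p q : 'I_J * 'I_n.+2) : bool :=
  (p.1 != q.1) && (facet M p.1 p.2 == facet M q.1 q.2).

Lemma adjacent_sym p q : adjacent p q = adjacent q p.
Proof. by rewrite /adjacent eq_sym (eq_sym (facet _ _ _)). Qed.

(** Among three simplices with a common facet, the two reorderings from the
    first to the second and from the second to the third would be odd, and so
    would be the one from the first to the third; but this is their product,
    which is even. *)
Lemma adjacent_uniq p q r : adjacent p q -> adjacent p r -> q = r.
Proof.
case: p q r => [j a] [i b] [l c] /andP[/= ji /eqP fi] /andP[/= jl /eqP fl].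
have [il|il] := eqVneq i l.
  by move: fl; rewrite fi -il => /facet_opposite_uniq ->.
exfalso.
have [s hs] := shared_facet (esym fi); rewrite eq_sym in ji.
have [s' hs'] := @shared_facet l i b c (etrans (esym fl) fi).
have o1 := shared_facet_odd ji hs.
have o2 : odd_perm (lift_perm b c s') by apply: shared_facet_odd hs'; rewrite eq_sym.
have o3 : odd_perm (lift_perm a c (s * s')).
  by apply: (@shared_facet_odd l j) => [|m]; rewrite 1?eq_sym // permM hs' hs.
by move: o3; rewrite -(lift_permM a b c) odd_permM o1 o2.
Qed.

(** Stokes' theorem on the mesh. An interior facet belongs to exactly two
    simplices, which induce opposite orientations on it, so that their terms
    cancel when g is alternating. *)
Lemma facet_cancel (g : ('I_n.+1 -> 'I_K) -> R) :
  (forall f (s : 'S_n.+1), g (f \o s) = (-1) ^+ s * g f) ->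
  (forall j a, boundary_facet M j a -> g (facet_map j a) = 0) ->
  \sum_j \sum_(a < n.+2) (-1) ^+ a * g (facet_map j a) = 0.
Proof.
move=> alt g0.
pose X (p : 'I_J * 'I_n.+2) := (-1) ^+ p.2 * g (facet_map p.1 p.2).
rewrite pair_big /= -/X.
have anti p q : adjacent p q -> X p = - X q.
  case: p q => [j a] [i b] /andP[/= ji /eqP fe].
  have [s hs] := shared_facet (esym fe); rewrite eq_sym in ji.
  rewrite /X /= (_ : facet_map j a = facet_map i b \o s); last by apply/funext => m /=; rewrite hs.
  rewrite alt mulrA -signr_odd; have := shared_facet_odd ji hs.
  rewrite odd_lift_perm -[in RHS]signr_odd => o.
  rewrite -mulNr; congr (_ * _); move: o.
  by case: (odd a); case: (odd b); case: (odd_perm s) => //= _; rewrite !(expr0, expr1); ring.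
have S p : X p = \sum_(q | adjacent p q) X p.
  case: (pickP (adjacent p)) => [q pq|np].
    rewrite (bigD1 q) //= big1 ?addr0 // => r /andP[pr]; rewrite (adjacent_uniq pr pq).
    by rewrite eqxx.
  rewrite big_pred0 // /X g0 ?mulr0 //; apply/forallP => i; apply/implyP => ip.
  apply/forallP => b; apply/negP => fe; have := np (i, b).
  by rewrite /adjacent /= eq_sym ip eq_sym fe.
have e : \sum_p X p = - \sum_p X p.
  rewrite {1}(eq_bigr _ (fun p _ => S p)).
  rewrite (exchange_big_dep xpredT) //= -sumrN; apply: eq_bigr => q _.
  rewrite (eq_bigr (fun=> - X q)); last by move=> p /anti.
  rewrite (eq_bigl (adjacent q)); last by move=> p; rewrite adjacent_sym.
  by rewrite sumrN -S.
have : \sum_p X p + \sum_p X p = 0 by rewrite {1}e addNr.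
by rewrite -mulr2n => /eqP; rewrite mulrn_eq0 /= => /eqP.
Qed.

End FacetCancellation.

(** * Conservation of the volume *)

Section FluxAndMoment.
Context {R : realType} {n J K : nat}.
Variable G : evolution R n J K.
Hypothesis hd : n.+2 \in [:: 2; 3]%N.
Hypothesis hG : evolving_polyhedral_surface G.
Local Notation T := (final_time G).
Local Notation M := (at_time G).
Hypothesis still : forall s, 0 < s <= T -> vectorial (Vh0 (M s)) (velocity G s).
Variable t : R.
Hypothesis ht : 0 < t <= T.
Hypothesis flux : 0 = iph (M t) dot (fun=> velocity G t) (fun j _ => normal (M t) j).
Local Notation w j i := (nodal_velocity G t (conn G j i)).
Local Notation hM := (mesh_ok hG ht).

(** Area times normal is the wedge, up to the factor (d-1)!. *)
Lemma nodal_flux : \sum_j \sum_i dot (w j i) (wedge (M t) j) = 0.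
Proof.
have wV l : Vh (M t) (fun x => velocity G t x l 0) by case: (still ht l).
have := flux; rewrite (iph_cvg hM (c := fun j i => dot (w j i) (normal (M t) j))); last first.
  move=> j i; apply: cvg_dot => l; last exact: cvg_cst.
  by rewrite -(velocity_vtx hG _ ht); exact: (Vh_cvg hM j i (wV l)).
move=> /esym /eqP; rewrite mulf_eq0 invr_eq0 pnatr_eq0 /= => /eqP e.
transitivity (n.+1`!%:R * (0 : R)); last by rewrite mulr0.
rewrite -[in RHS]e [RHS]mulr_sumr; apply: eq_bigr => j _.
rewrite [RHS]mulrA [RHS]mulr_sumr; apply: eq_bigr => i _.
have a0 : enorm (wedge (M t) j) != 0.
  by rewrite gt_eqF // (enorm_cross_gt0 (edge_rank hM j)).
rewrite (elt_areaE hd hM) /normal dotZr.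
rewrite -[cross _]/(wedge (M t) j); by field; rewrite a0 pnatr_eq0 -lt0n fact_gt0.
Qed.

Lemma boundary_facet_still j a m : boundary_facet (M t) j a ->
  nodal_velocity G t (facet_map (M t) j a m) = 0.
Proof.
move=> b; apply: (boundary_vertex_velocity hG still ht); exists j, a; split=> //.
exact: facet_mapP.
Qed.

End FluxAndMoment.

Section MomentRate2.
Context {R : realType} {J K : nat}.
Variable G : evolution R 0 J K.
Hypothesis hG : evolving_polyhedral_surface G.
Local Notation T := (final_time G).
Local Notation M := (at_time G).
Local Notation o1 := (lift ord0 ord0 : 'I_2).
Variable t : R.
Hypothesis ht : 0 < t <= T.
Local Notation w := (nodal_velocity G t).
Hypothesis still : forall j a m, boundary_facet (M t) j a -> w (facet_map (M t) j a m) = 0.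
Hypothesis flux : \sum_j \sum_i dot (w (conn G j i)) (wedge (M t) j) = 0.

(** The derivative is the flux of [nodal_flux] plus a sum over facets, by
    integration by parts on each segment. *)
Lemma column_moment_rate2 :
  is_tderiv (V := R^o) T (fun s => column_moment (M s) : R^o) t 0.
Proof.
pose x s k : R := pos G s k ord0 0; pose z s k : R := pos G s k o1 0.
pose a k : R := w k ord0 0; pose c k : R := w k o1 0.
have dx k : is_tderiv (V := R^o) T (fun s => x s k : R^o) t (a k) by exact: (tdm_pos hG).
have dz k : is_tderiv (V := R^o) T (fun s => z s k : R^o) t (c k) by exact: (tdm_pos hG).
pose D j : R := (a (conn G j ord0) - a (conn G j o1)) * (z t (conn G j ord0) + z t (conn G j o1))
  + (x t (conn G j ord0) - x t (conn G j o1)) * (c (conn G j ord0) + c (conn G j o1)).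
have dm j := tdM ht (tdB ht (dx (conn G j ord0)) (dx (conn G j o1)))
                    (tdD (dz (conn G j ord0)) (dz (conn G j o1))).
suff <- : \sum_j D j = 0.
  have := td_sum ht (r := index_enum 'I_J) (P := xpredT) (l := D) (fun j _ => dm j).
  apply: (td_ext ht) => s hs; apply: eq_bigr => j _.
  rewrite wedged2 !big_ord_recl big_ord0 (_ : ord_max = o1); last exact: val_inj.
  by rewrite /verts /x /z /=; ring.
(* The facets of a segment are points; g is the boundary term - 2 z a of the
   integration by parts. *)
pose g (f : 'I_1 -> 'I_K) : R := - (2 * z t (f ord0) * a (f ord0)).
have facets : \sum_j \sum_(b < 2) (-1) ^+ b * g (facet_map (M t) j b) = 0.
  apply: (facet_cancel (mesh_ok hG ht)) => [f s|j b hb].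
    rewrite (_ : s = 1%g) ?odd_perm1; last by apply/permP => m; rewrite !ord1.
    by rewrite /g /= perm1 expr0 mul1r.
  by rewrite /g /a still // mxE mulr0 oppr0.
rewrite -[RHS]addr0 -[X in _ = X + _]flux -[X in _ = _ + X]facets -[RHS]big_split.
apply: eq_bigr => j _.
rewrite !big_ord_recl !big_ord0 /g /facet_map !dotE !big_ord_recl !big_ord0 /wedge !mxE.
rewrite !det2E !row_mx0 !row_mxS !mxE /= (_ : lift o1 ord0 = ord0); last exact: val_inj.
rewrite /D /x /z /a /c /verts /=.
(* What remains is a polynomial identity in the coordinates. *)
move: (pos G t (conn G j ord0)) (pos G t (conn G j o1)) => p0 p1.
move: (w (conn G j ord0)) (w (conn G j o1)) => w0 w1.
move: (p0 ord0 0) (p0 o1 0) (p1 ord0 0) (p1 o1 0)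
  (w0 ord0 0) (w0 o1 0) (w1 ord0 0) (w1 o1 0) => *.
ring.
Qed.

End MomentRate2.

Section MomentRate3.
Context {R : realType} {J K : nat}.
Variable G : evolution R 1 J K.
Hypothesis hG : evolving_polyhedral_surface G.
Local Notation T := (final_time G).
Local Notation M := (at_time G).
Local Notation o1 := (lift ord0 ord0 : 'I_3).
Local Notation o2 := (lift ord0 (lift ord0 ord0) : 'I_3).
Variable t : R.
Hypothesis ht : 0 < t <= T.
Local Notation w := (nodal_velocity G t).
Hypothesis still : forall j a m, boundary_facet (M t) j a -> w (facet_map (M t) j a m) = 0.
Hypothesis flux : \sum_j \sum_i dot (w (conn G j i)) (wedge (M t) j) = 0.

(** As in the plane, with an integration by parts on each triangle. *)
Lemma column_moment_rate3 :
  is_tderiv (V := R^o) T (fun s => column_moment (M s) : R^o) t 0.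
Proof.
pose x s k : R := pos G s k ord0 0; pose y s k : R := pos G s k o1 0.
pose z s k : R := pos G s k o2 0.
pose a k : R := w k ord0 0; pose b k : R := w k o1 0; pose c k : R := w k o2 0.
have dx k : is_tderiv (V := R^o) T (fun s => x s k : R^o) t (a k) by exact: (tdm_pos hG).
have dy k : is_tderiv (V := R^o) T (fun s => y s k : R^o) t (b k) by exact: (tdm_pos hG).
have dz k : is_tderiv (V := R^o) T (fun s => z s k : R^o) t (c k) by exact: (tdm_pos hG).
pose e j i := conn G j i.
pose D j : R :=
  ((a (e j o1) - a (e j ord0)) * (y t (e j o2) - y t (e j ord0))
   + (x t (e j o1) - x t (e j ord0)) * (b (e j o2) - b (e j ord0))
   - ((a (e j o2) - a (e j ord0)) * (y t (e j o1) - y t (e j ord0))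
      + (x t (e j o2) - x t (e j ord0)) * (b (e j o1) - b (e j ord0))))
  * (z t (e j ord0) + (z t (e j o1) + z t (e j o2)))
  + ((x t (e j o1) - x t (e j ord0)) * (y t (e j o2) - y t (e j ord0))
     - (x t (e j o2) - x t (e j ord0)) * (y t (e j o1) - y t (e j ord0)))
  * (c (e j ord0) + (c (e j o1) + c (e j o2))).
have dx' j i : is_tderiv (V := R^o) T (fun s => x s (e j i) - x s (e j ord0) : R^o) t
    (a (e j i) - a (e j ord0)) by exact: tdB.
have dy' j i : is_tderiv (V := R^o) T (fun s => y s (e j i) - y s (e j ord0) : R^o) t
    (b (e j i) - b (e j ord0)) by exact: tdB.
have dm j := tdM ht (tdB ht (tdM ht (dx' j o1) (dy' j o2)) (tdM ht (dx' j o2) (dy' j o1)))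
                    (tdD (dz (e j ord0)) (tdD (dz (e j o1)) (dz (e j o2)))).
suff <- : \sum_j D j = 0.
  have := td_sum ht (r := index_enum 'I_J) (P := xpredT) (l := D) (fun j _ => dm j).
  apply: (td_ext ht) => s hs; apply: eq_bigr => j _.
  rewrite wedged3 !big_ord_recl big_ord0 (_ : ord_max = o2); last exact: val_inj.
  rewrite /edge_area /verts /x /y /z /e /=; ring.
(* Six times the integral of z (a dy - b dx) along the edge from p to q,
   with z, a and b affine on the edge: the boundary term of Stokes' theorem
   on a triangle. *)
pose g (f : 'I_2 -> 'I_K) : R :=
  let p := f ord0 in let q := f (lift ord0 ord0) in
  (2 * z t p * a p + 2 * z t q * a q + z t p * a q + z t q * a p) * (y t q - y t p)
  - (2 * z t p * b p + 2 * z t q * b q + z t p * b q + z t q * b p) * (x t q - x t p).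
have facets : \sum_j \sum_(i < 3) (-1) ^+ i * g (facet_map (M t) j i) = 0.
  apply: (facet_cancel (mesh_ok hG ht)) => [f s|j i hi].
    have [->|s1] := eqVneq s 1%g.
      by rewrite odd_perm1 expr0 mul1r /g /= !perm1.
    have -> : s = tperm ord0 (lift ord0 ord0).
      apply/permP => m; have sn : s ord0 = lift ord0 ord0.
        apply/eqP; apply: contraNT s1 => s0; apply/eqP/permP => i; rewrite perm1.
        have s00 : s ord0 = ord0.
          by case: (unliftP ord0 (s ord0)) s0 => [i' ->|//]; rewrite (ord1 i') eqxx.
        case: (unliftP ord0 i) => [i' ->|-> //]; rewrite (ord1 i').
        case: (unliftP ord0 (s (lift ord0 ord0))) => [i'' ->|]; first by rewrite (ord1 i'').
        by rewrite -{2}s00 => /perm_inj.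
      case: (unliftP ord0 m) => [m' ->|->]; last by rewrite tpermL.
      rewrite (ord1 m') tpermR; case: (unliftP ord0 (s (lift ord0 ord0))) => [i|//].
      by rewrite (ord1 i) -{2}sn => /perm_inj.
    rewrite odd_tperm /= expr1 /g /= tpermL tpermR; move: (f ord0) (f (lift ord0 ord0)) => p q.
    by move: (x t p) (x t q) (y t p) (y t q) (z t p) (z t q) (a p) (a q) (b p) (b q) => *; ring.
  by rewrite /g /a /b !still // !mxE !mulr0 !addr0 !mul0r subr0.
rewrite -[RHS]addr0 -[X in _ = X + _]flux -[X in _ = _ + X]facets -[RHS]big_split.
apply: eq_bigr => j _.
rewrite !big_ord_recl !big_ord0 /g /facet_map !dotE !big_ord_recl !big_ord0 /wedge !mxE.
rewrite !det3E !row_mx0 !row_mxS !mxE /=.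
have -> : lift (lift ord0 ord0) ord0 = ord0 :> 'I_3 by apply: val_inj.
have -> : lift (lift ord0 ord0) (lift ord0 ord0) = o2 :> 'I_3 by apply: val_inj.
have -> : lift (lift ord0 (lift ord0 ord0)) ord0 = ord0 :> 'I_3 by apply: val_inj.
have -> : lift (lift ord0 (lift ord0 ord0)) (lift ord0 ord0) = o1 :> 'I_3 by apply: val_inj.
rewrite /D /e /x /y /z /a /b /c /verts /=.
(* What remains is a polynomial identity in the coordinates. *)
move: (pos G t (conn G j ord0)) (pos G t (conn G j o1)) (pos G t (conn G j o2)) => p0 p1 p2.
move: (w (conn G j ord0)) (w (conn G j o1)) (w (conn G j o2)) => w0 w1 w2.
move: (p0 ord0 0) (p0 o1 0) (p0 o2 0) (p1 ord0 0) (p1 o1 0) (p1 o2 0)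
  (p2 ord0 0) (p2 o1 0) (p2 o2 0) (w0 ord0 0) (w0 o1 0) (w0 o2 0)
  (w1 ord0 0) (w1 o1 0) (w1 o2 0) (w2 ord0 0) (w2 o1 0) (w2 o2 0) => *.
ring.
Qed.

End MomentRate3.

Lemma volume_conserved (R : realType) (n J K : nat) (G : evolution R n J K)
    (hd : n.+2 \in [:: 2; 3]%N) (hG : evolving_polyhedral_surface G)
    cap Om (hOm : encloses G cap Om)
    (still : forall s, 0 < s <= final_time G -> vectorial (Vh0 (at_time G s)) (velocity G s))
    t (ht : 0 < t <= final_time G) :
  0 = iph (at_time G t) dot (fun=> velocity G t) (fun j _ => normal (at_time G t) j) ->
  is_tderiv (V := R^o) (final_time G) (fun s => fine (leb_vol (Om s)) : R^o) t 0.
Proof.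
move=> S5; have flux := nodal_flux hd hG still ht S5.
have still' := boundary_facet_still hG still ht.
have affine c : is_tderiv (V := R^o) (final_time G)
      (fun s => column_moment (at_time G s) : R^o) t 0 ->
    (forall s, 0 < s <= final_time G -> fine (leb_vol (Om s)) - fine (leb_vol (Om t))
      = column_moment (at_time G s) / c - column_moment (at_time G t) / c) ->
    is_tderiv (V := R^o) (final_time G) (fun s => fine (leb_vol (Om s)) : R^o) t 0.
  move=> dm vE.
  have := tdD (td_cst (final_time G) t (fine (leb_vol (Om t)) - column_moment (at_time G t) / c))
              (tdZ ht (c := c^-1) dm).
  rewrite mulr0 addr0; apply: (td_ext ht) => s /vE e.
  by rewrite -[RHS](subrK (fine (leb_vol (Om t)))) e addrC mulrC -addrA (addrC (- _)).
case: n hd G hG cap Om hOm still ht S5 flux still' affine => [|[|n //]] hd G hG cap Om hOm still ht S5 flux still' affine.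
- by apply: (affine 2); [exact: column_moment_rate2|move=> s hs; exact: (volume_difference2 hG hOm)].
- by apply: (affine 6); [exact: column_moment_rate3|move=> s hs; exact: (volume_difference3 hG hOm)].
Qed.

Theorem theorem4p3 (R : realType) (n J K : nat) (hd : n.+2 \in [:: 2; 3]%N)
    (alpha : R) (halpha : 0 <= alpha)
    (G : evolution R n J K) (hT : 0 < final_time G)
    (hG : evolving_polyhedral_surface G)
    (cap : set 'cV[R]_n.+2) (Om : R -> set 'cV[R]_n.+2) (hOm : encloses G cap Om)
    (mu : 'cV[R]_n.+2 -> 'cV[R]_n.+2) (hmu : boundary_datum G mu)
    (kap : R -> 'cV[R]_n.+2 -> R) (k : R -> 'cV[R]_n.+2 -> 'cV[R]_n.+2)
    (lam : R -> 'cV[R]_n.+2 -> R) (p : R -> 'cV[R]_n.+2 -> 'cV[R]_n.+2)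
    (lamA lamV : R -> R)
    (hkap : VT G kap) (hk : forall i, VT G (fun t x => k t x i 0))
    (hsys : forall t : R, 0 < t <= final_time G ->
      helfrich_system G alpha mu t (kap t) (k t) (lam t) (p t) (lamA t) (lamV t))
    (htr : forall t : R, 0 < t <= final_time G -> discrete_transport G kap t) :
  forall t : R, 0 < t <= final_time G ->
    [/\ is_tderiv (V := R^o) (final_time G) (fun s => area (at_time G s)) t 0,
        is_tderiv (V := R^o) (final_time G) (fun s => fine (leb_vol (Om s))) t 0
      & exists2 dE : R,
          is_tderiv (V := R^o) (final_time G)
            (fun s => bending_energy (at_time G s) (k s)) t dE
        & dE + iph (at_time G t) *%R
                 (fun j x => dot (velocity G t x) (normal (at_time G t) j))
                 (fun j x => dot (velocity G t x) (normal (at_time G t) j)) = 0].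
Proof.
move=> t ht; split.
- exact: (area_conserved hd hG hsys ht).
- apply: (volume_conserved hd hG hOm _ ht) => [s /hsys [[]] //|].
  by have [_ _ _ _ []] := hsys _ ht.
- exact: (energy_law hd hG hkap hk hsys htr ht).
Qed.
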